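(* Let $H$ be a nonzero finite-dimensional weak Hopf algebra over a field $\Bbbk$ of characteristic $0$. Then there exists a nonzero $\Bbbk$-linear map $\Delta:H\to H\otimes H$ such that: (a) $(H,\Delta)$ is non-counital Frobenius, i.e. $\Delta$ is coassociative and is an $H$-bimodule map; (b) $\Delta$ is counital if and only if $H$ is a Frobenius algebra, equivalently, if and only if $H$ has a non-degenerate left integral; and in this case the counit of $\Delta$ is a non-degenerate left integral of $H^*$.
   Context: Non-counital Frobenius: an algebra $A$ with multiplication $m$ together with a $\Bbbk$-linear map $\Delta:A\to A\otimes A$ is non-counital Frobenius if $(\Delta\otimes \mathrm{id})\Delta=(\mathrm{id}\otimes\Delta)\Delta$ and $(\mathrm{id}\otimes m)(\Delta\otimes\mathrm{id})=\Delta m=(m\otimes\mathrm{id})(\mathrm{id}\otimes\Delta)$ (it is not required to be, but may be, counital). $\Delta$ is counital if there is a $\Bbbk$-linear $\varepsilon:A\to\Bbbk$ (the counit) with $(\varepsilon\otimes\mathrm{id})\Delta=\mathrm{id}=(\mathrm{id}\otimes\varepsilon)\Delta$. A (finite-dimensional) algebra $A$ with multiplication $m$ is Frobenius if it admits some $\Bbbk$-linear map $\Delta':A\to A\otimes A$ that is coassociative, i.e. $(\Delta'\otimes\mathrm{id})\Delta'=(\mathrm{id}\otimes\Delta')\Delta'$, counital, i.e. there is a $\Bbbk$-linear $\varepsilon':A\to\Bbbk$ with $(\varepsilon'\otimes\mathrm{id})\Delta'=\mathrm{id}=(\mathrm{id}\otimes\varepsilon')\Delta'$, and an $A$-bimodule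 map, i.e. $(\mathrm{id}\otimes m)(\Delta'\otimes\mathrm{id})=\Delta' m=(m\otimes\mathrm{id})(\mathrm{id}\otimes\Delta')$ (equivalently, it is Frobenius in the usual sense). A weak bialgebra is $(H,m,u,\Delta_{\mathrm{wk}},\varepsilon_{\mathrm{wk}})$ where $(H,m,u)$ is a (unital associative) $\Bbbk$-algebra, $(H,\Delta_{\mathrm{wk}},\varepsilon_{\mathrm{wk}})$ is a $\Bbbk$-coalgebra, and, writing $\Delta_{\mathrm{wk}}(h)=h_1\otimes h_2$, for all $a,b,c\in H$: $\Delta_{\mathrm{wk}}(ab)=\Delta_{\mathrm{wk}}(a)\Delta_{\mathrm{wk}}(b)$; $\varepsilon_{\mathrm{wk}}(abc)=\varepsilon_{\mathrm{wk}}(ab_1)\varepsilon_{\mathrm{wk}}(b_2c)=\varepsilon_{\mathrm{wk}}(ab_2)\varepsilon_{\mathrm{wk}}(b_1c)$; and $\Delta_{\mathrm{wk}}^2(1_H)=(\Delta_{\mathrm{wk}}(1_H)\otimes 1_H)(1_H\otimes\Delta_{\mathrm{wk}}(1_H))=(1_H\otimes\Delta_{\mathrm{wk}}(1_H))(\Delta_{\mathrm{wk}}(1_H)\otimes 1_H)$. The source and target counital maps are $\varepsilon_s(x)=1_1\,\varepsilon_{\mathrm{wk}}(x1_2)$ and $\varepsilon_t(x)=\varepsilon_{\mathrm{wk}}(1_1x)\,1_2$, where $1_1\otimes 1_2=\Delta_{\mathrm{wk}}(1_H)$. A weak Hopf algebra is a weak bialgebra with a $\Bbbk$-linear antipode $S:H\to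 H$ such that $S(h_1)h_2=\varepsilon_s(h)$, $h_1S(h_2)=\varepsilon_t(h)$, $S(h_1)h_2S(h_3)=S(h)$ for all $h\in H$. The linear dual $H^*$ of a finite-dimensional weak Hopf algebra is a weak Hopf algebra with the dual structure: product $(\phi\psi)(h)=\phi(h_1)\psi(h_2)$, unit $\varepsilon_{\mathrm{wk}}$, coproduct $\phi\mapsto\phi_1\otimes\phi_2$ with $\phi_1(x)\phi_2(y)=\phi(xy)$, counit $\phi\mapsto\phi(1_H)$, antipode $\phi\mapsto\phi\circ S$. A left integral of a weak Hopf algebra $H$ is $\Lambda\in H$ with $h\Lambda=\varepsilon_t(h)\Lambda$ for all $h\in H$. It is non-degenerate if the linear map $H^*\to H$, $\phi\mapsto\Lambda_1\phi(\Lambda_2)$, is bijective, where $\Lambda_1\otimes\Lambda_2=\Delta_{\mathrm{wk}}(\Lambda)$. The same definitions apply to the weak Hopf algebra $H^*$ (with $H^{**}=H$). *)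

(* Defs.v *)
From HB Require Import structures.
From mathcomp Require Import all_boot all_order all_algebra all_field.

Set Implicit Arguments.
Unset Strict Implicit.
Unset Printing Implicit Defensive.

Import GRing.Theory.
Local Open Scope ring_scope.

Reserved Notation "U *t V" (at level 40, left associativity).
Reserved Notation "u \ox v" (at level 40, left associativity).
Reserved Notation "\sweedler_ ( a , b <- t ) F"
  (at level 36, a name, b name, t at level 36, F at level 36,
   format "\sweedler_ ( a ,  b  <-  t )  F").

Reserved Notation "\dsweedler_ ( a , b <- t ) F"
  (at level 36, a name, b name, t at level 36, F at level 36,
   format "\dsweedler_ ( a ,  b  <-  t )  F").

(* The tensor product of two finite-dimensional spaces is modelled by the     *)
(* matrices of coordinates in the tensor product of their chosen bases.       *)
(* The universal property is given by [tlift_tens] and [tens_ext].           *)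
Definition tensor (K : fieldType) (U V : vectType K) : Type :=
  'M[K]_(\dim {:U}, \dim {:V}).

HB.instance Definition _ (K : fieldType) (U V : vectType K) :=
  Vector.copy (tensor U V) 'M[K]_(\dim {:U}, \dim {:V}).

Notation "U *t V" := (tensor U V) : type_scope.
Notation "U *t V" := (tensor U V) : ring_scope.

Section Tensor.
Variable K : fieldType.
Implicit Types U V W : vectType K.

Definition tens U V (u : U) (v : V) : U *t V :=
  \matrix_(i, j) (coord (vbasis {:U}) i u * coord (vbasis {:V}) j v).

(* The linear map on the tensor product induced by f; it is meaningful only   *)
(* for bilinear f, but defined for every f by its values on the basis.        *)
Definition tlift U V W (f : U -> V -> W) : 'Hom(U *t V, W) :=
  linfun (fun t : U *t V =>
    \sum_i \sum_j (t : 'M_(_, _)) i j *: f (vbasis {:U})`_i (vbasis {:V})`_j).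

End Tensor.

Notation "u \ox v" := (tens u v) : ring_scope.

(* Sweedler notation: \sweedler_(a, b <- t) F is the sum of the F over the    *)
(* pure tensors a \ox b that add up to t.                                     *)
Notation "\sweedler_ ( a , b <- t ) F" := (tlift (fun a b => F) t) : ring_scope.

Section TensorMaps.
Variable K : fieldType.
Implicit Types U V W : vectType K.

Definition tmap U V U' V' (f : 'Hom(U, U')) (g : 'Hom(V, V')) :
  'Hom(U *t V, U' *t V') := tlift (fun u v => f u \ox g v).

Definition tassoc U V W : 'Hom((U *t V) *t W, U *t (V *t W)) :=
  tlift (fun t w => \sweedler_(u, v <- t) (u \ox (v \ox w))).

Definition tassocV U V W : 'Hom(U *t (V *t W), (U *t V) *t W) :=
  tlift (fun u t => \sweedler_(v, w <- t) (u \ox v \ox w)).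

Definition tunitl V : 'Hom(K^o *t V, V) := tlift (fun (c : K^o) v => c *: v).
Definition tunitr V : 'Hom(V *t K^o, V) := tlift (fun v (c : K^o) => c *: v).

End TensorMaps.

Notation "f \ox g" := (tmap f g) : lfun_scope.

Section TensorTheory.
Variable K : fieldType.
Implicit Types U V W : vectType K.

Lemma tlift_sum U V W (f : U -> V -> W) (t : U *t V) :
  tlift f t =
  \sum_i \sum_j (t : 'M_(_, _)) i j *: f (vbasis {:U})`_i (vbasis {:V})`_j.
Proof.
pose F (s : U *t V) := \sum_i \sum_j
  (s : 'M_(_, _)) i j *: f (vbasis {:U})`_i (vbasis {:V})`_j.
have lF : linear F.
  move=> c s s'; rewrite /F scaler_sumr -big_split; apply: eq_bigr => i _ /=.
  rewrite scaler_sumr -big_split; apply: eq_bigr => j _ /=.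
  by rewrite !mxE scalerDl scalerA.
pose G : {linear U *t V -> W} :=
  HB.pack F (GRing.isLinear.Build K (U *t V) W _ F lF).
by rewrite /tlift (lfunE G t).
Qed.

Lemma tensDl U V (u u' : U) (v : V) : (u + u') \ox v = u \ox v + u' \ox v.
Proof. by apply/matrixP => i j; rewrite !mxE linearD mulrDl. Qed.

Lemma tensDr U V (u : U) (v v' : V) : u \ox (v + v') = u \ox v + u \ox v'.
Proof. by apply/matrixP => i j; rewrite !mxE linearD mulrDr. Qed.

Lemma tensZl U V c (u : U) (v : V) : (c *: u) \ox v = c *: (u \ox v).
Proof. by apply/matrixP => i j; rewrite !mxE linearZ /= mulrA. Qed.

Lemma tensZr U V c (u : U) (v : V) : u \ox (c *: v) = c *: (u \ox v).
Proof. by apply/matrixP => i j; rewrite !mxE linearZ /= mulrCA. Qed.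

Lemma tens0 U V (v : V) : (0 : U) \ox v = 0.
Proof. by rewrite -[in LHS](scale0r 0) tensZl scale0r. Qed.

Lemma tens_suml (U W : vectType K) n (u : 'I_n -> U) (w : W) :
  (\sum_i u i) \ox w = \sum_i (u i \ox w).
Proof. by elim/big_rec2: _ => [|i s s' _ <-]; rewrite ?tens0 ?tensDl. Qed.

Lemma tens_sumr (U W : vectType K) n (u : U) (w : 'I_n -> W) :
  u \ox (\sum_i w i) = \sum_i (u \ox w i).
Proof.
elim/big_rec2: _ => [|i s s' _ <-]; rewrite ?tensDr //.
by rewrite -[in LHS](scale0r 0) tensZr scale0r.
Qed.

Lemma tens_basis U V (i : 'I_(\dim {:U})) (j : 'I_(\dim {:V})) :
  (vbasis {:U})`_i \ox (vbasis {:V})`_j = delta_mx i j :> 'M_(_, _).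
Proof.
apply/matrixP => k l; rewrite !mxE !coord_free ?(basis_free (vbasisP _)) //.
by rewrite -natrM mulnb [i == k]eq_sym [j == l]eq_sym.
Qed.

Lemma tensor_sum U V (t : U *t V) :
  t = \sum_i \sum_j (t : 'M_(_, _)) i j *:
        ((vbasis {:U})`_i \ox (vbasis {:V})`_j).
Proof.
rewrite [LHS]matrix_sum_delta; apply: eq_bigr => i _; apply: eq_bigr => j _.
by rewrite tens_basis.
Qed.

Lemma tensor_ind U V (P : U *t V -> Prop) :
  (forall u v, P (u \ox v)) -> (forall s t, P s -> P t -> P (s + t)) ->
  forall t, P t.
Proof.
move=> Pp PD t; have P0 : P 0 by rewrite -(tens0 U (0 : V)).
rewrite [t]tensor_sum; elim/big_ind: _ => // i _; elim/big_ind: _ => // j _.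
by rewrite -tensZl.
Qed.

Lemma tens_ext U V W (f g : 'Hom(U *t V, W)) :
  (forall u v, f (u \ox v) = g (u \ox v)) -> f = g.
Proof.
move=> fg; apply/lfunP; elim/tensor_ind => // s t IHs IHt.
by rewrite !linearD /= IHs IHt.
Qed.

Lemma tlift_tens U V W (f : U -> V -> W) :
  (forall v, linear (f^~ v)) -> (forall u, linear (f u)) ->
  forall u v, tlift f (u \ox v) = f u v.
Proof.
move=> fl fr u v.
pose fL v' : {linear U -> W} :=
  HB.pack (f^~ v') (GRing.isLinear.Build K U W _ (f^~ v') (fl v')).
pose fR u' : {linear V -> W} :=
  HB.pack (f u') (GRing.isLinear.Build K V W _ (f u') (fr u')).
rewrite tlift_sum [RHS](_ : _ = fL v u) //.
rewrite {2}(coord_vbasis (memvf u)) linear_sum; apply: eq_bigr => i _.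
rewrite linearZ /= [f _ v](_ : _ = fR (vbasis {:U})`_i v) //.
rewrite {2}(coord_vbasis (memvf v)) linear_sum scaler_sumr.
by apply: eq_bigr => j _; rewrite linearZ /= mxE scalerA.
Qed.

Lemma tmap_tens U V U' V' (f : 'Hom(U, U')) (g : 'Hom(V, V')) u v :
  (f \ox g)%VF (u \ox v) = f u \ox g v.
Proof.
rewrite tlift_tens // => [w|w] c x y; rewrite linearP.
  by rewrite tensDl tensZl.
by rewrite tensDr tensZr.
Qed.

Lemma eq_tlift U V W (f g : U -> V -> W) t : (forall u v, f u v = g u v) ->
  tlift f t = tlift g t.
Proof.
by move=> fg; rewrite !tlift_sum; do 2!apply: eq_bigr => ? _; rewrite fg.
Qed.

Lemma tliftP U V W (f g : U -> V -> W) c t :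
  tlift (fun u v => c *: f u v + g u v) t = c *: tlift f t + tlift g t.
Proof.
rewrite !tlift_sum scaler_sumr -big_split; apply: eq_bigr => i _ /=.
rewrite scaler_sumr -big_split; apply: eq_bigr => j _ /=.
by rewrite scalerDr !scalerA mulrC.
Qed.

Lemma tassoc_tens U V W (u : U) (v : V) (w : W) :
  tassoc U V W (u \ox v \ox w) = u \ox (v \ox w).
Proof.
rewrite tlift_tens => [|w'|t] /=.
- rewrite tlift_tens // => [w'|w'] c x y; first by rewrite tensDl tensZl.
  by rewrite tensDl tensZl tensDr tensZr.
- by move=> c x y; rewrite linearP.
- by move=> c x y; rewrite -tliftP; apply: eq_tlift => *; rewrite !(tensDr, tensZr).
Qed.

Lemma tassocV_tens U V W (u : U) (v : V) (w : W) :
  tassocV U V W (u \ox (v \ox w)) = u \ox v \ox w.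
Proof.
rewrite tlift_tens => [|t|u'] /=.
- rewrite tlift_tens // => [w'|w'] c x y; last by rewrite tensDr tensZr.
  by rewrite tensDr tensZr tensDl tensZl.
- by move=> c x y; rewrite -tliftP; apply: eq_tlift => *; rewrite !(tensDl, tensZl).
- by move=> c x y; rewrite linearP.
Qed.

Lemma tunitl_tens V (c : K^o) (v : V) : tunitl V (c \ox v) = c *: v.
Proof.
rewrite tlift_tens => [//|v'|d] e x y; first by rewrite scalerDl scalerA.
by rewrite scalerDr !scalerA mulrC.
Qed.

Lemma tunitr_tens V (c : K^o) (v : V) : tunitr V (v \ox c) = c *: v.
Proof.
rewrite tlift_tens => [//|d|v'] e x y; last by rewrite scalerDl scalerA.
by rewrite scalerDr !scalerA mulrC.
Qed.

End TensorTheory.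

Section CoordForm.
Variables (K : fieldType) (V : vectType K).

Definition coordf (i : 'I_(\dim {:V})) : 'Hom(V, K^o) :=
  linfun (coord (vbasis {:V}) i : V -> K^o).

Lemma coordfE i v : coordf i v = coord (vbasis {:V}) i v.
Proof.
pose F : {linear V -> K^o} := HB.pack (coord (vbasis {:V}) i : V -> K^o)
  (GRing.isLinear.Build K V K^o _ (coord (vbasis {:V}) i : V -> K^o)
    (linearP _)).
exact: (lfunE F).
Qed.

End CoordForm.

Section TensorAlgebra.
Variables (K : fieldType) (A B : falgType K).

Definition tmul (s t : A *t B) : A *t B :=
  \sweedler_(a, b <- s) \sweedler_(a', b' <- t) ((a * a') \ox (b * b')).

Lemma tmul_tens (a a' : A) (b b' : B) :
  tmul (a \ox b) (a' \ox b') = (a * a') \ox (b * b').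
Proof.
have lr c d : forall x y, tlift (fun x y => (c * x) \ox (d * y)) (x \ox y) =
    (c * x) \ox (d * y) :> A *t B.
  apply: tlift_tens => [v|u] e x y.
    by rewrite mulrDr -scalerAr tensDl tensZl.
  by rewrite mulrDr -scalerAr tensDr tensZr.
rewrite /tmul tlift_tens ?lr // => [d|c] e x y; rewrite -tliftP;
  apply: eq_tlift => u v; rewrite mulrDl -scalerAl.
  by rewrite tensDl tensZl.
by rewrite tensDr tensZr.
Qed.

Lemma tmulDl : left_distributive tmul +%R.
Proof. by move=> s s' t; rewrite /tmul linearD. Qed.

Lemma tmulZl c s t : c *: tmul s t = tmul (c *: s) t.
Proof. by rewrite /tmul linearZ. Qed.

Lemma tmulPr s c t t' : tmul s (c *: t + t') = c *: tmul s t + tmul s t'.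
Proof. by rewrite /tmul -tliftP; apply: eq_tlift => a b; rewrite linearP. Qed.

Lemma tmulDr : right_distributive tmul +%R.
Proof. by move=> s t t'; have:= tmulPr s 1 t t'; rewrite !scale1r. Qed.

Lemma tmulZr c s t : c *: tmul s t = tmul s (c *: t).
Proof.
have t0 : tmul s 0 = 0.
  by apply: (@addrI _ (tmul s 0)); rewrite -tmulDr !addr0.
by have:= tmulPr s c t 0; rewrite t0 !addr0.
Qed.

Lemma tmulA : associative tmul.
Proof.
move=> s t u; elim/tensor_ind: s => [a b|s s' IHs IHs']; last first.
  by rewrite !tmulDl IHs IHs'.
elim/tensor_ind: t => [a' b'|t t' IHt IHt']; last first.
  by rewrite !(tmulDl, tmulDr) IHt IHt'.
elim/tensor_ind: u => [a'' b''|u u' IHu IHu']; last first.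
  by rewrite !tmulDr IHu IHu'.
by rewrite !tmul_tens !mulrA.
Qed.

Lemma tmul1l : left_id (1 \ox 1) tmul.
Proof.
elim/tensor_ind => [a b|s t IHs IHt]; first by rewrite tmul_tens !mul1r.
by rewrite tmulDr IHs IHt.
Qed.

Lemma tmul1r : right_id (1 \ox 1) tmul.
Proof.
elim/tensor_ind => [a b|s t IHs IHt]; first by rewrite tmul_tens !mulr1.
by rewrite tmulDl IHs IHt.
Qed.

Lemma tens11_neq0 : 1 \ox 1 != 0 :> A *t B.
Proof.
have [e e1] : exists e : 'Hom(A, K^o), e 1 != 0.
  have: 1 != 0 :> A := oner_neq0 _; rewrite {1}(coord_vbasis (memvf 1)).
  move/eqP => n0; case: (pickP (fun i => coord (vbasis {:A}) i 1 != 0)).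
    by move=> i ni; exists (coordf i); rewrite coordfE.
  by move=> z; case: n0; apply: big1 => i _; move/eqP: (z i) => /= ->;
    rewrite scale0r.
apply/eqP => /(congr1 (tunitl B \o (e \ox \1))%VF); rewrite linear0 comp_lfunE.
rewrite tmap_tens tunitl_tens id_lfunE => /eqP.
by rewrite scaler_eq0 (negPf e1) oner_eq0.
Qed.

HB.instance Definition _ := GRing.Zmodule_isNzRing.Build (A *t B)
  tmulA tmul1l tmul1r tmulDl tmulDr tens11_neq0.
HB.instance Definition _ := GRing.Lmodule_isLalgebra.Build K (A *t B) tmulZl.
HB.instance Definition _ := GRing.Lalgebra_isAlgebra.Build K (A *t B) tmulZr.
HB.instance Definition _ := Algebra_isFalgebra.Build K (A *t B).

Lemma tensM (a a' : A) (b b' : B) :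
  (a \ox b) * (a' \ox b') = (a * a') \ox (b * b') :> A *t B.
Proof. exact: tmul_tens. Qed.

End TensorAlgebra.

Definition tmult (K : fieldType) (A : falgType K) : 'Hom(A *t A, A) :=
  tlift (fun a b => a * b).

Lemma tmult_tens (K : fieldType) (A : falgType K) (a b : A) :
  tmult A (a \ox b) = a * b.
Proof.
rewrite tlift_tens // => [v|u] c x y; first by rewrite mulrDl scalerAl.
by rewrite mulrDr scalerAr.
Qed.

Section Coproducts.
Variables (K : fieldType).

Definition coassociative (V : vectType K) (D : 'Hom(V, V *t V)) :=
  (tassoc V V V \o (D \ox \1) \o D = (\1 \ox D) \o D)%VF.

Definition is_counit (V : vectType K) (D : 'Hom(V, V *t V)) (e : 'Hom(V, K^o)) :=
  (tunitl V \o (e \ox \1) \o D = \1)%VF /\ (tunitr V \o (\1 \ox e) \o D = \1)%VF.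

Definition counital (V : vectType K) (D : 'Hom(V, V *t V)) :=
  exists e : 'Hom(V, K^o), is_counit D e.

Definition bimodule_map (A : falgType K) (D : 'Hom(A, A *t A)) :=
  ((\1 \ox tmult A) \o tassoc A A A \o (D \ox \1) = D \o tmult A)%VF /\
  ((tmult A \ox \1) \o tassocV A A A \o (\1 \ox D) = D \o tmult A)%VF.

Definition noncounital_Frobenius (A : falgType K) (D : 'Hom(A, A *t A)) :=
  coassociative D /\ bimodule_map D.

Definition Frobenius_algebra (A : falgType K) :=
  exists D : 'Hom(A, A *t A),
    [/\ coassociative D, counital D & bimodule_map D].

End Coproducts.

(* A falgType is finite-dimensional, and nonzero since 1 != 0 in it.          *)
HB.mixin Record isWeakBialgebra (K : fieldType) H of Falgebra K H := {
  comul : 'Hom(H, H *t H);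
  counit : 'Hom(H, K^o);
  comulA : coassociative comul;
  comul_counit : is_counit comul counit;
  comulM : forall a b : H, comul (a * b) = comul a * comul b;
  counitM : forall a b c : H,
    counit (a * b * c) =
      \sweedler_(b1, b2 <- comul b) (counit (a * b1) * counit (b2 * c));
  counitM_op : forall a b c : H,
    counit (a * b * c) =
      \sweedler_(b1, b2 <- comul b) (counit (a * b2) * counit (b1 * c));
  comul1 :
    (\1 \ox comul)%VF (comul 1) =
      tassoc H H H (comul 1 \ox 1) * (1 \ox comul 1);
  comul1_op :
    (\1 \ox comul)%VF (comul 1) =
      (1 \ox comul 1) * tassoc H H H (comul 1 \ox 1) }.

#[short(type="weakBialgType")]
HB.structure Definition WeakBialgebra (K : fieldType) :=
  { H of Falgebra K H & isWeakBialgebra K H }.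

Section WeakBialgebraTheory.
Variables (K : fieldType) (H : weakBialgType K).

Definition eps_s (x : H) : H :=
  \sweedler_(a, b <- comul (1 : H)) (counit (x * b) *: a).

Definition eps_t (x : H) : H :=
  \sweedler_(a, b <- comul (1 : H)) (counit (a * x) *: b).

Definition left_integral (L : H) := forall h : H, h * L = eps_t h * L.

Definition nondegenerate_left_integral (L : H) :=
  left_integral L /\
  bijective (fun phi : 'Hom(H, K^o) => \sweedler_(a, b <- comul L) (phi b *: a)).

End WeakBialgebraTheory.

HB.mixin Record WeakBialgebra_isWeakHopf (K : fieldType) H
    of WeakBialgebra K H := {
  antipode : 'Hom(H, H);
  antipodel : forall h : H,
    \sweedler_(a, b <- comul h) (antipode a * b) = eps_s h;
  antipoder : forall h : H,
    \sweedler_(a, b <- comul h) (a * antipode b) = eps_t h;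
  antipodeK : forall h : H,
    \sweedler_(a, h' <- comul h) \sweedler_(b, c <- comul h')
      (antipode a * b * antipode c) = antipode h }.

#[short(type="weakHopfType")]
HB.structure Definition WeakHopf (K : fieldType) :=
  { H of WeakBialgebra K H & WeakBialgebra_isWeakHopf K H }.

Section SweedlerTheory.
Variable K : fieldType.
Implicit Types U V W X : vectType K.

Lemma lfun_tlift U V W X (g : 'Hom(W, X)) (f : U -> V -> W) t :
  g (tlift f t) = tlift (fun u v => g (f u v)) t.
Proof.
rewrite !tlift_sum linear_sum; apply: eq_bigr => i _.
by rewrite linear_sum; apply: eq_bigr => j _; rewrite linearZ.
Qed.

Lemma tlift_lfunE U V W X (f : U -> V -> 'Hom(W, X)) t w :
  tlift f t w = tlift (fun u v => f u v w) t.
Proof.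
rewrite !tlift_sum sum_lfunE; apply: eq_bigr => i _.
by rewrite sum_lfunE; apply: eq_bigr => j _; rewrite scale_lfunE.
Qed.

Lemma exchange_tlift U V U' V' W (f : U -> V -> U' -> V' -> W) s t :
  \sweedler_(u, v <- s) \sweedler_(u', v' <- t) f u v u' v' =
  \sweedler_(u', v' <- t) \sweedler_(u, v <- s) f u v u' v'.
Proof.
rewrite !tlift_sum.
transitivity (\sum_i \sum_j \sum_k \sum_l ((s : 'M_(_, _)) i j *
  (t : 'M_(_, _)) k l) *: f (vbasis {:U})`_i (vbasis {:V})`_j
    (vbasis {:U'})`_k (vbasis {:V'})`_l).
  apply: eq_bigr => i _; apply: eq_bigr => j _; rewrite tlift_sum scaler_sumr.
  apply: eq_bigr => k _; rewrite scaler_sumr.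
  by apply: eq_bigr => l _; rewrite scalerA.
under eq_bigr do rewrite exchange_big.
rewrite exchange_big; apply: eq_bigr => k _.
under eq_bigr do rewrite exchange_big.
rewrite exchange_big; apply: eq_bigr => l _ /=.
rewrite tlift_sum scaler_sumr; apply: eq_bigr => i _.
by rewrite scaler_sumr; apply: eq_bigr => j _; rewrite scalerA [in RHS]mulrC.
Qed.

Lemma tliftZ U V W (f : U -> V -> W) c t :
  \sweedler_(u, v <- t) (c *: f u v) = c *: tlift f t.
Proof.
rewrite !tlift_sum scaler_sumr; apply: eq_bigr => i _; rewrite scaler_sumr.
by apply: eq_bigr => j _; rewrite !scalerA mulrC.
Qed.

Lemma tlift_mull U V (f : U -> V -> K^o) (c : K^o) t :
  c * tlift f t = \sweedler_(u, v <- t) (c * f u v).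
Proof. by rewrite (tliftZ f c t). Qed.

Lemma tlift_mulr U V (f : U -> V -> K^o) (c : K^o) t :
  tlift f t * c = \sweedler_(u, v <- t) (f u v * c).
Proof. by rewrite mulrC tlift_mull; apply: eq_tlift => u v; rewrite mulrC. Qed.

Lemma tlift_form U V (f : 'Hom(U, K^o)) (g : 'Hom(V, K^o)) u v :
  \sweedler_(a, b <- (u \ox v)) (f a * g b) = f u * g v.
Proof.
rewrite (tlift_tens (f := fun a b => f a * g b)) // => w c x y; rewrite linearP.
  by rewrite mulrDl -scalerAl.
by rewrite mulrDr -scalerAr.
Qed.

Lemma tlift_tensE U V (t : U *t V) : \sweedler_(u, v <- t) (u \ox v) = t.
Proof. by rewrite tlift_sum [RHS]tensor_sum. Qed.

End SweedlerTheory.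

(* An alias of 'Hom(V, K^o), carrying the dual weak Hopf algebra structure.   *)
Definition dual (K : fieldType) (V : vectType K) : Type := 'Hom(V, K^o).

HB.instance Definition _ (K : fieldType) (V : vectType K) :=
  Vector.copy (dual V) 'Hom(V, K^o).

Section DualSpace.
Variables (K : fieldType) (V : vectType K).
Implicit Types (phi : dual V) (t : dual V *t dual V) (x y z : V).

Definition tev x y : 'Hom(dual V *t dual V, K^o) :=
  tlift (fun phi psi : dual V => phi x * psi y).

Lemma linear_ev x : linear (fun phi : dual V => phi x).
Proof. by move=> c phi psi; rewrite add_lfunE scale_lfunE. Qed.

Lemma tev_tens x y (phi psi : dual V) : tev x y (phi \ox psi) = phi x * psi y.
Proof.
rewrite /tev tlift_tens // => w c a b; rewrite linear_ev.
  by rewrite mulrDl -scalerAl.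
by rewrite mulrDr -scalerAr.
Qed.

Lemma dual_sum phi : phi = \sum_(i < \dim {:V}) phi (vbasis {:V})`_i *: coordf i.
Proof.
apply/lfunP => x; rewrite sum_lfunE [in LHS](coord_vbasis (memvf x)) linear_sum.
by apply: eq_bigr => i _; rewrite scale_lfunE coordfE linearZ; exact: mulrC.
Qed.

Lemma tev_sum t :
  t = \sum_(i < \dim {:V}) \sum_(j < \dim {:V})
        tev (vbasis {:V})`_i (vbasis {:V})`_j t *:
        (coordf i \ox coordf j : dual V *t dual V).
Proof.
elim/tensor_ind: t => [phi psi|s t {1}-> {1}->].
  rewrite [in LHS](dual_sum phi) tens_suml; apply: eq_bigr => i _.
  rewrite [in LHS](dual_sum psi) tens_sumr; apply: eq_bigr => j _.
  by rewrite tensZl tensZr scalerA tev_tens.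
rewrite -big_split; apply: eq_bigr => i _; rewrite -big_split.
by apply: eq_bigr => j _; rewrite linearD scalerDl.
Qed.

Lemma tev_inj s t : (forall x y, tev x y s = tev x y t) -> s = t.
Proof.
move=> st; rewrite [s]tev_sum [t]tev_sum.
by apply: eq_bigr => i _; apply: eq_bigr => j _; rewrite st.
Qed.

Definition tev3 x y z : 'Hom(dual V *t (dual V *t dual V), K^o) :=
  tlift (fun (phi : dual V) t => phi x * tev y z t).

Lemma tev3_tens x y z phi t : tev3 x y z (phi \ox t) = phi x * tev y z t.
Proof.
rewrite /tev3 tlift_tens // => [s|psi] c a b.
  by rewrite linear_ev mulrDl -scalerAl.
by rewrite linearP mulrDr -scalerAr.
Qed.

Lemma tev3_sum (t : dual V *t (dual V *t dual V)) :
  t = \sum_(i < \dim {:V}) \sum_(j < \dim {:V}) \sum_(k < \dim {:V})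
    tev3 (vbasis {:V})`_i (vbasis {:V})`_j (vbasis {:V})`_k t *:
    ((coordf i : dual V) \ox (coordf j \ox coordf k : dual V *t dual V)).
Proof.
elim/tensor_ind: t => [phi psi|s t {1}-> {1}->].
  rewrite [in LHS](dual_sum phi) tens_suml; apply: eq_bigr => i _.
  rewrite [in LHS](tev_sum psi) tens_sumr; apply: eq_bigr => j _.
  rewrite tens_sumr; apply: eq_bigr => k _.
  by rewrite tensZl tensZr scalerA tev3_tens.
rewrite -big_split; apply: eq_bigr => i _; rewrite -big_split.
apply: eq_bigr => j _; rewrite -big_split.
by apply: eq_bigr => k _; rewrite linearD scalerDl.
Qed.

Lemma tev3_inj (s t : dual V *t (dual V *t dual V)) : (forall x y z, tev3 x y z s = tev3 x y z t) -> s = t.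
Proof.
move=> st; rewrite [s]tev3_sum [t]tev3_sum.
by do 3!(apply: eq_bigr => ? _); rewrite st.
Qed.

Lemma tev3_tassoc x y z t phi :
  tev3 x y z (tassoc _ _ _ (t \ox phi)) = tev x y t * phi z.
Proof.
elim/tensor_ind: t => [a b|s t IHs IHt].
  by rewrite tassoc_tens tev3_tens !tev_tens mulrA.
by rewrite tensDl !linearD /= IHs IHt mulrDl.
Qed.

End DualSpace.

Section DualAlgebra.
Variables (K : fieldType) (H : weakBialgType K).
Implicit Types (phi psi chi : dual H) (x y h : H).

Definition dual_mul phi psi : dual H :=
  (tlift (fun a b => phi a * psi b : K^o) \o comul)%VF.

Definition dual_one : dual H := counit.

Lemma dual_mulE phi psi h :
  dual_mul phi psi h = \sweedler_(a, b <- comul h) (phi a * psi b).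
Proof. by rewrite comp_lfunE. Qed.

Lemma dual_mulA : associative dual_mul.
Proof.
move=> phi psi chi; apply/lfunP => h.
have e1 (t : H *t H) : \sweedler_(a, b <- t) (phi a * dual_mul psi chi b) =
    tlift (fun a s => phi a * \sweedler_(b, c <- s) (psi b * chi c))
      ((\1 \ox comul)%VF t).
  elim/tensor_ind: t => [a b|s t IHs IHt]; last by rewrite !linearD /= IHs IHt.
  rewrite tlift_form tmap_tens id_lfunE tlift_tens ?dual_mulE //.
    by move=> w c u v; rewrite linearP mulrDl -scalerAl.
  by move=> w c u v; rewrite linearP mulrDr -scalerAr.
have e2 (t : H *t H) : \sweedler_(a, b <- t) (dual_mul phi psi a * chi b) =
    tlift (fun a s => phi a * \sweedler_(b, c <- s) (psi b * chi c))
      (tassoc H H H ((comul \ox \1)%VF t)).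
  elim/tensor_ind: t => [a b|s t IHs IHt]; last by rewrite !linearD /= IHs IHt.
  rewrite tlift_form tmap_tens id_lfunE dual_mulE; move: (comul a) => {a} s.
  elim/tensor_ind: s => [a c|s t IHs IHt].
    rewrite tlift_form tassoc_tens tlift_tens ?tlift_form ?mulrA //.
      by move=> w d u v; rewrite linearP mulrDl -scalerAl.
    by move=> w d u v; rewrite linearP mulrDr -scalerAr.
  by rewrite tensDl !linearD mulrDl /= IHs IHt.
rewrite !dual_mulE e1 e2; have /lfunP/(_ h) := @comulA K H.
by rewrite !comp_lfunE => ->.
Qed.

Lemma dual_mulPl c phi phi' psi :
  dual_mul (c *: phi + phi') psi = c *: dual_mul phi psi + dual_mul phi' psi.
Proof.
apply/lfunP => h; rewrite add_lfunE scale_lfunE !dual_mulE -tliftP.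
by apply: eq_tlift => a b; rewrite add_lfunE scale_lfunE mulrDl -scalerAl.
Qed.

Lemma dual_mulPr c phi psi psi' :
  dual_mul phi (c *: psi + psi') = c *: dual_mul phi psi + dual_mul phi psi'.
Proof.
apply/lfunP => h; rewrite add_lfunE scale_lfunE !dual_mulE -tliftP.
by apply: eq_tlift => a b; rewrite add_lfunE scale_lfunE mulrDr -scalerAr.
Qed.

Lemma dual_mulDl : left_distributive dual_mul +%R.
Proof. by move=> p q r; have:= dual_mulPl 1 p q r; rewrite !scale1r. Qed.

Lemma dual_mulDr : right_distributive dual_mul +%R.
Proof. by move=> p q r; have:= dual_mulPr 1 p q r; rewrite !scale1r. Qed.

Lemma dual_mulZl c phi psi :
  c *: dual_mul phi psi = dual_mul (c *: phi) psi.
Proof.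
have z : dual_mul 0 psi = 0.
  by apply: (@addrI _ (dual_mul 0 psi)); rewrite -dual_mulDl !addr0.
by have:= dual_mulPl c phi 0 psi; rewrite z !addr0.
Qed.

Lemma dual_mulZr c phi psi :
  c *: dual_mul phi psi = dual_mul phi (c *: psi).
Proof.
have z : dual_mul phi 0 = 0.
  by apply: (@addrI _ (dual_mul phi 0)); rewrite -dual_mulDr !addr0.
by have:= dual_mulPr c phi psi 0; rewrite z !addr0.
Qed.

Lemma dual_mul1l : left_id dual_one dual_mul.
Proof.
move=> phi; apply/lfunP => h; rewrite dual_mulE.
have [/lfunP/(_ h) + _] := @comul_counit K H; rewrite !comp_lfunE id_lfunE.
move=> {2}<-; elim/tensor_ind: (comul h) => [a b|s t IHs IHt].
  by rewrite tlift_form tmap_tens id_lfunE tunitl_tens linearZ.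
by rewrite !linearD /= IHs IHt.
Qed.

Lemma dual_mul1r : right_id dual_one dual_mul.
Proof.
move=> phi; apply/lfunP => h; rewrite dual_mulE.
have [_ /lfunP/(_ h)] := @comul_counit K H; rewrite !comp_lfunE id_lfunE.
move=> {2}<-; elim/tensor_ind: (comul h) => [a b|s t IHs IHt].
  by rewrite tlift_form tmap_tens id_lfunE tunitr_tens linearZ /= mulrC.
by rewrite !linearD /= IHs IHt.
Qed.

Lemma dual_one_neq0 : dual_one != 0.
Proof.
apply/eqP => e0; have /eqP[] := oner_neq0 H.
have [/lfunP/(_ 1) + _] := @comul_counit K H; rewrite !comp_lfunE id_lfunE.
move=> <-; elim/tensor_ind: (comul 1) => [a b|s t IHs IHt].
  rewrite tmap_tens tunitl_tens -[counit]/dual_one e0.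
  by rewrite [X in X *: _]zero_lfunE scale0r.
by rewrite !linearD /= IHs IHt addr0.
Qed.

HB.instance Definition _ := GRing.Zmodule_isNzRing.Build (dual H)
  dual_mulA dual_mul1l dual_mul1r dual_mulDl dual_mulDr dual_one_neq0.
HB.instance Definition _ := GRing.Lmodule_isLalgebra.Build K (dual H) dual_mulZl.
HB.instance Definition _ := GRing.Lalgebra_isAlgebra.Build K (dual H) dual_mulZr.
HB.instance Definition _ := Algebra_isFalgebra.Build K (dual H).

Lemma dualM phi psi h :
  (phi * psi : dual H) h = \sweedler_(a, b <- comul h) (phi a * psi b).
Proof. exact: dual_mulE. Qed.

(* The transpose of the product: by [tev_dual_comul] and [tev_inj], it is the *)
(* only map with phi_1(x) phi_2(y) = phi(xy), where phi_1 \ox phi_2 denotes   *)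
(* the image of phi.                                                          *)
Definition dual_comul : 'Hom(dual H, dual H *t dual H) :=
  linfun (fun phi : dual H => \sum_(i < \dim {:H}) \sum_(j < \dim {:H})
    phi ((vbasis {:H})`_i * (vbasis {:H})`_j) *:
      (coordf i \ox coordf j : dual H *t dual H)).

Definition dual_counit : 'Hom(dual H, K^o) := linfun (fun phi : dual H => phi 1).

Lemma dual_counitE phi : dual_counit phi = phi 1.
Proof.
pose F (psi : dual H) : K^o := psi 1.
pose G : {linear dual H -> K^o} :=
  HB.pack F (GRing.isLinear.Build K (dual H) K^o _ F (linear_ev 1)).
exact: (lfunE G).
Qed.

Lemma tev_dual_comul x y phi : tev x y (dual_comul phi) = phi (x * y).
Proof.
pose F (psi : dual H) : dual H *t dual H := \sum_(i < \dim {:H}) \sum_(j < \dim {:H})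
    psi ((vbasis {:H})`_i * (vbasis {:H})`_j) *:
      (coordf i \ox coordf j : dual H *t dual H).
have lF : linear F.
  move=> c s s'; rewrite /F scaler_sumr -big_split; apply: eq_bigr => i _ /=.
  rewrite scaler_sumr -big_split; apply: eq_bigr => j _ /=.
  by rewrite add_lfunE scale_lfunE scalerDl scalerA.
pose G : {linear dual H -> dual H *t dual H} :=
  HB.pack F (GRing.isLinear.Build K (dual H) (dual H *t dual H) _ F lF).
rewrite /dual_comul (lfunE G) /= /F linear_sum.
rewrite {2}(coord_vbasis (memvf x)) mulr_suml linear_sum.
apply: eq_bigr => i _; rewrite !linear_sum.
rewrite {2}(coord_vbasis (memvf y)) mulr_sumr linear_sum.
apply: eq_bigr => j _; rewrite linearZ /= tev_tens !coordfE.
by rewrite -scalerAl -scalerAr !linearZ; congr (_ *: _); exact: mulrC.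
Qed.

End DualAlgebra.

Section SweedlerAlgebra.
Variable K : fieldType.

Lemma tlift_tensl (U V W X : vectType K) (f : U -> V -> W) t (w : X) :
  tlift f t \ox w = \sweedler_(u, v <- t) (f u v \ox w).
Proof.
rewrite !tlift_sum tens_suml; apply: eq_bigr => i _; rewrite tens_suml.
by apply: eq_bigr => j _; rewrite tensZl.
Qed.

Lemma tlift_tensr (U V W X : vectType K) (f : U -> V -> W) t (w : X) :
  w \ox tlift f t = \sweedler_(u, v <- t) (w \ox f u v).
Proof.
rewrite !tlift_sum tens_sumr; apply: eq_bigr => i _; rewrite tens_sumr.
by apply: eq_bigr => j _; rewrite tensZr.
Qed.

Lemma mul_tliftl (U V : vectType K) (A : falgType K) (f : U -> V -> A) t c :
  tlift f t * c = \sweedler_(u, v <- t) (f u v * c).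
Proof.
rewrite !tlift_sum mulr_suml; apply: eq_bigr => i _; rewrite mulr_suml.
by apply: eq_bigr => j _; rewrite scalerAl.
Qed.

Lemma mul_tliftr (U V : vectType K) (A : falgType K) (f : U -> V -> A) t c :
  c * tlift f t = \sweedler_(u, v <- t) (c * f u v).
Proof.
rewrite !tlift_sum mulr_sumr; apply: eq_bigr => i _; rewrite mulr_sumr.
by apply: eq_bigr => j _; rewrite scalerAr.
Qed.

End SweedlerAlgebra.

Section DualWeakBialgebra.
Variables (K : fieldType) (H : weakBialgType K).
Implicit Types (phi psi chi : dual H) (x y z h : H).

Local Notation Dd := (dual_comul H).
Local Notation "\dsweedler_ ( a , b <- t ) F" :=
  (tlift (fun a b : dual H => F) t) : ring_scope.

Lemma tev_mul x y (s t : dual H *t dual H) : tev x y (s * t) =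
  \sweedler_(a, a' <- comul x) \sweedler_(b, b' <- comul y)
    (tev a b s * tev a' b' t).
Proof.
elim/tensor_ind: s => [p q|s s' IHs IHs']; last first.
  rewrite mulrDl linearD /= IHs IHs' -(scale1r (tlift _ _)) -tliftP.
  apply: eq_tlift => a a'; rewrite scale1r -(scale1r (tlift _ _)) -tliftP.
  by apply: eq_tlift => b b'; rewrite scale1r linearD mulrDl.
elim/tensor_ind: t => [p' q'|t t' IHt IHt']; last first.
  rewrite mulrDr linearD /= IHt IHt' -(scale1r (tlift _ _)) -tliftP.
  apply: eq_tlift => a a'; rewrite scale1r -(scale1r (tlift _ _)) -tliftP.
  by apply: eq_tlift => b b'; rewrite scale1r linearD mulrDr.
rewrite tensM tev_tens !dualM tlift_mulr; apply: eq_tlift => a a'.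
by rewrite tlift_mull; apply: eq_tlift => b b'; rewrite !tev_tens mulrACA.
Qed.

Lemma tev3_comull x y z (t : dual H *t dual H) :
  tev3 x y z (tassoc _ _ _ ((Dd \ox \1)%VF t)) = tev (x * y) z t.
Proof.
elim/tensor_ind: t => [p q|s t IHs IHt]; last by rewrite !linearD /= IHs IHt.
by rewrite tmap_tens id_lfunE tev3_tassoc tev_dual_comul tev_tens.
Qed.

Lemma tev3_comulr x y z (t : dual H *t dual H) : tev3 x y z ((\1 \ox Dd)%VF t) = tev x (y * z) t.
Proof.
elim/tensor_ind: t => [p q|s t IHs IHt]; last by rewrite !linearD /= IHs IHt.
by rewrite tmap_tens id_lfunE tev3_tens tev_dual_comul tev_tens.
Qed.

Lemma dual_comulA : coassociative Dd.
Proof.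
apply/lfunP => phi; rewrite !comp_lfunE; apply: tev3_inj => x y z.
by rewrite tev3_comull tev3_comulr !tev_dual_comul mulrA.
Qed.

Lemma dual_comul_counit : is_counit Dd (dual_counit H).
Proof.
split; apply/lfunP => phi; rewrite !comp_lfunE id_lfunE; apply/lfunP => h.
  rewrite -[in RHS](mul1r h) -tev_dual_comul.
  elim/tensor_ind: (Dd phi) => [p q|s t IHs IHt].
    by rewrite tmap_tens id_lfunE tunitl_tens dual_counitE scale_lfunE tev_tens.
  by rewrite !linearD add_lfunE /= IHs IHt.
rewrite -[in RHS](mulr1 h) -tev_dual_comul.
elim/tensor_ind: (Dd phi) => [p q|s t IHs IHt].
  rewrite tmap_tens id_lfunE tunitr_tens dual_counitE scale_lfunE tev_tens.
  exact: mulrC.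
by rewrite !linearD add_lfunE /= IHs IHt.
Qed.

Lemma form_mul (phi psi : dual H) (X Y : H *t H) :
  \sweedler_(a, a' <- X) \sweedler_(b, b' <- Y) (phi (a * b) * psi (a' * b')) =
  \sweedler_(a, b <- X * Y) (phi a * psi b) :> K^o.
Proof.
rewrite -[X * Y]/(tmul X Y) /tmul lfun_tlift; apply: eq_tlift => a a'.
by rewrite lfun_tlift; apply: eq_tlift => b b'; rewrite tlift_form.
Qed.

Lemma dual_comulM phi psi : Dd (phi * psi) = Dd phi * Dd psi.
Proof.
apply: tev_inj => x y; rewrite tev_dual_comul dualM tev_mul comulM -form_mul.
by do 2!apply: eq_tlift => ? ?; rewrite !tev_dual_comul.
Qed.

Definition form3 phi psi chi : 'Hom(H *t (H *t H), K^o) :=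
  tlift (fun a t => phi a * \sweedler_(b, c <- t) (psi b * chi c)).

Lemma form3_tens phi psi chi a b c :
  form3 phi psi chi (a \ox (b \ox c)) = phi a * psi b * chi c.
Proof.
rewrite /form3 tlift_tens ?tlift_form ?mulrA //.
  by move=> w d u v; rewrite linearP mulrDl -scalerAl.
by move=> w d u v; rewrite linearP mulrDr -scalerAr.
Qed.

Lemma dual_counitM3 phi psi chi :
  dual_counit H (phi * psi * chi) =
    form3 phi psi chi ((\1 \ox comul)%VF (comul 1)).
Proof.
rewrite dual_counitE -mulrA dualM /form3.
elim/tensor_ind: (comul 1) => [a b|s t IHs IHt].
  rewrite tlift_form tmap_tens id_lfunE tlift_tens ?dualM //.
    by move=> w d u v; rewrite linearP mulrDl -scalerAl.
  by move=> w d u v; rewrite linearP mulrDr -scalerAr.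
by rewrite !linearD /= IHs IHt.
Qed.

Lemma form3_mul phi psi chi (X Y : H *t H) :
  form3 phi psi chi (tassoc H H H (X \ox 1) * (1 \ox Y)) =
  \sweedler_(a, b <- X) \sweedler_(c, d <- Y) (phi a * psi (b * c) * chi d).
Proof.
rewrite -[in LHS](tlift_tensE X) -[in LHS](tlift_tensE Y).
rewrite tlift_tensl [tassoc _ _ _ _]lfun_tlift mul_tliftl lfun_tlift; apply: eq_tlift => a b.
rewrite tlift_tensr mul_tliftr lfun_tlift; apply: eq_tlift => c d.
by rewrite tassoc_tens !tensM form3_tens mulr1 mul1r.
Qed.

Lemma form3_mul_op phi psi chi (X Y : H *t H) :
  form3 phi psi chi ((1 \ox Y) * tassoc H H H (X \ox 1)) =
  \sweedler_(a, b <- X) \sweedler_(c, d <- Y) (phi a * psi (c * b) * chi d).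
Proof.
rewrite -[in LHS](tlift_tensE X) -[in LHS](tlift_tensE Y).
rewrite tlift_tensl [tassoc _ _ _ _]lfun_tlift mul_tliftr lfun_tlift; apply: eq_tlift => a b.
rewrite tlift_tensr mul_tliftl lfun_tlift; apply: eq_tlift => c d.
by rewrite tassoc_tens !tensM form3_tens mulr1 mul1r.
Qed.

Lemma dual_counitM phi psi chi :
  dual_counit H (phi * psi * chi) = \dsweedler_(p, q <- Dd psi)
    (dual_counit H (phi * p) * dual_counit H (q * chi)).
Proof.
rewrite dual_counitM3 comul1 form3_mul.
transitivity (\dsweedler_(p, q <- Dd psi)
  \sweedler_(a, b <- comul (1 : H)) \sweedler_(c, d <- comul (1 : H))
    (phi a * (p b * q c) * chi d)); last first.
  apply: eq_tlift => p q; rewrite !dual_counitE !dualM tlift_mulr.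
  apply: eq_tlift => a b; rewrite tlift_mull.
  by apply: eq_tlift => c d; rewrite !mulrA.
rewrite [RHS]exchange_tlift; apply: eq_tlift => a b.
rewrite [RHS]exchange_tlift; apply: eq_tlift => c d.
by rewrite -tev_dual_comul -tlift_mulr -tlift_mull.
Qed.

Lemma dual_counitM_op phi psi chi :
  dual_counit H (phi * psi * chi) = \dsweedler_(p, q <- Dd psi)
    (dual_counit H (phi * q) * dual_counit H (p * chi)).
Proof.
rewrite dual_counitM3 comul1_op form3_mul_op.
transitivity (\dsweedler_(p, q <- Dd psi)
  \sweedler_(a, b <- comul (1 : H)) \sweedler_(c, d <- comul (1 : H))
    (phi a * (p c * q b) * chi d)); last first.
  apply: eq_tlift => p q; rewrite !dual_counitE !dualM tlift_mulr.
  apply: eq_tlift => a b; rewrite tlift_mull.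
  by apply: eq_tlift => c d; rewrite [p c * q b]mulrC !mulrA.
rewrite [RHS]exchange_tlift; apply: eq_tlift => a b.
rewrite [RHS]exchange_tlift; apply: eq_tlift => c d.
by rewrite -tev_dual_comul -tlift_mulr -tlift_mull.
Qed.

Lemma tev3_mul x y z (s t : dual H *t dual H) :
  tev3 x y z (tassoc _ _ _ (s \ox 1) * (1 \ox t)) =
  \sweedler_(b, c <- comul y) (tev x b s * tev c z t).
Proof.
rewrite -[in LHS](tlift_tensE s) -[in LHS](tlift_tensE t).
rewrite tlift_tensl [tassoc _ _ _ _]lfun_tlift mul_tliftl lfun_tlift.
under eq_tlift => p q do rewrite tlift_tensr mul_tliftr lfun_tlift.
transitivity (\dsweedler_(p, q <- s) \dsweedler_(p', q' <- t)
  \sweedler_(b, c <- comul y) (p x * q b * (p' c * q' z))).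
  apply: eq_tlift => p q; apply: eq_tlift => p' q'.
  rewrite tassoc_tens !tensM mulr1 mul1r tev3_tens tev_tens dualM tlift_mulr.
  by rewrite tlift_mull; apply: eq_tlift => b c; rewrite !mulrA.
under eq_tlift => p q do rewrite exchange_tlift.
rewrite exchange_tlift; apply: eq_tlift => b c.
rewrite [tev x b s * _]tlift_mulr; apply: eq_tlift => p q.
by rewrite -tlift_mull.
Qed.

Lemma tev3_mul_op x y z (s t : dual H *t dual H) :
  tev3 x y z ((1 \ox t) * tassoc _ _ _ (s \ox 1)) =
  \sweedler_(b, c <- comul y) (tev x c s * tev b z t).
Proof.
rewrite -[in LHS](tlift_tensE s) -[in LHS](tlift_tensE t).
rewrite tlift_tensl [tassoc _ _ _ _]lfun_tlift mul_tliftr lfun_tlift.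
under eq_tlift => p q do rewrite tlift_tensr mul_tliftl lfun_tlift.
transitivity (\dsweedler_(p, q <- s) \dsweedler_(p', q' <- t)
  \sweedler_(b, c <- comul y) (p x * q c * (p' b * q' z))).
  apply: eq_tlift => p q; apply: eq_tlift => p' q'.
  rewrite tassoc_tens !tensM mulr1 mul1r tev3_tens tev_tens dualM tlift_mulr.
  rewrite tlift_mull; apply: eq_tlift => b c.
  by rewrite [p' b * q c]mulrC !mulrA.
under eq_tlift => p q do rewrite exchange_tlift.
rewrite exchange_tlift; apply: eq_tlift => b c.
rewrite [tev x c s * _]tlift_mulr; apply: eq_tlift => p q.
by rewrite -tlift_mull.
Qed.

Lemma dual_comul1 :
  (\1 \ox Dd)%VF (Dd 1) = tassoc _ _ _ (Dd 1 \ox 1) * (1 \ox Dd 1).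
Proof.
apply: tev3_inj => x y z; rewrite tev3_comulr tev_dual_comul tev3_mul mulrA.
under eq_tlift => b c do rewrite !tev_dual_comul.
exact: counitM.
Qed.

Lemma dual_comul1_op :
  (\1 \ox Dd)%VF (Dd 1) = (1 \ox Dd 1) * tassoc _ _ _ (Dd 1 \ox 1).
Proof.
apply: tev3_inj => x y z; rewrite tev3_comulr tev_dual_comul tev3_mul_op mulrA.
under eq_tlift => b c do rewrite !tev_dual_comul.
exact: counitM_op.
Qed.

HB.instance Definition _ := isWeakBialgebra.Build K (dual H)
  dual_comulA dual_comul_counit dual_comulM dual_counitM dual_counitM_op
  dual_comul1 dual_comul1_op.

End DualWeakBialgebra.

Section DualWeakHopf.
Variables (K : fieldType) (H : weakHopfType K).
Implicit Types (phi psi chi : dual H) (x y z h : H).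

Local Notation "\dsweedler_ ( a , b <- t ) F" :=
  (tlift (fun a b : dual H => F) t) : ring_scope.

Definition dual_antipode : 'Hom(dual H, dual H) :=
  linfun (fun phi : dual H => (phi \o antipode)%VF : dual H).

Lemma dual_antipodeE phi h : dual_antipode phi h = phi (antipode h).
Proof.
pose F (psi : dual H) : dual H := (psi \o antipode)%VF.
have lF : linear F.
  move=> c p q; apply/lfunP => x.
  by rewrite !(add_lfunE, scale_lfunE, comp_lfunE).
pose G : {linear dual H -> dual H} :=
  HB.pack F (GRing.isLinear.Build K (dual H) (dual H) _ F lF).
by rewrite /dual_antipode (lfunE G) comp_lfunE.
Qed.

Lemma dual_antipodel phi :
  \dsweedler_(p, q <- comul phi) (dual_antipode p * q) = eps_s phi.
Proof.
apply/lfunP => h; rewrite /eps_s !tlift_lfunE.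
transitivity (\dsweedler_(p, q <- comul phi) \sweedler_(a, b <- comul h)
    (p (antipode a) * q b)).
  apply: eq_tlift => p q; rewrite dualM.
  by apply: eq_tlift => a b; rewrite dual_antipodeE.
rewrite exchange_tlift.
transitivity (phi (eps_s h)).
  rewrite -antipodel lfun_tlift; apply: eq_tlift => a b.
  by rewrite -tev_dual_comul.
transitivity (\dsweedler_(p, q <- comul (1 : dual H))
    \sweedler_(c, d <- comul (1 : H)) (phi c * (p h * q d))); last first.
  apply: eq_tlift => p q; rewrite scale_lfunE.
  rewrite [counit _](dual_counitE (phi * q)) dualM.
  rewrite [RHS]tlift_mulr; apply: eq_tlift => c d.
  by rewrite -mulrA [q d * _]mulrC.
rewrite exchange_tlift lfun_tlift; apply: eq_tlift => c d.
rewrite -tlift_mull linearZ /=.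
rewrite [\dsweedler_(p, q <- _) _](tev_dual_comul h d 1); exact: mulrC.
Qed.

Lemma dual_antipoder phi :
  \dsweedler_(p, q <- comul phi) (p * dual_antipode q) = eps_t phi.
Proof.
apply/lfunP => h; rewrite /eps_t !tlift_lfunE.
transitivity (\dsweedler_(p, q <- comul phi) \sweedler_(a, b <- comul h)
    (p a * q (antipode b))).
  apply: eq_tlift => p q; rewrite dualM.
  by apply: eq_tlift => a b; rewrite dual_antipodeE.
rewrite exchange_tlift.
transitivity (phi (eps_t h)).
  rewrite -antipoder lfun_tlift; apply: eq_tlift => a b.
  by rewrite -tev_dual_comul.
transitivity (\dsweedler_(p, q <- comul (1 : dual H))
    \sweedler_(c, d <- comul (1 : H)) (phi d * (p c * q h))); last first.
  apply: eq_tlift => p q; rewrite scale_lfunE.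
  rewrite [counit _](dual_counitE (p * phi)) dualM.
  rewrite [RHS]tlift_mulr; apply: eq_tlift => c d.
  by rewrite mulrA [phi d * _]mulrC.
rewrite exchange_tlift lfun_tlift; apply: eq_tlift => c d.
rewrite -tlift_mull linearZ /=.
rewrite [\dsweedler_(p, q <- _) _](tev_dual_comul c h 1); exact: mulrC.
Qed.

Lemma dual_antipodeK phi :
  \dsweedler_(p, f <- comul phi) \dsweedler_(q, r <- comul f)
    (dual_antipode p * q * dual_antipode r) = dual_antipode phi.
Proof.
apply/lfunP => h; rewrite dual_antipodeE -antipodeK tlift_lfunE lfun_tlift.
transitivity (\dsweedler_(p, f <- comul phi) \sweedler_(a, h' <- comul h)
  \sweedler_(b, c <- comul h') (p (antipode a) * f (b * antipode c))).
  apply: eq_tlift => p f; rewrite tlift_lfunE.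
  transitivity (\dsweedler_(q, r <- comul f) \sweedler_(a, h' <- comul h)
    \sweedler_(b, c <- comul h') (p (antipode a) * (q b * r (antipode c)))).
    apply: eq_tlift => q r; rewrite -mulrA dualM; apply: eq_tlift => a h'.
    rewrite dualM tlift_mull; apply: eq_tlift => b c.
    by rewrite !dual_antipodeE.
  rewrite exchange_tlift; apply: eq_tlift => a h'.
  rewrite exchange_tlift; apply: eq_tlift => b c.
  by rewrite -tlift_mull -tev_dual_comul.
rewrite exchange_tlift; apply: eq_tlift => a h'.
rewrite exchange_tlift lfun_tlift; apply: eq_tlift => b c.
by rewrite -mulrA -tev_dual_comul.
Qed.

HB.instance Definition _ := WeakBialgebra_isWeakHopf.Build K (dual H)
  dual_antipodel dual_antipoder dual_antipodeK.

End DualWeakHopf.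

(* Main.v *)
Require Import Defs.
From HB Require Import structures.
From mathcomp Require Import all_boot all_order all_algebra all_field.
From Stdlib Require Import Classical.

(** Let H be a weak Hopf algebra. Coproducts as in the theorem are the maps
    h |-> h.c for a Casimir element c = a (x) b, that is ha (x) b = a (x) bh
    for all h, and every Casimir element gives one. A left integral L yields the
    Casimir element L_1 (x) S(L_2). It is nonzero when L is, and a nonzero left
    integral always exists: the sum
      E(y) = sum_i e_i1 <e^i, S^2(e_i2) y>
    over a pair of dual bases is a left integral ([int_proj_integral]), and every
    x is recovered from the integrals E(e_i x) ([hopf_module_decomp]; this is the
    decomposition of H as a Hopf module over its dual). So if H has no
    nondegenerate left integral, any such coproduct will do, provided that H is
    then not Frobenius.

    That Frobenius algebras have nondegenerate left integrals
    ([Frobenius_nondegenerate]) is the main point. Let I be the space of left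
    integrals, a right module over the source algebra H_s, which is separable. It
    suffices that I be generated by one element L, for then the decomposition
    above shows that L_1 phi(L_2) takes all values. Four spaces of maps of
    right H_s-modules are compared:
    - Hom(H_s, I) = I has the dimension d of H_s if H is Frobenius
      ([dim_integrals]);
    - Hom(H_s, H_s) = H_s also has dimension d;
    - Hom(I, H_s), the dual of I because H_s is Frobenius, has dimension d;
    - Hom(I, I) has dimension at most d: an endomorphism of I extends to
      one of the Hopf module H, and these are the right multiplications by elements
      of the target algebra H_t ([int_endo_mul], [int_ext_eps_t]).
    As H_s is semisimple, the pairing of the modules M and N by dim Hom(M, N)
    is additive and positive, so that I and H_s are isomorphic, as in the equality
    case of the Cauchy-Schwarz inequality. In concrete terms, if the orbit L.H_s of
    an integral is not I, then either it can be enlarged ([orbit_enlarge]) or the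
    dimensions contradict one another ([ann_trivial]).

    Conversely, let L be nondegenerate. Then S is injective ([antipode_inj]), and
    the Casimir element L_2 (x) S^-1(L_1) has for counit the form lambda with
    L_1 lambda(L_2) = 1. This lambda is a left integral of the dual because
    x_1 lambda(x_2) lies in H_t ([lam_integral]), and it is nondegenerate because
    it is a Frobenius form. *)

Import GRing.Theory.
Local Open Scope ring_scope.

Set Implicit Arguments.
Unset Strict Implicit.
Unset Printing Implicit Defensive.

Reserved Notation "\sw_ ( a , b <- x ) F"
  (at level 36, a name, b name, x at level 36, F at level 36,
   format "\sw_ ( a ,  b  <-  x )  F").

Local Notation "\sw_ ( a , b <- x ) F" := (\sweedler_(a, b <- comul x) F)
  : ring_scope.

(** * Linearity side conditions *)

Section Linearity.
Variable K : fieldType.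
Implicit Types U V W X : vectType K.

(** Linearity as a bare pointwise property of an unbundled function, so that the
    many multilinear expressions below can be recognised from their syntax. *)
Definition lin U V (f : U -> V) := forall c x y, f (c *: x + y) = c *: f x + f y.

Lemma lin_id U : lin (fun x : U => x). Proof. by []. Qed.

Lemma lin_comp U V W (g : V -> W) (f : U -> V) :
  lin g -> lin f -> lin (fun x => g (f x)).
Proof. by move=> lg lf c x y; rewrite lf lg. Qed.

Lemma lin_lfun U V W (g : 'Hom(V, W)) (f : U -> V) :
  lin f -> lin (fun x => g (f x)).
Proof. by move=> lf c x y; rewrite lf linearP. Qed.

Lemma lin_app U V W (f : U -> 'Hom(V, W)) v : lin f -> lin (fun x => f x v).
Proof. by move=> lf c x y; rewrite lf add_lfunE scale_lfunE. Qed.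

Lemma lin_mull U (A : falgType K) (a : A) (f : U -> A) :
  lin f -> lin (fun x => a * f x).
Proof. by move=> lf c x y; rewrite lf mulrDr scalerAr. Qed.

Lemma lin_mulr U (A : falgType K) (a : A) (f : U -> A) :
  lin f -> lin (fun x => f x * a).
Proof. by move=> lf c x y; rewrite lf mulrDl scalerAl. Qed.

Lemma lin_tensl U V W (v : V) (f : U -> W) : lin f -> lin (fun x => f x \ox v).
Proof. by move=> lf c x y; rewrite lf tensDl tensZl. Qed.

Lemma lin_tensr U V W (v : V) (f : U -> W) : lin f -> lin (fun x => v \ox f x).
Proof. by move=> lf c x y; rewrite lf tensDr tensZr. Qed.

Lemma lin_scalel U V (v : V) (f : U -> K^o) : lin f -> lin (fun x => f x *: v).
Proof. by move=> lf c x y; rewrite lf scalerDl scalerA. Qed.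

Lemma lin_scaler U V (c : K) (f : U -> V) : lin f -> lin (fun x => c *: f x).
Proof. by move=> lf d x y; rewrite lf scalerDr !scalerA mulrC. Qed.

Lemma lin_add U V (f g : U -> V) : lin f -> lin g -> lin (fun x => f x + g x).
Proof. by move=> lf lg c x y; rewrite lf lg scalerDr addrACA. Qed.

Lemma lin_opp U V (f : U -> V) : lin f -> lin (fun x => - f x).
Proof. by move=> lf c x y; rewrite lf opprD scalerN. Qed.

Lemma lin_sum U V (I : finType) (F : I -> U -> V) :
  (forall i, lin (F i)) -> lin (fun x => \sum_i F i x).
Proof.
by move=> lF c x y; rewrite scaler_sumr -big_split; apply: eq_bigr => i _ /=;
  rewrite lF.
Qed.

Lemma lin_tlift U V W X (F : U -> V -> W -> X) t :
  (forall u v, lin (F u v)) -> lin (fun x => \sweedler_(u, v <- t) F u v x).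
Proof. by move=> lF c x y; rewrite -tliftP;
  apply: eq_tlift => u v; rewrite lF. Qed.

Lemma lin_tlift_arg U V W X (F : U -> V -> W) (f : X -> U *t V) :
  lin f -> lin (fun x => tlift F (f x)).
Proof. by move=> lf c x y; rewrite lf linearD linearZ. Qed.

Lemma linfun_lin U V (f : U -> V) : lin f -> linfun f =1 f.
Proof.
move=> lf x.
exact: (lfunE (HB.pack f (GRing.isLinear.Build K U V _ f lf) : {linear U -> V})).
Qed.

Lemma lin_tlift_tens U V W (F : U -> V -> W) u v :
  (forall b, lin (F^~ b)) -> (forall a, lin (F a)) -> tlift F (u \ox v) = F u v.
Proof. by move=> l1 l2; apply: tlift_tens. Qed.

Lemma lin_tlift_fun U V W X (F : W -> X) (f : U -> V -> W) t :
  lin F -> F (tlift f t) = \sweedler_(u, v <- t) F (f u v).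
Proof. by move=> lF; rewrite -(linfun_lin lF) lfun_tlift;
  apply: eq_tlift => u v; rewrite linfun_lin. Qed.

Lemma lin_sumE U V (I : finType) (F : U -> V) (f : I -> U) :
  lin F -> F (\sum_i f i) = \sum_i F (f i).
Proof.
move=> lF; rewrite -(linfun_lin lF) linear_sum.
by apply: eq_bigr => i _; rewrite /= linfun_lin.
Qed.

Lemma lin_scaleE U V (F : U -> V) c x : lin F -> F (c *: x) = c *: F x.
Proof. by move=> lF; rewrite -(linfun_lin lF) linearZ /= linfun_lin. Qed.

Lemma tlift_scale U V W (f : U -> V -> K^o) t (w : W) :
  \sweedler_(u, v <- t) (f u v *: w) = tlift f t *: w.
Proof. by rewrite (lin_tlift_fun (F := fun x : K^o => x *: w)) //;
  exact: lin_scalel. Qed.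

End Linearity.

Ltac lin_hyp := match goal with
  | l : _ |- lin _ => first
    [ refine (lin_comp l _) | refine (lin_comp (l _) _)
    | refine (lin_comp (l _ _) _) | refine (lin_comp (l _ _ _) _) ]
  end.
(** A hook for the operators defined further on; each extension covers the
    operators available at that point. *)
Ltac lin_extra := fail.
(** The order of the rules matters: evaluation at a fixed vector ([lin_app])
    unifies with every application of a linear map, including [tlift]. *)
Ltac lin_step := cbv beta; first
  [ assumption | apply: lin_id | lin_extra | apply: lin_lfun
  | apply: lin_mull | apply: lin_mulr | apply: lin_tensl | apply: lin_tensr
  | apply: lin_scalel | apply: lin_scaler
  | apply: lin_tlift_arg | (apply: lin_tlift => ? ?) | apply: lin_app
  | (apply: lin_sum => ?)
  | apply: lin_add | apply: lin_opp | lin_hyp ].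
Ltac lin := intros; repeat lin_step.

(** * Coproducts in Sweedler notation *)

Lemma tlift_falg_mul (K : fieldType) (A : falgType K) (V : vectType K)
    (F : A -> A -> V) (s t : A *t A) :
  (forall b, lin (F^~ b)) -> (forall a, lin (F a)) ->
  tlift F (s * t) =
  \sweedler_(a, b <- s) \sweedler_(c, d <- t) F (a * c) (b * d).
Proof.
move=> l1 l2; rewrite -[s * t]/(tmul s t) /tmul lfun_tlift.
apply: eq_tlift => a b; rewrite lfun_tlift.
by apply: eq_tlift => c d; rewrite lin_tlift_tens.
Qed.

Section Coalgebra.
Variables (K : fieldType) (H : weakBialgType K).
Implicit Types (V : vectType K) (x y z a b c d : H).

(** The three linearity hypotheses let F descend to the threefold tensor
    product, where coassociativity is an equation between linear maps. *)
Lemma sw_coassoc V (F : H -> H -> H -> V) x :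
  (forall b c, lin (fun a => F a b c)) -> (forall a c, lin (fun b => F a b c)) ->
  (forall a b, lin (F a b)) ->
  \sw_(a, b <- x) \sw_(c, d <- a) F c d b =
  \sw_(a, b <- x) \sw_(c, d <- b) F a c d.
Proof.
move=> l1 l2 l3; pose G : 'Hom(H *t (H *t H), V) :=
  tlift (fun a t => \sweedler_(c, d <- t) F a c d).
have GE a t : G (a \ox t) = \sweedler_(c, d <- t) F a c d.
  by rewrite /G lin_tlift_tens //; lin.
transitivity (G (tassoc _ _ _ ((comul \ox \1)%VF (comul x)))).
  elim/tensor_ind: (comul x) => [a b|s t IHs IHt].
    rewrite tmap_tens id_lfunE lin_tlift_tens; [|lin..].
    elim/tensor_ind: (comul a) => [c d|s t IHs IHt].
      by rewrite tassoc_tens GE !lin_tlift_tens //; lin.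
    by rewrite tensDl !linearD /= IHs IHt.
  by rewrite !linearD /= IHs IHt.
have /lfunP/(_ x) := @comulA K H; rewrite !comp_lfunE => ->.
elim/tensor_ind: (comul x) => [a b|s t IHs IHt].
  by rewrite tmap_tens id_lfunE GE lin_tlift_tens //; lin.
by rewrite !linearD /= IHs IHt.
Qed.

Lemma sw_counitl V (f : H -> V) x : lin f ->
  \sw_(a, b <- x) (counit a *: f b) = f x.
Proof.
move=> lf; have [/lfunP/(_ x) + _] := @comul_counit K H.
rewrite !comp_lfunE id_lfunE => {2}<-; rewrite -(linfun_lin lf).
elim/tensor_ind: (comul x) => [a b|s t IHs IHt].
  rewrite tmap_tens id_lfunE tunitl_tens lin_tlift_tens; [|lin..].
  by rewrite linearZ /= linfun_lin.
by rewrite !linearD /= IHs IHt.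
Qed.

Lemma sw_counitr V (f : H -> V) x : lin f ->
  \sw_(a, b <- x) (counit b *: f a) = f x.
Proof.
move=> lf; have [_ /lfunP/(_ x)] := @comul_counit K H.
rewrite !comp_lfunE id_lfunE => {2}<-; rewrite -(linfun_lin lf).
elim/tensor_ind: (comul x) => [a b|s t IHs IHt].
  rewrite tmap_tens id_lfunE tunitr_tens lin_tlift_tens; [|lin..].
  by rewrite linearZ /= linfun_lin.
by rewrite !linearD /= IHs IHt.
Qed.

Lemma sw_mul V (F : H -> H -> V) x y :
  (forall b, lin (F^~ b)) -> (forall a, lin (F a)) ->
  \sw_(a, b <- x * y) F a b =
  \sw_(a, b <- x) \sw_(c, d <- y) F (a * c) (b * d).
Proof. by move=> l1 l2; rewrite comulM tlift_falg_mul. Qed.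

Lemma tlift3_1 V (F : H -> H -> H -> V) (X Y : H *t H) :
  (forall b c, lin (fun a => F a b c)) -> (forall a c, lin (fun b => F a b c)) ->
  (forall a b, lin (F a b)) ->
  forall G : 'Hom(H *t (H *t H), V),
  (forall a t, G (a \ox t) = \sweedler_(c, d <- t) F a c d) ->
  G (tassoc H H H (X \ox 1) * (1 \ox Y)) =
  \sweedler_(a, b <- X) \sweedler_(c, d <- Y) F a (b * c) d.
Proof.
move=> l1 l2 l3 G GE.
rewrite -[in LHS](tlift_tensE X) -[in LHS](tlift_tensE Y).
rewrite tlift_tensl [tassoc _ _ _ _]lfun_tlift mul_tliftl lfun_tlift.
apply: eq_tlift => a b.
rewrite tlift_tensr mul_tliftr lfun_tlift; apply: eq_tlift => c d.
by rewrite tassoc_tens !tensM GE lin_tlift_tens // ?mulr1 ?mul1r.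
Qed.

Lemma tlift3_2 V (F : H -> H -> H -> V) (X Y : H *t H) :
  (forall b c, lin (fun a => F a b c)) -> (forall a c, lin (fun b => F a b c)) ->
  (forall a b, lin (F a b)) ->
  forall G : 'Hom(H *t (H *t H), V),
  (forall a t, G (a \ox t) = \sweedler_(c, d <- t) F a c d) ->
  G ((1 \ox Y) * tassoc H H H (X \ox 1)) =
  \sweedler_(a, b <- X) \sweedler_(c, d <- Y) F a (c * b) d.
Proof.
move=> l1 l2 l3 G GE.
rewrite -[in LHS](tlift_tensE X) -[in LHS](tlift_tensE Y).
rewrite tlift_tensl [tassoc _ _ _ _]lfun_tlift mul_tliftr lfun_tlift.
apply: eq_tlift => a b.
rewrite tlift_tensr mul_tliftl lfun_tlift; apply: eq_tlift => c d.
by rewrite tassoc_tens !tensM GE lin_tlift_tens // ?mulr1 ?mul1r.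
Qed.

Lemma sw_one V (F : H -> H -> H -> V) :
  (forall b c, lin (fun a => F a b c)) -> (forall a c, lin (fun b => F a b c)) ->
  (forall a b, lin (F a b)) ->
  \sw_(a, b <- 1) \sw_(c, d <- b) F a c d =
  \sw_(a, b <- 1) \sw_(c, d <- 1) F a (b * c) d.
Proof.
move=> l1 l2 l3; pose G : 'Hom(H *t (H *t H), V) :=
  tlift (fun a t => \sweedler_(c, d <- t) F a c d).
have GE a t : G (a \ox t) = \sweedler_(c, d <- t) F a c d.
  by rewrite /G lin_tlift_tens //; lin.
rewrite -(tlift3_1 _ _ l1 l2 l3 GE) -comul1.
elim/tensor_ind: (comul 1) => [a b|s t IHs IHt].
  by rewrite tmap_tens id_lfunE GE lin_tlift_tens //; lin.
by rewrite !linearD /= IHs IHt.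
Qed.

Lemma sw_one_op V (F : H -> H -> H -> V) :
  (forall b c, lin (fun a => F a b c)) -> (forall a c, lin (fun b => F a b c)) ->
  (forall a b, lin (F a b)) ->
  \sw_(a, b <- 1) \sw_(c, d <- b) F a c d =
  \sw_(a, b <- 1) \sw_(c, d <- 1) F a (c * b) d.
Proof.
move=> l1 l2 l3; pose G : 'Hom(H *t (H *t H), V) :=
  tlift (fun a t => \sweedler_(c, d <- t) F a c d).
have GE a t : G (a \ox t) = \sweedler_(c, d <- t) F a c d.
  by rewrite /G lin_tlift_tens //; lin.
rewrite -(tlift3_2 _ _ l1 l2 l3 GE) -comul1_op.
elim/tensor_ind: (comul 1) => [a b|s t IHs IHt].
  by rewrite tmap_tens id_lfunE GE lin_tlift_tens //; lin.
by rewrite !linearD /= IHs IHt.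
Qed.

End Coalgebra.

(** * The source and target counital maps *)

Section CounitalMaps.
Variables (K : fieldType) (H : weakBialgType K).
Implicit Types (V : vectType K) (x y z h a b c d : H).

Lemma lin_eps_t V (f : V -> H) : lin f -> lin (fun v => eps_t (f v)).
Proof. by move=> lf; rewrite /eps_t; lin. Qed.

Lemma lin_eps_s V (f : V -> H) : lin f -> lin (fun v => eps_s (f v)).
Proof. by move=> lf; rewrite /eps_s; lin. Qed.

End CounitalMaps.

Ltac lin_extra ::= lazymatch goal with
  | |- lin (fun x => eps_t (@?f x)) => apply: lin_eps_t
  | |- lin (fun x => eps_s (@?f x)) => apply: lin_eps_s
  end.

Section CounitalMapsTheory.
Variables (K : fieldType) (H : weakBialgType K).
Local Notation "c *: v" := (@GRing.scale K _ c v) : ring_scope.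
Implicit Types (V : vectType K) (x y z h a b c d : H).

Lemma counit_mul x y z : counit (x * y * z) =
  \sw_(a, b <- y) (counit (x * a) *: counit (b * z)) :> K^o.
Proof. exact: counitM. Qed.

Lemma counit_mul_op x y z : counit (x * y * z) =
  \sw_(a, b <- y) (counit (x * b) *: counit (a * z)) :> K^o.
Proof. exact: counitM_op. Qed.

(** The twisted weak multiplicativity of the counit, with middle factor 1. *)
Lemma counit_eps_t x y : counit (x * eps_t y) = counit (x * y).
Proof.
rewrite -{2}(mulr1 x) counit_mul_op mul_tliftr lfun_tlift.
apply: eq_tlift => a b; rewrite -scalerAr linearZ /=; exact: mulrC.
Qed.

Lemma counit_eps_s x y : counit (eps_s x * y) = counit (x * y).
Proof.
rewrite -{2}(mulr1 x) counit_mul_op mul_tliftl lfun_tlift.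
by apply: eq_tlift => a b; rewrite -scalerAl linearZ.
Qed.

(** In Sweedler notation x_1 (x) eps_t(x_2) = 1_1 x (x) 1_2: expand 1_1 x with the
    counit, and use Delta^2(1) = 1_1 (x) 1'_1 1_2 (x) 1'_2 to free the middle leg. *)
Lemma sw_eps_t_r V (F : H -> H -> V) x :
  (forall b, lin (F^~ b)) -> (forall a, lin (F a)) ->
  \sw_(a, b <- x) F a (eps_t b) = \sw_(a, b <- 1) F (a * x) b.
Proof.
move=> l1 l2.
transitivity (\sw_(a, b <- 1) \sw_(c, d <- a) \sw_(e, f <- x)
  (counit (d * f) *: F (c * e) b)); last first.
  apply: eq_tlift => a b; rewrite -(sw_counitr (f := F^~ b)) // sw_mul //; lin.
rewrite (sw_coassoc (F := fun c d b => \sw_(e, f <- x)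
  (counit (d * f) *: F (c * e) b))); [|lin..].
rewrite (sw_one_op (F := fun c d b => \sw_(e, f <- x)
  (counit (d * f) *: F (c * e) b))); [|lin..].
transitivity (\sw_(p, q <- 1 * x) \sw_(c, d <- 1) (counit (c * q) *: F p d)).
  rewrite mul1r; apply: eq_tlift => a b; rewrite (lin_tlift_fun _ _ (l2 a)).
  by apply: eq_tlift => c d; rewrite lin_scaleE.
rewrite sw_mul; [|lin..]; apply: eq_tlift => a b; rewrite exchange_tlift.
by apply: eq_tlift => c d; apply: eq_tlift => e f; rewrite mulrA.
Qed.

(** The mirror image of [sw_eps_t_r]. *)
Lemma sw_eps_s_l V (F : H -> H -> V) x :
  (forall b, lin (F^~ b)) -> (forall a, lin (F a)) ->
  \sw_(a, b <- x) F (eps_s a) b = \sw_(a, b <- 1) F a (x * b).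
Proof.
move=> l1 l2.
transitivity (\sw_(a, b <- 1) \sw_(c, d <- b) \sw_(e, f <- x)
  (counit (e * c) *: F a (f * d))); last first.
  apply: eq_tlift => a b; rewrite -(sw_counitl (f := F a)) //.
  by rewrite sw_mul; [rewrite exchange_tlift|lin..].
rewrite (sw_one_op (F := fun a c d => \sw_(e, f <- x)
  (counit (e * c) *: F a (f * d)))); [|lin..].
transitivity (\sw_(p, q <- x * 1) \sw_(c, d <- 1) (counit (p * d) *: F c q)).
  rewrite mulr1; apply: eq_tlift => a b; rewrite (lin_tlift_fun _ _ (l1 b)).
  by apply: eq_tlift => c d; rewrite (lin_scaleE _ _ (l1 b)).
rewrite sw_mul; [|lin..]; rewrite exchange_tlift.
transitivity (\sw_(a, b <- 1) \sw_(e, f <- x) \sw_(c, d <- 1)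
   (counit (e * a * d) *: F c (f * b))) => //.
under eq_tlift => a b do rewrite exchange_tlift.
rewrite exchange_tlift; apply: eq_tlift => a b.
by apply: eq_tlift => c d; apply: eq_tlift => e f; rewrite mulrA.
Qed.

Lemma sw_eps_t_one V (F : H -> H -> V) :
  (forall b, lin (F^~ b)) -> (forall a, lin (F a)) ->
  \sw_(a, b <- 1) F a (eps_t b) = \sw_(a, b <- 1) F a b.
Proof.
by move=> l1 l2; rewrite sw_eps_t_r //; apply: eq_tlift => a b; rewrite mulr1.
Qed.

Lemma sw_eps_s_one V (F : H -> H -> V) :
  (forall b, lin (F^~ b)) -> (forall a, lin (F a)) ->
  \sw_(a, b <- 1) F (eps_s a) b = \sw_(a, b <- 1) F a b.
Proof.
by move=> l1 l2; rewrite sw_eps_s_l //; apply: eq_tlift => a b; rewrite mul1r.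
Qed.

(** Apply the counit to the first leg of Delta^2(1), written in its two forms:
    Delta(z) = z 1_1 (x) 1_2 = 1_1 z (x) 1_2 for z in the target algebra. *)
Lemma sw_of_eps_t V (F : H -> H -> V) x :
  (forall b, lin (F^~ b)) -> (forall a, lin (F a)) ->
  \sw_(a, b <- eps_t x) F a b = \sw_(a, b <- 1) F (eps_t x * a) b.
Proof.
move=> l1 l2;
  rewrite {1}/eps_t (lin_tlift_fun (F := fun y => tlift F (comul y))); [|lin].
transitivity (\sw_(a, b <- 1) \sw_(c, d <- b) (counit (a * x) *: F c d)).
  by apply: eq_tlift => a b; rewrite !linearZ /= tliftZ.
rewrite (sw_one (F := fun a c d => counit (a * x) *: F c d)); [|lin..].
rewrite exchange_tlift; apply: eq_tlift => c d.
rewrite mul_tliftl (lin_tlift_fun (F := fun y => F y d)) //.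
by apply: eq_tlift => a b; rewrite -scalerAl (lin_scaleE _ _ (l1 d)).
Qed.

Lemma sw_of_eps_t' V (F : H -> H -> V) x :
  (forall b, lin (F^~ b)) -> (forall a, lin (F a)) ->
  \sw_(a, b <- eps_t x) F a b = \sw_(a, b <- 1) F (a * eps_t x) b.
Proof.
move=> l1 l2;
  rewrite {1}/eps_t (lin_tlift_fun (F := fun y => tlift F (comul y))); [|lin].
transitivity (\sw_(a, b <- 1) \sw_(c, d <- b) (counit (a * x) *: F c d)).
  by apply: eq_tlift => a b; rewrite !linearZ /= tliftZ.
rewrite (sw_one_op (F := fun a c d => counit (a * x) *: F c d)); [|lin..].
rewrite exchange_tlift; apply: eq_tlift => c d.
rewrite mul_tliftr (lin_tlift_fun (F := fun y => F y d)) //.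
by apply: eq_tlift => a b; rewrite -scalerAr (lin_scaleE _ _ (l1 d)).
Qed.

(** For w in the source algebra, Delta(w) = 1_1 (x) 1_2 w = 1_1 (x) w 1_2. *)
Lemma sw_of_eps_s V (F : H -> H -> V) x :
  (forall b, lin (F^~ b)) -> (forall a, lin (F a)) ->
  \sw_(a, b <- eps_s x) F a b = \sw_(a, b <- 1) F a (b * eps_s x).
Proof.
move=> l1 l2;
  rewrite {1}/eps_s (lin_tlift_fun (F := fun y => tlift F (comul y))); [|lin].
transitivity (\sw_(a, b <- 1) \sw_(c, d <- a) (counit (x * b) *: F c d)).
  by apply: eq_tlift => a b; rewrite !linearZ /= tliftZ.
rewrite (sw_coassoc (F := fun c d b => counit (x * b) *: F c d)); [|lin..].
rewrite (sw_one (F := fun a c d => counit (x * d) *: F a c)); [|lin..].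
apply: eq_tlift => a b.
rewrite mul_tliftr (lin_tlift_fun (F := fun y => F a y)) //.
by apply: eq_tlift => c d; rewrite -scalerAr (lin_scaleE _ _ (l2 a)).
Qed.

Lemma sw_of_eps_s' V (F : H -> H -> V) x :
  (forall b, lin (F^~ b)) -> (forall a, lin (F a)) ->
  \sw_(a, b <- eps_s x) F a b = \sw_(a, b <- 1) F a (eps_s x * b).
Proof.
move=> l1 l2;
  rewrite {1}/eps_s (lin_tlift_fun (F := fun y => tlift F (comul y))); [|lin].
transitivity (\sw_(a, b <- 1) \sw_(c, d <- a) (counit (x * b) *: F c d)).
  by apply: eq_tlift => a b; rewrite !linearZ /= tliftZ.
rewrite (sw_coassoc (F := fun c d b => counit (x * b) *: F c d)); [|lin..].
rewrite (sw_one_op (F := fun a c d => counit (x * d) *: F a c)); [|lin..].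
apply: eq_tlift => a b.
rewrite mul_tliftl (lin_tlift_fun (F := fun y => F a y)) //.
by apply: eq_tlift => c d; rewrite -scalerAl (lin_scaleE _ _ (l2 a)).
Qed.

Lemma sw_mul_eps_t V (F : H -> H -> V) x y :
  (forall b, lin (F^~ b)) -> (forall a, lin (F a)) ->
  \sw_(a, b <- x * eps_t y) F a b = \sw_(a, b <- x) F (a * eps_t y) b.
Proof.
move=> l1 l2; rewrite sw_mul //.
transitivity (\sw_(a, b <- x) \sw_(c, d <- 1) F (a * c * eps_t y) (b * d)).
  apply: eq_tlift => a b.
  rewrite (sw_of_eps_t' (F := fun c d => F (a * c) (b * d))); [|lin..].
  by apply: eq_tlift => c d; rewrite mulrA.
rewrite -(sw_mul (F := fun a b => F (a * eps_t y) b)); [|lin..].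
by rewrite mulr1.
Qed.

Lemma sw_eps_t_mul V (F : H -> H -> V) x y :
  (forall b, lin (F^~ b)) -> (forall a, lin (F a)) ->
  \sw_(a, b <- eps_t y * x) F a b = \sw_(a, b <- x) F (eps_t y * a) b.
Proof.
move=> l1 l2; rewrite sw_mul //.
rewrite (sw_of_eps_t (F := fun a b => \sw_(c, d <- x) F (a * c) (b * d)));
  [|lin..].
transitivity (\sw_(a, b <- 1) \sw_(c, d <- x) F (eps_t y * (a * c)) (b * d)).
  by apply: eq_tlift => a b; apply: eq_tlift => c d; rewrite mulrA.
rewrite -(sw_mul (F := fun a b => F (eps_t y * a) b)); [|lin..].
by rewrite mul1r.
Qed.

Lemma sw_mul_eps_s V (F : H -> H -> V) x y :
  (forall b, lin (F^~ b)) -> (forall a, lin (F a)) ->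
  \sw_(a, b <- x * eps_s y) F a b = \sw_(a, b <- x) F a (b * eps_s y).
Proof.
move=> l1 l2; rewrite sw_mul //.
transitivity (\sw_(a, b <- x) \sw_(c, d <- 1) F (a * c) (b * d * eps_s y)).
  apply: eq_tlift => a b.
  rewrite (sw_of_eps_s (F := fun c d => F (a * c) (b * d))); [|lin..].
  by apply: eq_tlift => c d; rewrite mulrA.
rewrite -(sw_mul (F := fun a b => F a (b * eps_s y))); [|lin..].
by rewrite mulr1.
Qed.

Lemma sw_eps_s_mul V (F : H -> H -> V) x y :
  (forall b, lin (F^~ b)) -> (forall a, lin (F a)) ->
  \sw_(a, b <- eps_s y * x) F a b = \sw_(a, b <- x) F a (eps_s y * b).
Proof.
move=> l1 l2; rewrite sw_mul //.
rewrite (sw_of_eps_s' (F := fun a b => \sw_(c, d <- x) F (a * c) (b * d)));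
  [|lin..].
transitivity (\sw_(a, b <- 1) \sw_(c, d <- x) F (a * c) (eps_s y * (b * d))).
  by apply: eq_tlift => a b; apply: eq_tlift => c d; rewrite mulrA.
rewrite -(sw_mul (F := fun a b => F a (eps_s y * b))); [|lin..].
by rewrite mul1r.
Qed.

(** Both products contract the outer legs of Delta^2(1), one for each of its
    two forms. *)
Lemma eps_st_comm x y : eps_s x * eps_t y = eps_t y * eps_s x.
Proof.
pose F a b c : H := counit (a * y) *: (counit (x * c) *: b).
have l1 b c : lin (fun a => F a b c) by rewrite /F; lin.
have l2 a c : lin (fun b => F a b c) by rewrite /F; lin.
have l3 a b : lin (fun c => F a b c) by rewrite /F; lin.
transitivity (\sw_(a, b <- 1) \sw_(c, d <- 1) F a (c * b) d).
  rewrite mul_tliftr; apply: eq_tlift => a b; rewrite mul_tliftl.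
  apply: eq_tlift => c d.
  by rewrite /F -scalerAr -scalerAl.
rewrite -sw_one_op // sw_one //.
rewrite mul_tliftl; apply: eq_tlift => a b; rewrite mul_tliftr.
apply: eq_tlift => c d.
by rewrite /F -scalerAl -scalerAr.
Qed.

Lemma eps_t_id x : eps_t (eps_t x) = eps_t x.
Proof.
rewrite -[RHS](sw_counitl (f := fun x => x)); [|lin].
by rewrite (sw_of_eps_t' (F := fun a b => counit a *: b)) //; lin.
Qed.

Lemma eps_s_id x : eps_s (eps_s x) = eps_s x.
Proof.
rewrite -[RHS](sw_counitr (f := fun x => x)); [|lin].
by rewrite (sw_of_eps_s' (F := fun a b => counit b *: a)) //; lin.
Qed.

Lemma eps_t1 : eps_t (1 : H) = 1.
Proof.
rewrite -[RHS](sw_counitl (f := fun x => x)); [|lin].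
by apply: eq_tlift => a b; rewrite mulr1.
Qed.

Lemma eps_s1 : eps_s (1 : H) = 1.
Proof.
rewrite -[RHS](sw_counitr (f := fun x => x)); [|lin].
by apply: eq_tlift => a b; rewrite mul1r.
Qed.

Lemma eps_t_mulr x y : eps_t (x * eps_t y) = eps_t (x * y).
Proof. by apply: eq_tlift => a b; rewrite mulrA counit_eps_t mulrA. Qed.

Lemma eps_s_mull x y : eps_s (eps_s x * y) = eps_s (x * y).
Proof. by apply: eq_tlift => a b; rewrite -mulrA counit_eps_s mulrA. Qed.

Lemma counit_of_eps_s x : counit (eps_s x) = counit x.
Proof. by rewrite -[eps_s x]mulr1 counit_eps_s mulr1. Qed.

(** Weak multiplicativity of the counit at x_2 1_2 1'_2 splits off x_2, and the
    counit property then removes it. *)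
Lemma sw_eps_s_r_eps V (F : H -> H -> V) x :
  (forall b, lin (F^~ b)) -> (forall a, lin (F a)) ->
  \sw_(a, b <- x) F a (eps_s b) = \sw_(a, b <- 1) F (x * a) (eps_s b).
Proof.
move=> l1 l2.
pose G a b c : V := counit (b * c) *: F a c.
transitivity (\sw_(a, b <- 1) \sw_(c, d <- 1) (counit (b * d) *: F (x * a) c));
  last first.
  apply: eq_tlift => a b; rewrite (lin_tlift_fun _ _ (l2 (x * a))).
  by apply: eq_tlift => c d; rewrite lin_scaleE.
transitivity (\sw_(p, q <- x * 1) \sw_(c, d <- 1) (counit (q * d) *: F p c)).
  rewrite mulr1; apply: eq_tlift => a b; rewrite (lin_tlift_fun _ _ (l2 a)).
  by apply: eq_tlift => c d; rewrite lin_scaleE.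
rewrite sw_mul; [|lin..].
transitivity (\sw_(e, f <- x) \sw_(c, d <- 1) \sw_(a, b <- 1) \sw_(g, h <- b)
    (counit (f * g) *: (counit (h * d) *: F (e * a) c))).
  apply: eq_tlift => e f; rewrite exchange_tlift; apply: eq_tlift => c d.
  apply: eq_tlift => a b; rewrite counit_mul -tlift_scale.
  by apply: eq_tlift => g h; rewrite scalerA.
transitivity (\sw_(c, d <- 1) \sw_(a, b <- 1) \sw_(p, q <- a)
   \sw_(e, f <- x) (counit (f * q) *: (counit (b * d) *: F (e * p) c))).
  rewrite exchange_tlift; apply: eq_tlift => c d.
  rewrite exchange_tlift.
  rewrite (sw_coassoc (F := fun a g h => \sw_(e, f <- x)
    (counit (f * g) *: (counit (h * d) *: F (e * a) c)))); [|lin..].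
  by apply: eq_tlift => a b; rewrite exchange_tlift.
rewrite exchange_tlift; apply: eq_tlift => a b; apply: eq_tlift => c d.
rewrite exchange_tlift.
rewrite -(sw_mul (F := fun p q => counit q *: (counit (b * d) *: F p c)));
  [|lin..].
by rewrite (sw_counitr (f := fun p => counit (b * d) *: F p c)) //; lin.
Qed.

(** The mirror image of the previous identity. *)
Lemma sw_eps_t_l V (F : H -> H -> V) x :
  (forall b, lin (F^~ b)) -> (forall a, lin (F a)) ->
  \sw_(a, b <- x) F (eps_t a) b = \sw_(a, b <- 1) F (eps_t a) (b * x).
Proof.
move=> l1 l2.
transitivity (\sw_(a, b <- 1) \sw_(c, d <- 1) (counit (c * a) *: F d (b * x)));
  last first.
  apply: eq_tlift => a b; rewrite (lin_tlift_fun _ _ (l1 (b * x))).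
  by apply: eq_tlift => c d; rewrite (lin_scaleE _ _ (l1 _)).
transitivity (\sw_(p, q <- 1 * x) \sw_(c, d <- 1) (counit (c * p) *: F d q)).
  rewrite mul1r; apply: eq_tlift => a b; rewrite (lin_tlift_fun _ _ (l1 b)).
  by apply: eq_tlift => c d; rewrite (lin_scaleE _ _ (l1 _)).
rewrite sw_mul; [|lin..].
transitivity (\sw_(c, d <- 1) \sw_(a, b <- 1) \sw_(g, h <- a) \sw_(e, f <- x)
    (counit (c * g) *: (counit (h * e) *: F d (b * f)))).
  under eq_tlift => a b do rewrite exchange_tlift.
  rewrite exchange_tlift; apply: eq_tlift => c d; apply: eq_tlift => a b.
  rewrite exchange_tlift; apply: eq_tlift => e f.
  rewrite mulrA counit_mul -tlift_scale.
  by apply: eq_tlift => g h; rewrite scalerA.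
rewrite [RHS]exchange_tlift; apply: eq_tlift => c d.
rewrite (sw_coassoc (F := fun g h b => \sw_(e, f <- x)
    (counit (c * g) *: (counit (h * e) *: F d (b * f))))); [|lin..].
apply: eq_tlift => a b.
rewrite -(sw_mul (F := fun p q => counit (c * a) *: (counit p *: F d q)));
  [|lin..].
by rewrite tliftZ (sw_counitl (f := F d)).
Qed.

End CounitalMapsTheory.

(** * The antipode *)

Section Antipode.
Variables (K : fieldType) (H : weakHopfType K).
Local Notation "c *: v" := (@GRing.scale K _ c v) : ring_scope.
Local Notation S := (@antipode K H).
Implicit Types (V : vectType K) (x y z h w a b c d : H).

Lemma sw_antipodel V (f : H -> V) x : lin f ->
  \sw_(a, b <- x) f (S a * b) = f (eps_s x).
Proof. by move=> lf; rewrite -antipodel (lin_tlift_fun _ _ lf). Qed.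

Lemma sw_antipoder V (f : H -> V) x : lin f ->
  \sw_(a, b <- x) f (a * S b) = f (eps_t x).
Proof. by move=> lf; rewrite -antipoder (lin_tlift_fun _ _ lf). Qed.

Lemma antipode_eps_t x : \sw_(a, b <- x) (S a * eps_t b) = S x.
Proof.
rewrite -antipodeK; apply: eq_tlift => a b; rewrite -antipoder mul_tliftr.
by apply: eq_tlift => c d; rewrite mulrA.
Qed.

Lemma eps_s_antipode x : \sw_(a, b <- x) (eps_s a * S b) = S x.
Proof.
rewrite -antipodeK -(sw_coassoc (F := fun a b c => S a * b * S c)); [|lin..].
by apply: eq_tlift => a b; rewrite -antipodel mul_tliftl.
Qed.

Lemma eps_t_mul x y : eps_t (x * y) = \sw_(a, b <- x) (a * eps_t y * S b).
Proof.
rewrite -eps_t_mulr -antipoder.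
by rewrite (sw_mul_eps_t _ _ (F := fun a b => a * S b)); [|lin..].
Qed.

Lemma eps_s_mul x y : eps_s (x * y) = \sw_(a, b <- y) (S a * (eps_s x * b)).
Proof.
rewrite -eps_s_mull -antipodel.
by rewrite (sw_eps_s_mul _ _ (F := fun a b => S a * b)); [|lin..].
Qed.

(** The usual argument that S(xy) and S(y)S(x) are both convolution inverse to
    the product fails for weak Hopf algebras, where S(x_1)x_2 is not a scalar. Its
    replacement inserts eps_t(x_2 y_2) behind S(x_1 y_1), moves eps_s(x) past
    eps_t(y), and uses S(x_1) eps_t(x_2) = S(x) = eps_s(x_1) S(x_2). *)
Lemma antipodeM x y : S (x * y) = S y * S x.
Proof.
rewrite -antipode_eps_t (sw_mul (F := fun p q => S p * eps_t q)); [|lin..].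
transitivity (\sw_(a, b <- x) \sw_(e, f <- b) \sw_(c, d <- y) \sw_(g, h <- d)
    (S (a * c) * (e * g) * S h * S f)).
  apply: eq_tlift => a b; rewrite [RHS]exchange_tlift; apply: eq_tlift => c d.
  rewrite eps_t_mul mul_tliftr; apply: eq_tlift => e f.
  rewrite -antipoder mul_tliftr mul_tliftl mul_tliftr.
  by apply: eq_tlift => g h; rewrite !mulrA.
rewrite -(sw_coassoc (F := fun a e f => \sw_(c, d <- y) \sw_(g, h <- d)
    (S (a * c) * (e * g) * S h * S f))); [|lin..].
transitivity (\sw_(a, f <- x) \sw_(c, h <- y) (eps_s (a * c) * S h * S f)).
  apply: eq_tlift => a f.
  transitivity (\sw_(a', e <- a) \sw_(c, h <- y) \sw_(c', g <- c)
    (S (a' * c') * (e * g) * S h * S f)).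
    apply: eq_tlift => a' e.
    by rewrite (sw_coassoc (F := fun c g h => S (a' * c) * (e * g) * S h * S f));
      [|lin..].
  rewrite exchange_tlift; apply: eq_tlift => c h.
  rewrite -antipodel (sw_mul (F := fun p q => S p * q)); [|lin..].
  rewrite !mul_tliftl; apply: eq_tlift => a' e.
  by rewrite !mul_tliftl.
rewrite -(antipode_eps_t y) -(eps_s_antipode x) mul_tliftr.
apply: eq_tlift => a f.
transitivity (\sw_(c, h <- y) \sw_(c', g <- c) (S c' * (eps_s a * g) * S h * S f)).
  by apply: eq_tlift => c h; rewrite eps_s_mul !mul_tliftl.
rewrite (sw_coassoc (F := fun c g h => S c * (eps_s a * g) * S h * S f));
  [|lin..].
rewrite mul_tliftl; apply: eq_tlift => c d.
rewrite -mulrA [eps_t d * _]mulrA -eps_st_comm -antipoder mul_tliftr mul_tliftl.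
by rewrite mul_tliftr; apply: eq_tlift => g h; rewrite !mulrA.
Qed.

Lemma antipode1 : S 1 = 1.
Proof.
rewrite -antipode_eps_t (sw_eps_t_one (F := fun a b => S a * b)); [|lin..].
by rewrite antipodel eps_s1.
Qed.

Lemma counit_antipode x : counit (S x) = counit x.
Proof.
rewrite -antipode_eps_t lfun_tlift -[RHS]counit_of_eps_s -antipodel lfun_tlift.
by apply: eq_tlift => a b; rewrite counit_eps_t.
Qed.

(** On the target algebra the antipode is eps_s, as
    S(z) = S(z) S(1_1) 1_2 = S(1_1 z) 1_2 = S(z_1) z_2. *)
Lemma antipode_of_eps_t x : S (eps_t x) = eps_s (eps_t x).
Proof.
rewrite -antipodel (sw_of_eps_t' _ (F := fun a b => S a * b)); [|lin..].
transitivity (S (eps_t x) * \sw_(a, b <- 1) (S a * b)).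
  by rewrite antipodel eps_s1 mulr1.
by rewrite mul_tliftr; apply: eq_tlift => a b; rewrite antipodeM mulrA.
Qed.

(** The second leg of Delta(1) lies in the target algebra, where eps_s and S
    agree. *)
Lemma sw_eps_s_r V (F : H -> H -> V) x :
  (forall b, lin (F^~ b)) -> (forall a, lin (F a)) ->
  \sw_(a, b <- x) F a (eps_s b) = \sw_(a, b <- 1) F (x * a) (S b).
Proof.
move=> l1 l2; rewrite sw_eps_s_r_eps //.
rewrite -(sw_eps_t_one (F := fun a b => F (x * a) (eps_s b))); [|lin..].
rewrite -[RHS](sw_eps_t_one (F := fun a b => F (x * a) (S b))); [|lin..].
by apply: eq_tlift => a b; rewrite antipode_of_eps_t.
Qed.

(** As S(h_2 w_2) h_3 = S(w_2) eps_s(h_2), the right side is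
    h_1 w_1 (x) S(w_2) eps_s(h_2); by [sw_eps_s_r] this is
    h 1_1 w_1 (x) S(1_2 w_2), where Delta(1) is absorbed by Delta(w). *)
Lemma sw_twist V (F : H -> H -> V) h w :
  (forall b, lin (F^~ b)) -> (forall a, lin (F a)) ->
  \sw_(a, b <- w) F (h * a) (S b) =
  \sw_(p, q <- h) \sw_(a, b <- p * w) F a (S b * q).
Proof.
move=> l1 l2; symmetry.
transitivity (\sw_(p, q <- h) \sw_(p1, p2 <- p) \sw_(a, b <- w)
   F (p1 * a) (S b * (S p2 * q))).
  apply: eq_tlift => p q; rewrite sw_mul; [|lin..].
  apply: eq_tlift => p1 p2; apply: eq_tlift => a b.
  by rewrite antipodeM mulrA.
rewrite (sw_coassoc (F := fun p1 p2 q => \sw_(a, b <- w)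
   F (p1 * a) (S b * (S p2 * q)))); [|lin..].
transitivity (\sw_(p, q <- h) \sw_(a, b <- w) F (p * a) (S b * eps_s q)).
  apply: eq_tlift => p q; rewrite exchange_tlift; apply: eq_tlift => a b.
  by rewrite (sw_antipodel (f := fun y => F (p * a) (S b * y))) //; lin.
rewrite (sw_eps_s_r _ (F := fun p q => \sw_(a, b <- w) F (p * a) (S b * q)));
  [|lin..].
transitivity (\sw_(a, b <- 1 * w) F (h * a) (S b)); last by rewrite mul1r.
rewrite sw_mul; [|lin..]; apply: eq_tlift => p q; apply: eq_tlift => a b.
by rewrite antipodeM mulrA.
Qed.

(** A left integral L gives the Casimir element L_1 (x) S(L_2). After the
    twist of [sw_twist] the product h_1 L becomes eps_t(h_1) L, which depends on h
    only through eps_t(h_1) (x) h_2 = eps_t(1_1) (x) 1_2 h; comparing with the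
    case h = 1 removes the remaining factors. *)
Lemma sw_integral_r V (F : H -> H -> V) L h : left_integral L ->
  (forall b, lin (F^~ b)) -> (forall a, lin (F a)) ->
  \sw_(a, b <- L) F (h * a) (S b) = \sw_(a, b <- L) F a (S b * h).
Proof.
move=> intL l1 l2.
have eF (G : H -> H -> V) g : (forall b, lin (G^~ b)) -> (forall a, lin (G a)) ->
  \sw_(a, b <- L) G (g * a) (S b) =
  \sw_(p, q <- 1) \sw_(a, b <- L) G (eps_t p * a) (S b * (q * g)).
  move=> m1 m2; rewrite sw_twist //.
  rewrite -(sw_eps_t_l _ (F := fun p q => \sw_(a, b <- L)
    G (p * a) (S b * q))); [|lin..].
  apply: eq_tlift => p q; rewrite intL.
  by rewrite (sw_eps_t_mul _ _ (F := fun a b => G a (S b * q))); [|lin..].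
rewrite eF //; transitivity (\sw_(a, b <- L) F (1 * a) (S b * h)); last first.
  by apply: eq_tlift => a b; rewrite mul1r.
rewrite (eF (fun a b => F a (b * h))); [|lin..].
apply: eq_tlift => p q; apply: eq_tlift => a b.
by rewrite mulr1 !mulrA.
Qed.

End Antipode.

(** * Dual bases and the coproduct of the antipode *)

Section DualBasis.
Variables (K : fieldType) (U : vectType K).
Local Notation "c *: v" := (@GRing.scale K _ c v) : ring_scope.
Implicit Types (V : vectType K).

Lemma dual_basis V (F : U -> V) x : lin F ->
  \sum_(i < \dim {:U}) coordf i x *: F (vbasis {:U})`_i = F x.
Proof.
move=> lF; rewrite {2}(coord_vbasis (memvf x)) lin_sumE //.
by apply: eq_bigr => i _; rewrite lin_scaleE // coordfE.
Qed.

Lemma dual_basis_form V (F : dual U -> V) (phi : dual U) : lin F ->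
  \sum_(i < \dim {:U}) phi (vbasis {:U})`_i *: F (coordf i) = F phi.
Proof.
move=> lF; rewrite [in RHS](dual_sum phi) (lin_sumE _ lF).
by apply: eq_bigr => i _; rewrite (lin_scaleE _ _ lF).
Qed.

(** The form phi o g for a bare function g; it is meaningful for linear g only. *)
Definition pullback (phi : dual U) (g : U -> U) : dual U :=
  linfun (fun x => phi (g x)).

Lemma pullbackE phi g x : lin g -> pullback phi g x = phi (g x).
Proof. by move=> lg; apply: linfun_lin; lin. Qed.

(** Cyclicity of the trace: a linear map may be moved from one member of the
    canonical tensor to the other. *)
Lemma dual_basis_comp V (R : dual U -> U -> V) (g : U -> U) :
  (forall x, lin (R^~ x)) -> (forall phi, lin (R phi)) -> lin g ->
  \sum_(i < \dim {:U}) R (coordf i) (g (vbasis {:U})`_i) =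
  \sum_(i < \dim {:U})
     R (pullback (coordf i) g) (vbasis {:U})`_i.
Proof.
move=> l1 l2 lg.
transitivity (\sum_(i < \dim {:U}) \sum_(k < \dim {:U})
   coordf k (g (vbasis {:U})`_i) *: R (coordf i) (vbasis {:U})`_k).
  by apply: eq_bigr => i _; rewrite -(dual_basis _ (l2 _)).
rewrite exchange_big; apply: eq_bigr => k _ /=.
rewrite -(dual_basis_form _ (l1 _)).
by apply: eq_bigr => i _; rewrite pullbackE.
Qed.

Lemma bilinear_ext V (F : U -> U -> V) (t s : U *t U) :
  (forall b, lin (F^~ b)) -> (forall a, lin (F a)) ->
  (forall phi psi : dual U, \sweedler_(a, b <- t) (phi a *: psi b) =
                            \sweedler_(a, b <- s) (phi a *: psi b) :> K^o) ->
  tlift F t = tlift F s.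
Proof.
move=> l1 l2 ts.
have e r : tlift F r = \sum_(i < \dim {:U}) \sum_(j < \dim {:U})
    (\sweedler_(a, b <- r) (coordf i a *: coordf j b) : K^o) *:
       F (vbasis {:U})`_i (vbasis {:U})`_j.
  elim/tensor_ind: r => [u v|r r' IHr IHr'].
    rewrite lin_tlift_tens // -(dual_basis _ (l1 v)).
    apply: eq_bigr => i _; rewrite -(dual_basis _ (l2 _)) scaler_sumr.
    apply: eq_bigr => j _; rewrite lin_tlift_tens ?scalerA //; lin.
  rewrite linearD /= IHr IHr' -big_split; apply: eq_bigr => i _.
  rewrite -big_split; apply: eq_bigr => j _ /=.
  by rewrite linearD scalerDl.
by rewrite !e; apply: eq_bigr => i _; apply: eq_bigr => j _; rewrite ts.
Qed.

End DualBasis.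

Section DualBasisCoalgebra.
Variables (K : fieldType) (H : weakBialgType K).
Local Notation "c *: v" := (@GRing.scale K _ c v) : ring_scope.
Implicit Types (V : vectType K).

Lemma dual_scaleM (phi psi : dual H) h :
  (phi * psi : dual H) h = \sw_(a, b <- h) (phi a *: psi b) :> K^o.
Proof. exact: dualM. Qed.

(** The product of the dual is the transpose of the coproduct, seen on the
    canonical tensor sum_i e^i (x) e_i. *)
Lemma dual_basis_comul V (R : dual H -> H -> H -> V) :
  (forall x y, lin (fun phi => R phi x y)) ->
  (forall phi y, lin (fun x => R phi x y)) -> (forall phi x, lin (R phi x)) ->
  \sum_(i < \dim {:H}) \sw_(a, b <- (vbasis {:H})`_i) R (coordf i) a b =
  \sum_(i < \dim {:H}) \sum_(j < \dim {:H})
     R ((coordf i : dual H) * (coordf j : dual H)) (vbasis {:H})`_i (vbasis {:H})`_j.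
Proof.
move=> l1 l2 l3; symmetry.
transitivity (\sum_(i < \dim {:H}) \sum_(j < \dim {:H}) \sum_(k < \dim {:H})
   \sw_(a, b <- (vbasis {:H})`_k) (coordf i a *: (coordf j b *:
     R (coordf k) (vbasis {:H})`_i (vbasis {:H})`_j))).
  apply: eq_bigr => i _; apply: eq_bigr => j _.
  rewrite -(dual_basis_form ((coordf i : dual H) * (coordf j : dual H)) (l1 _ _)).
  apply: eq_bigr => k _; rewrite dual_scaleM -tlift_scale.
  by apply: eq_tlift => a b; rewrite scalerA.
transitivity (\sum_(k < \dim {:H}) \sum_(i < \dim {:H}) \sum_(j < \dim {:H})
   \sw_(a, b <- (vbasis {:H})`_k) (coordf i a *: (coordf j b *:
     R (coordf k) (vbasis {:H})`_i (vbasis {:H})`_j))).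
  by under eq_bigr do rewrite exchange_big; rewrite exchange_big.
apply: eq_bigr => k _.
elim/tensor_ind: (comul _) => [a b|s t IHs IHt].
  rewrite lin_tlift_tens // -(dual_basis _ (l2 _ b)).
  apply: eq_bigr => i _; rewrite -(dual_basis _ (l3 _ _)) scaler_sumr.
  by apply: eq_bigr => j _; rewrite lin_tlift_tens //; lin.
rewrite linearD /= -IHs -IHt -big_split; apply: eq_bigr => i _ /=.
by rewrite -big_split; apply: eq_bigr => j _ /=; rewrite linearD.
Qed.

End DualBasisCoalgebra.

Section AntipodeComul.
Variables (K : fieldType) (H : weakHopfType K).
Local Notation "c *: v" := (@GRing.scale K _ c v) : ring_scope.
Local Notation S := (@antipode K H).
Implicit Types (V : vectType K) (x y z h w a b c d : H).

(** The dual of H is a weak Hopf algebra whose antipode is the transpose of S, so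
    [antipodeM] for the dual says that S reverses the coproduct of H. *)
Lemma sw_of_antipode V (F : H -> H -> V) x :
  (forall b, lin (F^~ b)) -> (forall a, lin (F a)) ->
  \sw_(a, b <- S x) F a b = \sw_(a, b <- x) F (S b) (S a).
Proof.
move=> l1 l2.
transitivity (tlift F (\sw_(a, b <- x) (S b \ox S a))); last first.
  by rewrite lfun_tlift; apply: eq_tlift => a b; rewrite lin_tlift_tens.
apply: bilinear_ext => // phi psi.
have /lfunP/(_ x) := antipodeM (phi : dual H) (psi : dual H).
rewrite [LHS]dual_antipodeE !dual_scaleM => ->.
rewrite lfun_tlift; apply: eq_tlift => a b.
rewrite lin_tlift_tens; [|lin..].
by rewrite [X in X *: _]dual_antipodeE [X in _ *: X]dual_antipodeE; exact: mulrC.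
Qed.

Lemma sw_of_antipode2 V (F : H -> H -> V) x :
  (forall b, lin (F^~ b)) -> (forall a, lin (F a)) ->
  \sw_(a, b <- S (S x)) F a b = \sw_(a, b <- x) F (S (S a)) (S (S b)).
Proof.
by move=> l1 l2; rewrite !sw_of_antipode //; lin.
Qed.

End AntipodeComul.

(** * The projection onto the left integrals *)

Section SumTlift.
Variable K : fieldType.
Lemma sum_tlift (U V W : vectType K) (I : finType) (F : I -> U -> V -> W) t :
  \sum_i tlift (F i) t = \sweedler_(u, v <- t) (\sum_i F i u v).
Proof.
rewrite tlift_sum; under eq_bigr do rewrite tlift_sum.
rewrite exchange_big; apply: eq_bigr => i _; rewrite exchange_big.
by apply: eq_bigr => j _ /=; rewrite scaler_sumr.
Qed.
End SumTlift.

Section Integrals.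
Variables (K : fieldType) (H : weakHopfType K).
Local Notation "c *: v" := (@GRing.scale K _ c v) : ring_scope.
Local Notation S := (@antipode K H).
Local Notation e_ i := ((vbasis {:H})`_i).
Local Notation n := (\dim {:H}).
Implicit Types (V : vectType K) (x y z h w a b c d L : H) (phi psi : dual H).

(** A right action of the dual algebra on H, see [dual_actM]; with the coaction
    x |-> sum_i e_i x (x) e^i it makes H a Hopf module over the dual. Its
    coinvariants are the left integrals. *)
Definition dual_act y phi : H := \sw_(a, b <- y) (phi (S b) *: a).

Lemma lin_dual_actl V (f : V -> H) phi : lin f -> lin (fun v => dual_act (f v) phi).
Proof. by move=> lf; rewrite /dual_act; lin. Qed.

Lemma lin_dual_actr V y (f : V -> dual H) : lin f -> lin (fun v => dual_act y (f v)).
Proof. by move=> lf; rewrite /dual_act; lin. Qed.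

(** The projection of the Hopf module H onto its coinvariants,
    y |-> y_(0).S(y_(1)), after moving y across the canonical tensor. *)
Definition int_proj y : H :=
  \sum_(i < n) \sw_(a, b <- e_ i) (coordf i (S (S b) * y) *: a).

Lemma lin_int_proj V (f : V -> H) : lin f -> lin (fun v => int_proj (f v)).
Proof. by move=> lf; rewrite /int_proj; lin. Qed.

End Integrals.

Ltac lin_extra ::= match goal with
  | |- lin (fun x => eps_t (@?f x)) => apply: lin_eps_t
  | |- lin (fun x => eps_s (@?f x)) => apply: lin_eps_s
  | |- lin (fun x => int_proj (@?f x)) => apply: lin_int_proj
  | |- lin (fun x => dual_act (@?f x) ?p) => apply: lin_dual_actl
  | |- lin (fun x => dual_act ?y (@?f x)) => apply: lin_dual_actr
  end.

Section IntegralsTheory.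
Variables (K : fieldType) (H : weakHopfType K).
Local Notation "c *: v" := (@GRing.scale K _ c v) : ring_scope.
Local Notation S := (@antipode K H).
Local Notation e_ i := ((vbasis {:H})`_i).
Local Notation n := (\dim {:H}).
Implicit Types (V : vectType K) (x y z h w a b c d L : H) (phi psi : dual H).

(** By [sw_twist] and cyclicity, h moves into the form e^i as
    h_1 S(h_2) = eps_t(h). So the product with h depends only on eps_t(h), which
    is fixed by eps_t. *)
Lemma int_proj_integral y : left_integral (int_proj y).
Proof.
pose G k : H := \sum_(i < n) \sw_(a, b <- e_ i) (coordf i (k * (S (S b) * y)) *: a).
have GE h : h * int_proj y = G (eps_t h).
  transitivity (\sw_(p, q <- h) \sum_(i < n) \sw_(a, b <- p * e_ i)
      (coordf i (S (S b * q) * y) *: a)).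
    rewrite -sum_tlift /int_proj mulr_sumr; apply: eq_bigr => i _.
    rewrite mul_tliftr.
    rewrite -(sw_twist _ _ (F := fun a b => coordf i (S b * y) *: a)); [|lin..].
    by apply: eq_tlift => a b; rewrite -scalerAr.
  rewrite -(sw_antipoder (f := G)); last by rewrite /G; lin.
  apply: eq_tlift => p q.
  pose R phi x : H := \sw_(a, b <- x) (phi (S (S b * q) * y) *: a).
  rewrite [LHS](dual_basis_comp (R := R) (g := fun x => p * x));
    [|rewrite /R; lin..].
  apply: eq_bigr => i _; apply: eq_tlift => a b.
  by rewrite pullbackE ?antipodeM ?mulrA //; lin.
by move=> h; rewrite !GE eps_t_id.
Qed.

(** The fundamental theorem of Hopf modules: x = E(x_(0)).x_(1). *)
Lemma hopf_module_decomp x :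
  \sum_(i < n) dual_act (int_proj (e_ i * x)) (coordf i) = x.
Proof.
transitivity (\sum_(j < n) \sw_(p, q <- 1) (coordf j (S q * x) *: (p * e_ j))).
  transitivity (\sum_(i < n) \sum_(j < n) \sw_(a, b <- e_ j) \sw_(c, d <- a)
      (coordf i (S d) *: (coordf j (S (S b) * (e_ i * x)) *: c))).
    apply: eq_bigr => i _.
    rewrite (lin_sumE (F := fun y => dual_act y (coordf i))); [|lin].
    apply: eq_bigr => j _.
    rewrite (lin_tlift_fun (F := fun y => dual_act y (coordf i))); [|lin].
    apply: eq_tlift => a b.
    rewrite (lin_scaleE (F := fun y => dual_act y (coordf i))); [|lin].
    rewrite -tliftZ; apply: eq_tlift => c d.
    by rewrite !scalerA mulrC.
  rewrite exchange_big; apply: eq_bigr => j _ /=.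
  transitivity (\sw_(a, b <- e_ j) \sw_(c, d <- a)
     (coordf j (S (S b) * (S d * x)) *: c)).
    rewrite sum_tlift; apply: eq_tlift => a b.
    rewrite sum_tlift; apply: eq_tlift => c d.
    by rewrite (dual_basis (F := fun y => coordf j (S (S b) * (y * x)) *: c)) //;
      lin.
  rewrite (sw_coassoc (F := fun c d b => coordf j (S (S b) * (S d * x)) *: c));
    [|lin..].
  rewrite -(sw_eps_t_r _ (F := fun p q => coordf j (S q * x) *: p)); [|lin..].
  apply: eq_tlift => a b.
  rewrite -(sw_antipoder (f := fun y => coordf j (S y * x) *: a)); [|lin].
  by apply: eq_tlift => c d; rewrite antipodeM mulrA.
rewrite sum_tlift -[RHS]mul1r -[in RHS]eps_t1 -antipoder mul_tliftl.
apply: eq_tlift => p q.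
by rewrite (dual_basis (F := fun y => p * y)) ?mulrA //; lin.
Qed.

(** Otherwise [int_proj] vanishes on a basis, so the decomposition of 1 is 0. *)
Lemma ex_left_integral : exists2 L : H, left_integral L & L != 0.
Proof.
have [/forallP p0|] := boolP [forall i : 'I_n, int_proj (e_ i) == 0];
  last first.
  by rewrite negb_forall => /existsP[i ni]; exists (int_proj (e_ i)) => //;
    exact: int_proj_integral.
have /eqP[] := oner_neq0 H; rewrite -[LHS](hopf_module_decomp 1).
apply: big1 => i _; rewrite mulr1 (eqP (p0 i)) /dual_act linear0.
by rewrite tlift_sum; do 2!(apply: big1 => ? _); rewrite mxE scale0r.
Qed.

(** On hL with L a left integral, the projection is right multiplication of L
    by this element of the source algebra, see [int_proj_of_integral]. *)
Definition int_weight h : H := \sw_(a, b <- 1) (counit (S (S b) * h) *: a).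

Lemma int_weight_eps_s h : eps_s (int_weight h) = int_weight h.
Proof.
rewrite /int_weight (lin_tlift_fun (F := fun x => eps_s x)); [|lin].
rewrite -[RHS](sw_eps_s_one (F := fun a b => counit (S (S b) * h) *: a));
  [|lin..].
by apply: eq_tlift => a b; rewrite (lin_scaleE (F := fun x => eps_s x)) //; lin.
Qed.

(** Weak multiplicativity of the counit at S^2(x_2) S^2(1_2) h, together with
    the coproduct of S^2(1_2), moves h from x_2 to Delta(1). *)
Lemma mul_int_weight x h :
  \sw_(a, b <- x) (counit (S (S b) * h) *: a) = x * int_weight h.
Proof.
transitivity (\sw_(a, b <- x) \sw_(c, d <- 1)
   (counit (S (S (b * d)) * h) *: (a * c))).
  by rewrite -(sw_mul _ _ (F := fun a b => counit (S (S b) * h) *: a)) ?mulr1 //;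
    lin.
transitivity (\sw_(a, b <- x) \sw_(c, d <- 1) \sw_(p, q <- d)
   (counit (b * p) *: (counit (S (S q) * h) *: (a * c)))).
  apply: eq_tlift => a b; apply: eq_tlift => c d.
  rewrite !antipodeM counit_mul -tlift_scale.
  rewrite (sw_of_antipode2 _ (F := fun p q =>
    (counit (S (S b) * p) *: (counit (q * h) : K^o)) *: (a * c))); [|lin..].
  apply: eq_tlift => p q.
  by rewrite -!antipodeM !counit_antipode scalerA.
transitivity (\sw_(a, b <- x) \sw_(c, d <- 1) \sw_(p, q <- c)
   (counit (b * q) *: (counit (S (S d) * h) *: (a * p)))).
  apply: eq_tlift => a b.
  by rewrite -(sw_coassoc (F := fun c p q =>
    counit (b * p) *: (counit (S (S q) * h) *: (a * c)))); [|lin..].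
rewrite exchange_tlift mul_tliftr; apply: eq_tlift => c d.
rewrite -(sw_mul _ _ (F := fun a b => counit b *: (counit (S (S d) * h) *: a)));
  [|lin..].
rewrite (sw_counitr (f := fun a => counit (S (S d) * h) *: a)); [|lin].
by rewrite scalerAr.
Qed.

(** By cyclicity hL can be put inside the coproduct of e_i, where it becomes
    eps_t(e_i h) L. The dual bases then cancel and leave eps_t(S^2(L_2) h) L_1, to
    which [sw_integral_r] applies. *)
Lemma int_proj_of_integral L h : left_integral L ->
  int_proj (h * L) = L * int_weight h.
Proof.
move=> intL; rewrite -mul_int_weight.
transitivity (\sum_(i < n) \sw_(a, b <- e_ i * (h * L)) (coordf i (S (S b)) *: a)).
  pose R phi x : H := \sw_(a, b <- x) (phi (S (S b)) *: a).
  rewrite [RHS](dual_basis_comp (R := R) (g := fun x => x * (h * L)));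
    [|rewrite /R; lin..].
  by apply: eq_bigr => i _; apply: eq_tlift => a b; rewrite pullbackE //; lin.
transitivity (\sw_(a, b <- L) (eps_t (S (S b) * h) * a)).
  transitivity (\sum_(i < n) \sw_(a, b <- L)
      (coordf i (S (S b)) *: (eps_t (e_ i * h) * a))).
    apply: eq_bigr => i _; rewrite mulrA intL.
    by rewrite (sw_eps_t_mul _ _ (F := fun a b => coordf i (S (S b)) *: a));
      [|lin..].
  rewrite sum_tlift; apply: eq_tlift => a b.
  by rewrite (dual_basis (F := fun y => eps_t (y * h) * a)) //; lin.
transitivity (\sw_(c, d <- 1) \sw_(a, b <- L)
   (counit (c * (S (S b) * h)) *: (d * a))).
  rewrite exchange_tlift; apply: eq_tlift => a b.
  by rewrite mul_tliftl; apply: eq_tlift => c d; rewrite -scalerAl.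
transitivity (\sw_(a, b <- L) (counit (eps_t 1 * (S (S b) * h)) *: a));
  last first.
  by apply: eq_tlift => a b; rewrite eps_t1 mul1r.
transitivity (\sw_(c, d <- 1) \sw_(a, b <- L)
    (counit (c * S d * (S (S b) * h)) *: a)).
  apply: eq_tlift => c d.
  rewrite (sw_integral_r _ intL (F := fun a b => counit (c * (S b * h)) *: a));
    [|lin..].
  by apply: eq_tlift => a b; rewrite antipodeM !mulrA.
rewrite exchange_tlift; apply: eq_tlift => a b.
by rewrite (sw_antipoder (f := fun y => counit (y * (S (S b) * h)) *: a)) //;
  lin.
Qed.

(** E(h_1) (x) eps_s(h_2) = E(h_1) (x) h_2. This is the compatibility of the
    projection with the action of the dual, E(x_(0) phi_1) x_(1) phi_2 =
    E(x_(0)) x_(1) phi, at x = 1. In the proof h_2 is multiplied by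
    S(e_i4) S^2(e_i3) = S(eps_s(e_i3)), which is absorbed; the legs then regroup
    as the coproduct of S^2(e_i2) h. *)
Lemma int_proj_eps_s V (F : H -> H -> V) h :
  (forall b, lin (F^~ b)) -> (forall a, lin (F a)) ->
  \sw_(a, b <- h) F (int_proj a) (eps_s b) = \sw_(a, b <- h) F (int_proj a) b.
Proof.
move=> l1 l2.
(* The multiplication by S(eps_s(q_2)) and the regrouping of the legs, with a
   general x in place of the basis vector. *)
have shuffle (G : H -> H -> H -> V) x :
    (forall b c, lin (fun a => G a b c)) -> (forall a c, lin (fun b => G a b c)) ->
    (forall a b, lin (G a b)) ->
    \sw_(p, q <- x) \sw_(a, b <- h) G p (S (S q) * a) b =
    \sw_(y, s <- x) \sw_(p, q <- y) \sw_(c, d <- S (S q) * h) G p c (S s * d).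
  move=> m1 m2 m3.
  rewrite (sw_coassoc (F := fun p q s => \sw_(c, d <- S (S q) * h) G p c (S s * d)));
    [|lin..].
  apply: eq_tlift => p q.
  transitivity (\sw_(q1, q2 <- q) \sw_(a, b <- h)
     G p (S (S q1) * a) (S (eps_s q2) * b)).
    rewrite (sw_eps_s_r _ (F := fun q1 q2 => \sw_(a, b <- h)
      G p (S (S q1) * a) (S q2 * b))); [|lin..].
    transitivity (\sw_(r, s <- S (S 1)) \sw_(a, b <- h)
       G p (S (S q) * (r * a)) (s * b)).
      rewrite !antipode1.
      by rewrite -(sw_mul _ _ (F := fun a b => G p (S (S q) * a) b)) ?mul1r //;
        lin.
    rewrite (sw_of_antipode2 _ (F := fun r s => \sw_(a, b <- h)
      G p (S (S q) * (r * a)) (s * b))); [|lin..].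
    apply: eq_tlift => r s; apply: eq_tlift => a b.
    by rewrite !antipodeM !mulrA.
  transitivity (\sw_(q1, q2 <- q) \sw_(r, s <- q2) \sw_(a, b <- h)
     G p (S (S q1) * a) (S s * (S (S r) * b))).
    apply: eq_tlift => q1 q2; rewrite exchange_tlift; apply: eq_tlift => a b.
    rewrite -(sw_antipodel (f := fun y => G p (S (S q1) * a) (S y * b)));
      [|lin].
    by apply: eq_tlift => r s; rewrite antipodeM mulrA.
  rewrite -(sw_coassoc (F := fun q1 r s => \sw_(a, b <- h)
     G p (S (S q1) * a) (S s * (S (S r) * b)))); [|lin..].
  apply: eq_tlift => q' s.
  rewrite sw_mul; [|lin..].
  by rewrite (sw_of_antipode2 _ (F := fun c d => \sw_(a, b <- h)
    G p (c * a) (S s * (d * b)))); [|lin..].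
pose G i p c d : V := coordf i c *: F p d.
have expand (f : H -> H) : lin f -> \sw_(a, b <- h) F (int_proj a) (f b) =
   \sum_(i < n) \sw_(p, q <- e_ i) \sw_(a, b <- h)
      (coordf i (S (S q) * a) *: F p (f b)).
  move=> lf.
  transitivity (\sum_(i < n) \sw_(a, b <- h) \sw_(p, q <- e_ i)
     (coordf i (S (S q) * a) *: F p (f b))).
    rewrite sum_tlift; apply: eq_tlift => a b.
    rewrite (lin_sumE _ (l1 (f b))); apply: eq_bigr => i _.
    rewrite (lin_tlift_fun _ _ (l1 (f b))); apply: eq_tlift => p q.
    by rewrite (lin_scaleE _ _ (l1 (f b))).
  by apply: eq_bigr => i _; rewrite exchange_tlift.
rewrite (expand (fun b => b)); [|lin]; rewrite (expand (fun b => eps_s b));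
  [|lin].
symmetry.
transitivity (\sum_(i < n) \sw_(y, s <- e_ i) \sw_(p, q <- y)
   \sw_(c, d <- S (S q) * h) (coordf i c *: F p (S s * d))).
  by apply: eq_bigr => i _; rewrite (shuffle (G i)) // /G; lin.
rewrite (dual_basis_comul (R := fun phi y s => \sw_(p, q <- y)
   \sw_(c, d <- S (S q) * h) (phi c *: F p (S s * d)))); [|lin..].
apply: eq_bigr => i _; rewrite sum_tlift; apply: eq_tlift => p q.
transitivity (\sw_(r, s <- 1) (coordf i (S (S q) * h * r) *: F p (S s)));
  last first.
  rewrite (sw_eps_s_r _ (F := fun a b => coordf i (S (S q) * a) *: F p b));
    [|lin..].
  by apply: eq_tlift => r s; rewrite mulrA.
rewrite -(sw_eps_s_r _ (F := fun a b => coordf i a *: F p b)); [|lin..].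
transitivity (\sw_(c, d <- S (S q) * h) \sw_(c1, c2 <- c)
  (coordf i c1 *: F p (S c2 * d))).
  rewrite sum_tlift; apply: eq_tlift => c d.
  transitivity (\sum_(j < n) \sw_(c1, c2 <- c)
     (coordf j c2 *: (coordf i c1 *: F p (S (e_ j) * d)))).
    apply: eq_bigr => j _; rewrite dual_scaleM -tlift_scale.
    by apply: eq_tlift => c1 c2; rewrite !scalerA mulrC.
  rewrite sum_tlift; apply: eq_tlift => c1 c2.
  by rewrite (dual_basis (F := fun y => coordf i c1 *: F p (S y * d))) //; lin.
rewrite (sw_coassoc (F := fun c1 c2 d => coordf i c1 *: F p (S c2 * d)));
  [|lin..].
apply: eq_tlift => c d.
by rewrite (sw_antipodel (f := fun y => coordf i c *: F p y)) //; lin.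
Qed.

Lemma dual_actM y phi psi :
  dual_act y (psi * phi : dual H) = dual_act (dual_act y psi) phi.
Proof.
rewrite {1 3}/dual_act (lin_tlift_fun (F := fun y => dual_act y phi)); [|lin].
transitivity (\sw_(a, b <- y) \sw_(c, d <- b) (psi (S d) *: (phi (S c) *: a))).
  apply: eq_tlift => a b; rewrite dual_scaleM.
  rewrite (sw_of_antipode _ (F := fun c d => psi c *: (phi d : K^o))); [|lin..].
  rewrite -tlift_scale.
  by apply: eq_tlift => c d; rewrite scalerA.
rewrite -(sw_coassoc (F := fun a c d => psi (S d) *: (phi (S c) *: a)));
  [|lin..].
apply: eq_tlift => a b.
rewrite (lin_scaleE (F := fun y => dual_act y phi)); [|lin].
by rewrite -tliftZ.
Qed.

(** The Casimir property of L_1 (x) S(L_2), read through the action. *)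
Lemma dual_act_integral L h phi : left_integral L ->
  h * dual_act L phi = dual_act L (pullback phi (fun x => x * h)).
Proof.
move=> intL; rewrite /dual_act mul_tliftr.
transitivity (\sw_(a, b <- L) (phi (S b) *: (h * a))).
  by apply: eq_tlift => a b; rewrite scalerAr.
rewrite (sw_integral_r _ intL (F := fun a b => phi b *: a)); [|lin..].
by apply: eq_tlift => a b; rewrite pullbackE //; lin.
Qed.

(** The source algebra acts on H by right multiplication through the dual. *)
Lemma dual_act_eps_s y w :
  dual_act y (pullback (counit : dual H) (fun x => S (eps_s w) * x)) = y * eps_s w.
Proof.
transitivity (\sw_(a, b <- y) (counit (b * eps_s w) *: a)).
  apply: eq_tlift => a b; rewrite pullbackE; [|lin].
  by rewrite -antipodeM counit_antipode.
rewrite -(sw_mul_eps_s _ _ (F := fun a b => counit b *: a)); [|lin..].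
by rewrite (sw_counitr (f := fun a => a)) //; lin.
Qed.

(** * Endomorphisms of the space of left integrals *)

(** The extension x |-> alpha(E(x_(0))).x_(1) of an endomorphism alpha of the
    integrals to an endomorphism of the Hopf module H. *)
Definition int_ext (alpha : 'End(H)) x : H :=
  \sum_(i < n) dual_act (alpha (int_proj (e_ i * x))) (coordf i).

Section IntEndo.
Variable alpha : 'End(H).
Hypothesis int_alpha : forall L, left_integral L -> left_integral (alpha L).

(** Left multiplication by h commutes with the extension because it only
    affects the forms e^i ([dual_act_integral]). Hence the extension is right
    multiplication by its value at 1. *)
Lemma int_ext_mull h x : int_ext alpha (h * x) = h * int_ext alpha x.
Proof.
pose R phi y : H := dual_act (alpha (int_proj (y * x))) phi.
transitivity (\sum_(i < n) R (coordf i) (e_ i * h)).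
  by apply: eq_bigr => i _; rewrite /R mulrA.
rewrite (dual_basis_comp (R := R) (g := fun y => y * h)); [|rewrite /R; lin..].
rewrite mulr_sumr; apply: eq_bigr => i _; rewrite dual_act_integral //.
exact/int_alpha/int_proj_integral.
Qed.

Lemma int_extE x : int_ext alpha x = x * int_ext alpha 1.
Proof. by rewrite -{1}(mulr1 x) int_ext_mull. Qed.

(** The extension commutes with the action of the dual; stated at 1, where
    the extension of 1.phi is (1.phi)u for u the value at 1. *)
Lemma dual_act_int_ext phi : dual_act (int_ext alpha 1) phi = dual_act 1 phi * int_ext alpha 1.
Proof.
rewrite -int_extE.
transitivity (\sum_(i < n) dual_act (alpha (int_proj (e_ i)))
    ((coordf i : dual H) * phi : dual H)).
  rewrite (lin_sumE (F := fun y => dual_act y phi)); [|lin].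
  by apply: eq_bigr => i _; rewrite dual_actM mulr1.
transitivity (\sum_(i < n) \sum_(j < n) phi (e_ j) *:
  dual_act (alpha (int_proj (e_ i))) ((coordf i : dual H) * (coordf j : dual H) : dual H)).
  apply: eq_bigr => i _; symmetry.
  by rewrite (dual_basis_form (F := fun psi => dual_act (alpha (int_proj (e_ i)))
    ((coordf i : dual H) * psi : dual H))) //; lin.
rewrite -(dual_basis_comul (R := fun psi a b => phi b *:
  dual_act (alpha (int_proj a)) psi)); [|lin..].
apply: eq_bigr => i _.
rewrite -(int_proj_eps_s _ (F := fun a b => phi b *: dual_act (alpha a) (coordf i)));
  [|lin..].
rewrite (sw_eps_s_r _ (F := fun a b => phi b *:
  dual_act (alpha (int_proj a)) (coordf i))); [|lin..].
rewrite {3}/dual_act.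
rewrite (lin_tlift_fun (F := fun y => dual_act (alpha (int_proj (e_ i * y))) (coordf i)));
  [|lin].
apply: eq_tlift => a b.
by rewrite (lin_scaleE (F := fun y => dual_act (alpha (int_proj (e_ i * y))) (coordf i)));
  [|lin].
Qed.

Lemma int_ext_comm w : int_ext alpha 1 * eps_s w = eps_s w * int_ext alpha 1.
Proof. by rewrite -!dual_act_eps_s dual_act_int_ext dual_act_eps_s mul1r. Qed.

(** Write u for the element. By [dual_act_int_ext], u_1 (x) S(u_2) =
    1_1 u (x) S(1_2), so eps_t(u) = 1_1 u S(1_2). As u commutes with the source
    algebra, this is u 1_1 S(1_2) = u. *)
Lemma int_ext_eps_t : eps_t (int_ext alpha 1) = int_ext alpha 1.
Proof.
set u := int_ext alpha 1.
have e y : \sum_(i < n) dual_act y (coordf i) * e_ i = \sw_(a, b <- y) (a * S b).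
  transitivity (\sum_(i < n) \sw_(a, b <- y) (coordf i (S b) *: (a * e_ i))).
    apply: eq_bigr => i _; rewrite mul_tliftl.
    by apply: eq_tlift => a b; rewrite -scalerAl.
  rewrite sum_tlift; apply: eq_tlift => a b.
  by rewrite (dual_basis (F := fun y => a * y)) //; lin.
rewrite -antipoder -e.
under eq_bigr do rewrite dual_act_int_ext.
transitivity (\sw_(a, b <- 1) (a * u * S b)).
  transitivity (\sum_(i < n) \sw_(a, b <- 1) (coordf i (S b) *: (a * u * e_ i))).
    apply: eq_bigr => i _; rewrite !mul_tliftl.
    by apply: eq_tlift => a b; rewrite -!scalerAl.
  rewrite sum_tlift; apply: eq_tlift => a b.
  by rewrite (dual_basis (F := fun y => a * u * y)) //; lin.
rewrite -(sw_eps_s_one (F := fun a b => a * u * S b)); [|lin..].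
transitivity (u * eps_t 1); last by rewrite eps_t1 mulr1.
rewrite -antipoder mul_tliftr -[RHS](sw_eps_s_one (F := fun a b => u * (a * S b))); [|lin..].
by apply: eq_tlift => a b; rewrite mulrA int_ext_comm.
Qed.

Hypothesis lin_alpha : forall L w, left_integral L ->
  alpha (L * eps_s w) = alpha L * eps_s w.

(** The extension agrees with alpha on integrals: by [int_proj_of_integral] the
    projection of e_i L is L times an element of the source algebra, and alpha
    commutes with that element. *)
Lemma int_endo_mul L : left_integral L -> alpha L = L * int_ext alpha 1.
Proof.
move=> intL; rewrite -int_extE -[LHS]hopf_module_decomp.
apply: eq_bigr => i _; rewrite !int_proj_of_integral //; last exact: int_alpha.
by rewrite -int_weight_eps_s lin_alpha.
Qed.

End IntEndo.

End IntegralsTheory.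

(** * Finite-dimensional linear algebra *)

Section FiniteDimension.
Variable K : fieldType.
Local Notation "c *: v" := (@GRing.scale K _ c v) : ring_scope.
Implicit Types (U V : vectType K).

Lemma dim_dual V : \dim {:dual V} = \dim {:V}.
Proof. by rewrite !dimvf /dim /= muln1. Qed.

Lemma form_ext V (x y : V) : (forall phi : dual V, phi x = phi y) -> x = y.
Proof.
move=> xy; rewrite (coord_vbasis (memvf x)) (coord_vbasis (memvf y)).
by apply: eq_bigr => i _; rewrite -!coordfE xy.
Qed.

Lemma inj_limg U V (f : 'Hom(U, V)) : \dim {:U} = \dim {:V} ->
  (forall x, f x = 0 -> x = 0) -> limg f = fullv.
Proof.
move=> dUV f0; apply/eqP; rewrite -(geq_leqif (dimv_leqif_eq (subvf _))).
rewrite -dUV -(limg_ker_dim f fullv).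
suff -> : (fullv :&: lker f = 0)%VS by rewrite dimv0.
apply/eqP; rewrite -subv0; apply/subvP => x.
by rewrite memv_cap memv_ker memv0 => /andP[_ /eqP/f0->].
Qed.

Lemma bij_of_inj U V (f : 'Hom(U, V)) : \dim {:U} = \dim {:V} ->
  (forall x, f x = 0 -> x = 0) -> bijective f.
Proof.
move=> dUV f0; have limgf := inj_limg dUV f0.
have fK y : f (f^-1%VF y) = y by rewrite limg_lfunVK // limgf memvf.
exists f^-1%VF => // x; apply/eqP; rewrite -subr_eq0; apply/eqP/f0.
by rewrite linearB /= fK subrr.
Qed.

Lemma bij_of_surj U V (f : 'Hom(U, V)) : \dim {:U} = \dim {:V} ->
  (forall y, exists x, f x = y) -> bijective f.
Proof.
move=> dUV fs; apply: bij_of_inj => // x fx0.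
have := limg_ker_dim f fullv.
have -> : limg f = fullv.
  apply/vspaceP => y; rewrite memvf.
  by have [z <-] := fs y; apply: memv_img; apply: memvf.
rewrite -dUV => /eqP;
  rewrite -{2}[\dim fullv]add0n eqn_add2r dimv_eq0 => /eqP k0.
by apply/eqP; rewrite -memv0 -k0 memv_cap memvf memv_ker fx0 eqxx.
Qed.

(** A bilinear form without left kernel embeds the first space into the dual
    of the second. *)
Lemma leq_dim_pairing U V (B : U -> V -> K^o) (A : {vspace U}) (C : {vspace V}) :
  (forall y, lin (B^~ y)) -> (forall x, lin (B x)) ->
  (forall x, x \in A -> (forall y, y \in C -> B x y = 0) -> x = 0) ->
  (\dim A <= \dim C)%N.
Proof.
move=> l1 l2 ndg.
pose f := linfun (fun x => \row_(j < \dim C) (B x (vbasis C)`_j : K)).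
have fE x : f x = \row_(j < \dim C) (B x (vbasis C)`_j : K).
  apply: linfun_lin => c u v; apply/rowP => j.
  by rewrite !mxE (l1 _ c u v).
rewrite -(limg_ker_dim f A).
have -> : (A :&: lker f = 0)%VS.
  apply/eqP; rewrite -subv0; apply/subvP => x.
  rewrite memv_cap memv_ker memv0 => /andP[xA /eqP fx0];
    apply/eqP/ndg => // y yC.
  rewrite (coord_vbasis yC) (lin_sumE _ (l2 x)); apply: big1 => j _.
  rewrite (lin_scaleE _ _ (l2 x)); have := congr1 (fun r : 'rV_ _ => r 0 j) fx0.
  by rewrite fE !mxE => ->; rewrite scaler0.
rewrite dimv0 add0n; apply: leq_trans (dimvS (subvf _)) _.
by rewrite dimvf dim_matrix [(_ * _)%R]mul1n.
Qed.

End FiniteDimension.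

(** * Casimir elements and Frobenius structures *)

Section Casimir.
Variables (K : fieldType) (A : falgType K).
Local Notation "c *: v" := (@GRing.scale K _ c v) : ring_scope.
Implicit Types (V : vectType K) (c : A *t A) (e : 'Hom(A, K^o)) (x y h : A).

Definition casimir c := forall h, (h \ox 1) * c = c * (1 \ox h).

Lemma tlift_mul_tensl V (F : A -> A -> V) c h :
  (forall b, lin (F^~ b)) -> (forall a, lin (F a)) ->
  tlift F ((h \ox 1) * c) = \sweedler_(a, b <- c) F (h * a) b.
Proof.
move=> l1 l2; rewrite tlift_falg_mul // lin_tlift_tens; [|lin..].
by apply: eq_tlift => a b; rewrite mul1r.
Qed.

Lemma tlift_mul_tensr V (F : A -> A -> V) c h :
  (forall b, lin (F^~ b)) -> (forall a, lin (F a)) ->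
  tlift F (c * (1 \ox h)) = \sweedler_(a, b <- c) F a (b * h).
Proof.
move=> l1 l2; rewrite tlift_falg_mul //; apply: eq_tlift => a b.
by rewrite lin_tlift_tens ?mulr1 //; lin.
Qed.

Lemma casimir_sw V (F : A -> A -> V) c h : casimir c ->
  (forall b, lin (F^~ b)) -> (forall a, lin (F a)) ->
  \sweedler_(a, b <- c) F (h * a) b = \sweedler_(a, b <- c) F a (b * h).
Proof. by move=> cas l1 l2;
  rewrite -tlift_mul_tensl // cas tlift_mul_tensr. Qed.

Lemma casimirP c : (forall h,
  \sweedler_(a, b <- c) ((h * a) \ox b) = \sweedler_(a, b <- c) (a \ox (b * h)))
  -> casimir c.
Proof.
move=> ch h; rewrite -[LHS]tlift_tensE -[RHS]tlift_tensE.
by rewrite tlift_mul_tensl ?tlift_mul_tensr //; lin.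
Qed.

(** Every bimodule map A -> A (x) A has this form, with c its value at 1. *)
Definition casimir_comul c : 'Hom(A, A *t A) := linfun (fun h => (h \ox 1) * c).

Lemma casimir_comulE c h : casimir_comul c h = (h \ox 1) * c.
Proof. by apply: linfun_lin; lin. Qed.

(** Coassociativity is automatic: both sides are
    x a' (x) b' a (x) b, by the Casimir property of the inner copy of c. *)
Lemma casimir_noncounital_Frobenius c :
  casimir c -> noncounital_Frobenius (casimir_comul c).
Proof.
move=> cas; split; [|split].
- apply/lfunP => x; rewrite !comp_lfunE casimir_comulE.
  transitivity (\sweedler_(a, b <- c) \sweedler_(a', b' <- c)
    ((x * a') \ox ((b' * a) \ox b)) : A *t (A *t A)).
    rewrite -[in LHS](tlift_tensE (_ * c)).
    rewrite (lfun_tlift (casimir_comul c \ox \1)%VF) lfun_tlift.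
    rewrite tlift_mul_tensl; [|lin..].
    apply: eq_tlift => a b; rewrite tmap_tens id_lfunE casimir_comulE.
    rewrite -[in LHS](tlift_tensE (_ * c)) tlift_tensl lfun_tlift.
    rewrite tlift_mul_tensl; [|lin..].
    rewrite -(casimir_sw _ cas (F := fun a' b' => (x * a') \ox (b' \ox b)));
      [|lin..].
    by apply: eq_tlift => a' b'; rewrite tassoc_tens mulrA.
  rewrite -[in RHS](tlift_tensE (_ * c)).
  rewrite (lfun_tlift (\1 \ox casimir_comul c)%VF) tlift_mul_tensl; [|lin..].
  rewrite exchange_tlift; apply: eq_tlift => a b.
  rewrite tmap_tens id_lfunE casimir_comulE -[in RHS](tlift_tensE (_ * c)).
  by rewrite tlift_mul_tensl; [rewrite tlift_tensr|lin..].
- apply: tens_ext => x y; rewrite !comp_lfunE tmap_tens id_lfunE tmult_tens.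
  rewrite !casimir_comulE -[in LHS](tlift_tensE (_ * c)) -[in RHS](tlift_tensE (_ * c)).
  rewrite tlift_tensl (lfun_tlift (tassoc A A A)).
  rewrite (lfun_tlift (\1 \ox tmult A)%VF) !tlift_mul_tensl; [|lin..].
  transitivity (\sweedler_(a, b <- c) ((x * a) \ox (b * y))).
    by apply: eq_tlift => a b;
      rewrite tassoc_tens tmap_tens id_lfunE tmult_tens.
  rewrite -(casimir_sw _ cas (F := fun a b => (x * a) \ox b)); [|lin..].
  by apply: eq_tlift => a b; rewrite mulrA.
- apply: tens_ext => x y; rewrite !comp_lfunE tmap_tens id_lfunE tmult_tens.
  rewrite !casimir_comulE -[in LHS](tlift_tensE (_ * c)) -[in RHS](tlift_tensE (_ * c)).
  rewrite tlift_tensr (lfun_tlift (tassocV A A A)).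
  rewrite (lfun_tlift (tmult A \ox \1)%VF) !tlift_mul_tensl; [|lin..].
  apply: eq_tlift => a b.
  by rewrite tassocV_tens tmap_tens id_lfunE tmult_tens mulrA.
Qed.

Lemma is_counitP (D : 'Hom(A, A *t A)) e : is_counit D e <->
  (forall x, \sweedler_(a, b <- D x) (e a *: b) = x) /\
  (forall x, \sweedler_(a, b <- D x) (e b *: a) = x).
Proof.
have El t : tunitl A ((e \ox \1)%VF t) = \sweedler_(a, b <- t) (e a *: b).
  rewrite -[in LHS](tlift_tensE t) (lfun_tlift (e \ox \1)%VF) lfun_tlift.
  by apply: eq_tlift => a b; rewrite tmap_tens id_lfunE tunitl_tens.
have Er t : tunitr A ((\1 \ox e)%VF t) = \sweedler_(a, b <- t) (e b *: a).
  rewrite -[in LHS](tlift_tensE t) (lfun_tlift (\1 \ox e)%VF) lfun_tlift.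
  by apply: eq_tlift => a b; rewrite tmap_tens id_lfunE tunitr_tens.
split=> [[/lfunP e1 /lfunP e2]|[e1 e2]].
  split=> x; first by rewrite -El; have := e1 x; rewrite !comp_lfunE id_lfunE.
  by rewrite -Er; have := e2 x; rewrite !comp_lfunE id_lfunE.
by split; apply/lfunP => x; rewrite !comp_lfunE id_lfunE ?El ?Er.
Qed.

Section Form.
Variables (c : A *t A) (e : 'Hom(A, K^o)).
Hypothesis cas : casimir c.
Hypothesis e1 : \sweedler_(a, b <- c) (e a *: b) = 1.

Lemma casimir_forml x : \sweedler_(a, b <- c) (e (x * a) *: b) = x.
Proof.
rewrite (casimir_sw _ cas (F := fun a b => e a *: b)); [|lin..].
rewrite -[RHS]mul1r -e1 mul_tliftl.
by apply: eq_tlift => a b; rewrite scalerAl.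
Qed.

(** A form that is a counit on one side is one on the other. The map
    h |-> e(h -) is injective by [casimir_forml], hence onto, and any form
    e(h -) takes the same value at the two sides. *)
Lemma casimir_formr1 : \sweedler_(a, b <- c) (e b *: a) = 1.
Proof.
pose f : 'Hom(A, dual A) := linfun (fun h => linfun (fun x => e (h * x)) : dual A).
have fE h x : f h x = e (h * x).
  rewrite /f linfun_lin; first by rewrite linfun_lin //; lin.
  move=> k u v; apply/lfunP => y; rewrite add_lfunE scale_lfunE.
  by rewrite !linfun_lin; [|lin..]; rewrite mulrDl -scalerAl linearP.
have limgf : limg f = fullv.
  apply: inj_limg; first by rewrite dim_dual.
  move=> h fh0; rewrite -(casimir_forml h) tlift_sum.
  by do 2!(apply: big1 => ? _); rewrite -fE fh0 zero_lfunE scale0r scaler0.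
apply: form_ext => phi;
  have /memv_imgP[h _ ->] : phi \in limg f by rewrite limgf memvf.
rewrite !fE mulr1 -(casimir_forml h) mul_tliftr !lfun_tlift.
rewrite [in LHS](casimir_forml h).
by apply: eq_tlift => a b; rewrite -scalerAr !linearZ /=; exact: mulrC.
Qed.

Lemma casimir_formr x : \sweedler_(a, b <- c) (e (b * x) *: a) = x.
Proof.
rewrite -(casimir_sw _ cas (F := fun a b => e b *: a)); [|lin..].
rewrite -[RHS]mulr1 -casimir_formr1 mul_tliftr.
by apply: eq_tlift => a b; rewrite scalerAr.
Qed.

Lemma casimir_is_counit : is_counit (casimir_comul c) e.
Proof.
apply/is_counitP; split=> x; rewrite casimir_comulE.
  by rewrite tlift_mul_tensl; [exact: casimir_forml|lin..].
rewrite cas tlift_mul_tensr; [|lin..]; exact: casimir_formr.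
Qed.

Lemma casimir_Frobenius : Frobenius_algebra A.
Proof.
have [coA bim] := casimir_noncounital_Frobenius cas.
by exists (casimir_comul c); split=> //; exists e; exact: casimir_is_counit.
Qed.

End Form.

Lemma counit_uniq (D : 'Hom(A, A *t A)) e e' :
  is_counit D e -> is_counit D e' -> e = e'.
Proof.
move=> /is_counitP[_ e2] /is_counitP[e1 _]; apply/lfunP => x.
rewrite -{1}(e1 x) -[in RHS](e2 x) !lfun_tlift; apply: eq_tlift => a b.
by rewrite !linearZ; exact: mulrC.
Qed.

Lemma Frobenius_casimir : Frobenius_algebra A -> exists (c : A *t A) e,
  casimir c /\ \sweedler_(a, b <- c) (e a *: b) = 1.
Proof.
move=> [D [coA [e /is_counitP[e1 _]] [/lfunP bl /lfunP br]]].
exists (D 1), e; split; last exact: e1.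
move=> h; transitivity (D h).
  have := br (h \ox 1);
    rewrite !comp_lfunE tmap_tens id_lfunE tmult_tens mulr1 => <-.
  rewrite -[in LHS](tlift_tensE (D 1)) -[in RHS](tlift_tensE (D 1)).
  rewrite tlift_tensr (lfun_tlift (tassocV A A A)).
  rewrite (lfun_tlift (tmult A \ox \1)%VF) mul_tliftr; apply: eq_tlift => a b.
  by rewrite tassocV_tens tmap_tens id_lfunE tmult_tens tensM mul1r.
have := bl (1 \ox h);
  rewrite !comp_lfunE tmap_tens id_lfunE tmult_tens mul1r => <-.
rewrite -[in LHS](tlift_tensE (D 1)) -[in RHS](tlift_tensE (D 1)).
rewrite tlift_tensl (lfun_tlift (tassoc A A A)).
rewrite (lfun_tlift (\1 \ox tmult A)%VF) mul_tliftl; apply: eq_tlift => a b.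
by rewrite tassoc_tens tmap_tens id_lfunE tmult_tens tensM mulr1.
Qed.

End Casimir.

(** * The source and target subalgebras *)

Section Bases.
Variables (K : fieldType) (H : weakHopfType K).
Local Notation "c *: v" := (@GRing.scale K _ c v) : ring_scope.
Local Notation S := (@antipode K H).
Implicit Types (V : vectType K) (x y z h w a b c d L r : H).

Definition base_s : {vspace H} := limg (linfun (fun x : H => eps_s x)).
Definition base_t : {vspace H} := limg (linfun (fun x : H => eps_t x)).
Definition integrals : {vspace H} := limg (linfun (fun x : H => int_proj x)).

Lemma base_sP x : reflect (eps_s x = x) (x \in base_s).
Proof.
apply: (iffP memv_imgP) => [[y _ ->]|<-].
  by rewrite linfun_lin ?eps_s_id //; lin.
by exists x; rewrite ?memvf // linfun_lin ?eps_s_id //; lin.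
Qed.

Lemma base_tP x : reflect (eps_t x = x) (x \in base_t).
Proof.
apply: (iffP memv_imgP) => [[y _ ->]|<-].
  by rewrite linfun_lin ?eps_t_id //; lin.
by exists x; rewrite ?memvf // linfun_lin ?eps_t_id //; lin.
Qed.

Lemma eps_s_base x : eps_s x \in base_s.
Proof. by apply/base_sP; rewrite eps_s_id. Qed.

Lemma eps_t_base x : eps_t x \in base_t.
Proof. by apply/base_tP; rewrite eps_t_id. Qed.

Lemma integralsP x : reflect (left_integral x) (x \in integrals).
Proof.
apply: (iffP memv_imgP) => [[y _ ->]|intx].
  by rewrite linfun_lin; [exact: int_proj_integral|lin].
exists x; rewrite ?memvf // linfun_lin; last by lin.
rewrite -[in RHS](mul1r x) int_proj_of_integral // /int_weight.
suff -> : \sw_(a, b <- 1) (counit (S (S b) * 1) *: a) = 1 :> H by rewrite mulr1.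
rewrite -[RHS](sw_counitr (f := fun a => a)); last by lin.
by apply: eq_tlift => a b; rewrite mulr1 !counit_antipode.
Qed.

Lemma integral_mulr x h : left_integral x -> left_integral (x * h).
Proof. by move=> intx k; rewrite !mulrA intx. Qed.

Lemma base_s1 : 1 \in base_s.
Proof. by apply/base_sP; exact: eps_s1. Qed.

Lemma base_s_mul x y : x \in base_s -> y \in base_s -> x * y \in base_s.
Proof.
move=> /base_sP <- /base_sP <-; apply/base_sP.
rewrite -[RHS](sw_counitr (f := fun a => a)); last by lin.
rewrite (sw_eps_s_mul _ _ (F := fun a b => counit b *: a)); [|lin..].
rewrite (sw_of_eps_s' _ (F := fun a b => counit (eps_s x * b) *: a)); [|lin..].
by apply: eq_tlift => a b; rewrite mulrA.
Qed.

Lemma antipode_base x : x \in base_t -> S x \in base_s.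
Proof. by move=> /base_tP <-; rewrite antipode_of_eps_t eps_s_base. Qed.

(** Delta(1) lies in the tensor product of the source and target algebras. *)
Lemma sw_one_in V (F : H -> H -> V) (U : {vspace V}) :
  (forall b, lin (F^~ b)) -> (forall a, lin (F a)) ->
  (forall a b, a \in base_s -> b \in base_t -> F a b \in U) ->
  \sw_(a, b <- 1) F a b \in U.
Proof.
move=> l1 l2 FU;
  rewrite -sw_eps_s_one // -(sw_eps_t_one (F := fun a b => F (eps_s a) b)); [|lin..].
rewrite tlift_sum; do 2!(apply: rpred_sum => ? _); apply: rpredZ.
by apply: FU; rewrite ?eps_s_base ?eps_t_base.
Qed.

(** The form counit(w z) on the source and target algebras has no kernel on
    either side, since 1_1 counit(w 1_2) = w and counit(1_1 z) 1_2 = z. *)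
Lemma dim_bases : \dim base_s = \dim base_t.
Proof.
apply/eqP; rewrite eqn_leq; apply/andP; split.
  apply: (leq_dim_pairing (B := fun w z => counit (w * z))); [lin|lin|].
  move=> w /base_sP ws nw; rewrite -ws.
  rewrite -[LHS](sw_eps_t_one (F := fun a b => counit (w * b) *: a)); [|lin..].
  rewrite tlift_sum; do 2!(apply: big1 => ? _).
  by rewrite nw ?eps_t_base // scale0r scaler0.
apply: (leq_dim_pairing (B := fun z w => counit (w * z))); [lin|lin|].
move=> z /base_tP zt nz; rewrite -zt.
rewrite -[LHS](sw_eps_s_one (F := fun a b => counit (a * z) *: b)); [|lin..].
rewrite tlift_sum; do 2!(apply: big1 => ? _).
by rewrite nz ?eps_s_base // scale0r scaler0.
Qed.

(** So 1_1 (x) S(1_2) is a Casimir element of the source algebra. With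
    1_1 S(1_2) = 1 ([one_antipode]) it is a separability idempotent. *)
Lemma base_s_casimir V (F : H -> H -> V) w : w \in base_s ->
  (forall b, lin (F^~ b)) -> (forall a, lin (F a)) ->
  \sw_(a, b <- 1) F (w * a) (S b) = \sw_(a, b <- 1) F a (S b * w).
Proof.
move=> /base_sP <- l1 l2.
rewrite -sw_eps_s_r // (sw_of_eps_s _ (F := fun a b => F a (eps_s b)));
  [|lin..].
rewrite -[LHS](sw_eps_t_one (F := fun a b => F a (eps_s (b * eps_s w))));
  [|lin..].
rewrite -[RHS](sw_eps_t_one (F := fun a b => F a (S b * eps_s w))); [|lin..].
apply: eq_tlift => a b; congr (F a _).
rewrite -antipodel (sw_mul_eps_s _ _ (F := fun a b => S a * b)); [|lin..].
rewrite antipode_of_eps_t -[eps_s (eps_t b)]antipodel mul_tliftl.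
by apply: eq_tlift => c d; rewrite mulrA.
Qed.

(** The average of a linear map over the separability idempotent, a map of right
    modules over the source algebra. *)
Definition avg (g : H -> H) x : H := \sw_(a, b <- 1) (g (x * a) * S b).

Lemma lin_avg V (g : H -> H) (f : V -> H) : lin g -> lin f ->
  lin (fun v => avg g (f v)).
Proof. by move=> lg lf; rewrite /avg; lin. Qed.

Lemma avg_mulr g x w : lin g -> w \in base_s -> avg g (x * w) = avg g x * w.
Proof.
move=> lg ws; rewrite /avg mul_tliftl.
transitivity (\sw_(a, b <- 1) (g (x * (w * a)) * S b)).
  by apply: eq_tlift => a b; rewrite mulrA.
rewrite (base_s_casimir ws (F := fun a b => g (x * a) * b)); [|lin..].
by apply: eq_tlift => a b; rewrite mulrA.
Qed.

Definition stable_s (U : {vspace H}) :=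
  forall x w, x \in U -> w \in base_s -> x * w \in U.

Lemma avg_in g x (U : {vspace H}) : lin g -> stable_s U ->
  (forall y, g y \in U) -> avg g x \in U.
Proof.
move=> lg sU gU; apply: sw_one_in; [lin|lin|] => a b _ bt.
by apply: sU; rewrite ?antipode_base.
Qed.

Lemma one_antipode y : \sw_(a, b <- 1) (y * (a * S b)) = y.
Proof. by rewrite (sw_antipoder (f := fun x => y * x)) ?eps_t1 ?mulr1 //;
  lin. Qed.

(** Maschke's argument: the average of a linear projection is a projection of
    modules. *)
Lemma stable_projection (U : {vspace H}) : stable_s U ->
  exists pi : 'End(H), [/\ forall x, pi x \in U, forall x, x \in U -> pi x = x
   & forall x w, w \in base_s -> pi (x * w) = pi x * w].
Proof.
move=> sU; have lg : lin (fun x => projv U x) by lin.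
have la : lin (fun x => avg (fun x => projv U x) x) by apply: lin_avg; lin.
exists (linfun (fun x => avg (fun x => projv U x) x)).
split=> [x|x xU|x w ws]; rewrite !linfun_lin //.
- by apply: avg_in => // y; apply: memv_proj.
- rewrite -[RHS]one_antipode /avg.
  rewrite -(sw_eps_s_one (F := fun a b => projv U (x * a) * S b)); [|lin..].
  rewrite -(sw_eps_s_one (F := fun a b => x * (a * S b))); [|lin..].
  apply: eq_tlift => a b; rewrite projv_id ?mulrA //.
  by apply: sU; rewrite ?eps_s_base.
- exact: avg_mulr.
Qed.

(** The image of 1 under a module projection onto the ideal. *)
Lemma right_ideal_unit (U : {vspace H}) : stable_s U -> (U <= base_s)%VS ->
  exists2 p, p \in U & forall r, r \in U -> p * r = r.
Proof.
move=> sU Us; have [pi [piU piK pil]] := stable_projection sU.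
exists (pi 1) => // r rU.
by rewrite -pil ?mul1r ?piK // (subvP Us).
Qed.

Lemma integrals_stable : stable_s integrals.
Proof.
by move=> x w /integralsP ix _; apply/integralsP; exact: integral_mulr.
Qed.

End Bases.

(** * A generator of the left integrals of a Frobenius weak Hopf algebra *)

Section FrobeniusIntegrals.
Variables (K : fieldType) (H : weakHopfType K).
Local Notation "c *: v" := (@GRing.scale K _ c v) : ring_scope.
Local Notation S := (@antipode K H).
Local Notation I := (integrals H).
Local Notation Hs := (base_s H).
Local Notation Ht := (base_t H).
Implicit Types (V : vectType K) (x y z h w a b d L r p : H).
Variables (c : H *t H) (f : 'Hom(H, K^o)).
Hypotheses (cas : casimir c) (f1 : \sweedler_(a, b <- c) (f a *: b) = 1).

(** The Frobenius form pairs I with the target algebra, as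
    f(xL) = f(eps_t(x) L) for L in I. *)
Lemma integral_form L : L \in I ->
  (forall z, z \in Ht -> f (z * L) = 0) -> L = 0.
Proof.
move=> /integralsP iL f0; rewrite -(casimir_formr cas f1 L) tlift_sum.
by do 2!(apply: big1 => ? _); rewrite iL f0 ?eps_t_base // scale0r scaler0.
Qed.

(** For every form phi, phi(eps_t(b)) a is a left integral, and f applied to z
    times it gives phi(z). *)
Lemma base_t_form z : z \in Ht ->
  (forall L, L \in I -> f (z * L) = 0) -> z = 0.
Proof.
move=> /base_tP zt f0; apply: form_ext => phi; rewrite linear0 -zt.
pose L : H := \sweedler_(a, b <- c) (phi (eps_t b) *: a).
have iL : L \in I.
  have hL h : h * L = \sweedler_(a, b <- c) (phi (eps_t (b * h)) *: a).
    rewrite -(casimir_sw _ cas (F := fun a b => phi (eps_t b) *: a)); [|lin..].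
    by rewrite mul_tliftr; apply: eq_tlift => a b; rewrite scalerAr.
  apply/integralsP => h; rewrite !hL; apply: eq_tlift => a b.
  by rewrite eps_t_mulr.
rewrite -[RHS](f0 L iL) mul_tliftr [RHS]lfun_tlift -[in LHS](casimir_forml cas f1 z).
rewrite (lin_tlift_fun (F := fun x => phi (eps_t x))); [|lin].
apply: eq_tlift => a b; rewrite (lin_scaleE (F := fun x => phi (eps_t x)));
  [|lin].
by rewrite -scalerAr linearZ; exact: mulrC.
Qed.

Lemma dim_integrals : \dim I = \dim Hs.
Proof.
rewrite dim_bases; apply/eqP; rewrite eqn_leq; apply/andP; split.
  apply: (leq_dim_pairing (B := fun L z => f (z * L))); [lin|lin|].
  exact: integral_form.
apply: (leq_dim_pairing (B := fun z L => f (z * L))); [lin|lin|].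
exact: base_t_form.
Qed.

Lemma amullE L w : amull L w = L * w.
Proof. by rewrite lfunE. Qed.

Lemma orbitP L x : reflect (exists2 w, w \in Hs & x = L * w) (x \in (amull L @: Hs)%VS).
Proof.
by apply: (iffP memv_imgP) => -[w ws ->]; exists w => //; rewrite amullE.
Qed.

Section Step.
Variable L : H.
Hypothesis iL : L \in I.
Local Notation N := (amull L @: Hs)%VS.
Let P : {vspace H} := (Hs :&: lker (amull L))%VS.

Lemma orbit_stable : stable_s N.
Proof.
move=> x w /orbitP[v vs ->] ws; apply/orbitP; exists (v * w); rewrite ?mulrA //.
exact: base_s_mul.
Qed.

Lemma orbit_sub : (N <= I)%VS.
Proof.
apply/subvP => x /orbitP[w ws ->]; apply/integralsP/integral_mulr.
exact/integralsP.
Qed.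

Lemma annP w : reflect (w \in Hs /\ L * w = 0) (w \in P).
Proof.
rewrite memv_cap memv_ker amullE; apply: (iffP andP) => -[-> /eqP ->] //.
Qed.

Lemma ann_stable : stable_s P.
Proof.
move=> x w /annP[xs Lx] ws; apply/annP; split; first exact: base_s_mul.
by rewrite mulrA Lx mul0r.
Qed.

Variables (pi : 'End(H)) (p : H).
Hypotheses (piN : forall x, pi x \in N) (piK : forall x, x \in N -> pi x = x).
Hypothesis pil : forall x w, w \in Hs -> pi (x * w) = pi x * w.
Hypotheses (pP : p \in P) (pK : forall r, r \in P -> p * r = r).
Let W : {vspace H} := (I :&: lker pi)%VS.

Lemma complP x : reflect (x \in I /\ pi x = 0) (x \in W).
Proof. by rewrite memv_cap memv_ker; apply: (iffP andP) => -[-> /eqP ->]. Qed.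

Lemma compl_stable : stable_s W.
Proof.
move=> x w /complP[xI px] ws; apply/complP; split.
  exact: integrals_stable.
by rewrite pil // px mul0r.
Qed.

Lemma pi_integrals : (pi @: I)%VS = N.
Proof.
apply/vspaceP => x; apply/memv_imgP/idP => [[y _ ->] //|xN].
by exists x; rewrite ?piK // (subvP orbit_sub).
Qed.

Lemma dim_compl : \dim W = \dim P.
Proof.
apply/eqP; rewrite -(eqn_add2r (\dim N)) limg_ker_dim -{1}pi_integrals.
by rewrite limg_ker_dim dim_integrals.
Qed.

(** The new generator L + xp satisfies (L + xp)(w - pw) = Lw and (L + xp)p = xp,
    so its orbit contains the old one and xp, which lies in a complement. *)
Lemma orbit_enlarge x r : x \in W -> r \in P -> x * r != 0 ->
  L + x * p \in I /\ (\dim N < \dim (amull (L + x * p) @: Hs)%VS)%N.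
Proof.
move=> xW rP xr0; have [ps Lp] := annP _ pP.
have xpW : x * p \in W by apply: compl_stable.
have [xpI pxp] := complP _ xpW.
split; first exact: rpredD.
have sub : (N <= amull (L + x * p) @: Hs)%VS.
  apply/subvP => y /orbitP[w ws ->]; apply/orbitP; exists (w - p * w).
    by rewrite rpredB // base_s_mul.
  rewrite mulrDl mulrBr mulrA Lp mul0r subr0 -mulrA mulrBr mulrA (pK pP) subrr.
  by rewrite mulr0 addr0.
have /leqifP := dimv_leqif_eq sub; case: eqP => // eN.
have /piK : x * p \in N.
  rewrite eN; apply/orbitP; exists p => //.
  by rewrite mulrDl Lp add0r -mulrA (pK pP).
rewrite pxp => xp0; case/eqP: xr0.
by rewrite -(pK rP) mulrA -xp0 mul0r.
Qed.

Hypothesis WP0 : forall x r, x \in W -> r \in P -> x * r = 0.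

(** The image of such a map is a right ideal of the source algebra with a left
    unit q = g(x), and q = g(x)q = g(xq), where xq lies in WP = 0. *)
Lemma hom_compl_ann (g : 'End(H)) :
  (forall x, x \in W -> g x \in P) ->
  (forall x w, w \in Hs -> g (x * w) = g x * w) ->
  forall x, x \in W -> g x = 0.
Proof.
move=> gP gl.
have sR : stable_s (g @: W)%VS.
  move=> y w /memv_imgP[x xW ->] ws; rewrite -gl //; apply: memv_img.
  exact: compl_stable.
have RP : (g @: W <= P)%VS by apply/subvP => y /memv_imgP[x xW ->]; exact: gP.
have Rs : (g @: W <= Hs)%VS by apply: subv_trans RP (capvSl _ _).
have [q qR qK] := right_ideal_unit sR Rs.
have q0 : q = 0.
  have /memv_imgP[x xW e] := qR.
  rewrite -(qK q qR) {1}e -gl; last by rewrite (subvP Rs).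
  by rewrite WP0 ?linear0 // (subvP RP).
by move=> x xW; rewrite -(qK (g x)) ?memv_img // q0 mul0r.
Qed.

(** The average of a linear section of w |-> Lw, composed with the projection
    onto the orbit. *)
Lemma section_exists : exists kap : 'End(H),
  [/\ forall x, kap x \in Hs, forall x, L * kap x = pi x
    & forall x w, w \in Hs -> kap (x * w) = kap x * w].
Proof.
(* The projection onto Hs is used twice: to restrict w |-> L w to Hs, and to
   bring the chosen preimage back into Hs. *)
pose m := (amull L \o projv Hs)%VF.
pose k x := projv Hs (m^-1%VF (pi x)).
have lk : lin k by rewrite /k; lin.
have lavg : lin (avg k) by apply: lin_avg => //; lin.
exists (linfun (avg k)); split=> [x|x|x w ws]; rewrite !linfun_lin //.
- by apply: avg_in => //; [exact: base_s_mul|move=> y; exact: memv_proj].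
- rewrite /avg mul_tliftr -[RHS]one_antipode.
  rewrite -(sw_eps_s_one (F := fun a b => L * (k (x * a) * S b))); [|lin..].
  rewrite -[RHS](sw_eps_s_one (F := fun a b => pi x * (a * S b))); [|lin..].
  apply: eq_tlift => a b; rewrite !mulrA -pil ?eps_s_base //; congr (_ * _).
  have: pi (x * eps_s a) \in limg m.
    have /orbitP[w ws ->] := piN (x * eps_s a).
    by apply/memv_imgP; exists w;
      rewrite ?memvf // comp_lfunE projv_id // amullE.
  by move/limg_lfunVK; rewrite comp_lfunE amullE.
- exact: avg_mulr.
Qed.

(** The module map from I to the source algebra that corresponds to the form
    x |-> f(zx) under the isomorphism of Hom(I, H_s) with the dual of I; the form is
    recovered by the counit ([counit_base_form]). *)
Let base_form z : 'End(H) := linfun (avg (fun x => (f (z * x) : K) *: 1)).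

Lemma lin_base_form z : lin (fun x => (f (z * x) : K) *: (1 : H)).
Proof. by lin. Qed.

Lemma base_formE z x : base_form z x = \sw_(a, b <- 1) (f (z * (x * a)) *: S b).
Proof.
rewrite /base_form linfun_lin; last by apply: lin_avg (lin_base_form z) _; lin.
by apply: eq_tlift => a b; rewrite -scalerAl mul1r.
Qed.

Lemma base_form_mulr z x w : w \in Hs -> base_form z (x * w) = base_form z x * w.
Proof.
move=> ws;
  rewrite /base_form !linfun_lin; try by apply: lin_avg (lin_base_form z) _; lin.
exact: avg_mulr (lin_base_form z) ws.
Qed.

Lemma base_form_in z x : base_form z x \in Hs.
Proof.
by rewrite base_formE; apply: sw_one_in; [lin|lin|] => a b _ bt;
  rewrite rpredZ // antipode_base.
Qed.

Lemma counit_base_form z x : counit (base_form z x) = f (z * x).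
Proof.
rewrite base_formE lfun_tlift -[in RHS](mulr1 x).
rewrite -[RHS](sw_counitr (f := fun a => f (z * (x * a)))); last by lin.
by apply: eq_tlift => a b; rewrite linearZ /= counit_antipode; exact: mulrC.
Qed.

(** Suppose WP = 0 and compare two families of endomorphisms of I, identified
    with elements of the target algebra by [int_endo_mul]: beta_z = L base_form_z
    for z in H_t, with values in the orbit N, and gamma_y for y in W, which maps
    L to y and takes values in W. The two families are independent and the second
    has dimension dim W = dim P, so the kernel Z of z |-> beta_z has dimension at
    least dim P. For z in Z the form base_form_z takes values in P, vanishes on W by
    [hom_compl_ann], and is thus determined by its value at L. Since Lp = 0 this
    value is annihilated by p, so it lies in a subspace Q of P that does not
    contain p. Hence dim P <= dim Z <= dim Q, which forces p = 0. *)
Lemma ann_trivial : P = 0%VS.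
Proof.
have [kap [kaps kapL kapl]] := section_exists.
have [ps Lp] := annP _ pP.
pose beta z : 'End(H) := (amull L \o base_form z)%VF.
pose gamma y : 'End(H) := (amull y \o kap)%VF.
have betaE z x : beta z x = L * base_form z x by rewrite comp_lfunE amullE.
have gammaE y x : gamma y x = y * kap x by rewrite comp_lfunE amullE.
have lbeta : lin beta.
  move=> k u v; apply/lfunP => x; rewrite add_lfunE scale_lfunE !betaE.
  have lg : lin (fun z => L * base_form z x).
    have e z : L * base_form z x = L * \sw_(a, b <- 1) (f (z * (x * a)) *: S b).
      by rewrite base_formE.
    move=> k' u' v'; rewrite !e.
    by have: lin (fun z => L * \sw_(a, b <- 1) (f (z * (x * a)) *: S b)); [lin|exact].
  exact: lg.
have lgamma : lin gamma.
  move=> k u v; apply/lfunP => x; rewrite add_lfunE scale_lfunE !gammaE.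
  by rewrite mulrDl scalerAl.
pose ext (al : 'End(H)) : H := int_ext al 1.
have lext : lin ext by rewrite /ext /int_ext; lin.
pose Bf : 'End(H) := linfun (fun z => ext (beta z)).
pose Cf : 'End(H) := linfun (fun y => ext (gamma y)).
have BE z : Bf z = ext (beta z).
  by rewrite linfun_lin //; apply: lin_comp lext lbeta.
have CE z : Cf z = ext (gamma z).
  by rewrite linfun_lin //; apply: lin_comp lext lgamma.
have intI (al : 'End(H)) : (forall x, x \in I -> al x \in I) ->
    forall x, left_integral x -> left_integral (al x).
  by move=> alI x /integralsP xI; apply/integralsP/alI.
have bI z x : x \in I -> beta z x \in I.
  move=> xI; rewrite betaE; apply: (subvP orbit_sub); apply/orbitP.
  by exists (base_form z x) => //; exact: base_form_in.
have gW y x : y \in W -> gamma y x \in W.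
  by move=> yW; rewrite gammaE; apply: compl_stable.
have gI y x : y \in W -> x \in I -> gamma y x \in I.
  by move=> yW _; have [] := complP _ (gW y x yW).
have Bmul z x : x \in I -> L * base_form z x = x * Bf z.
  move=> xI; rewrite -betaE BE int_endo_mul //; first exact: intI (bI z).
    by move=> y w _; rewrite !betaE base_form_mulr ?eps_s_base // mulrA.
  exact/integralsP.
have Cmul y x : y \in W -> x \in I -> y * kap x = x * Cf y.
  move=> yW xI; rewrite -gammaE CE int_endo_mul //.
  - by apply: intI => u; exact: gI.
  - by move=> u w _; rewrite !gammaE kapl ?eps_s_base // mulrA.
  - exact/integralsP.
have BHt : (Bf @: Ht <= Ht)%VS.
  apply/subvP => u /memv_imgP[z _ ->]; apply/base_tP; rewrite BE.
  exact/int_ext_eps_t/intI/bI.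
have CHt : (Cf @: W <= Ht)%VS.
  apply/subvP => u /memv_imgP[y yW ->]; apply/base_tP; rewrite CE.
  by apply/int_ext_eps_t/intI => x; exact: gI.
(* kap L is congruent to 1 modulo P, and y P = 0. *)
have kapLK y : y \in W -> y * kap L = y.
  move=> yW; apply/eqP; rewrite -subr_eq0 -{2}(mulr1 y) -mulrBr; apply/eqP.
  apply: WP0 => //; apply/annP; split; first by rewrite rpredB ?base_s1.
  rewrite mulrBr mulr1 kapL piK ?subrr //; apply/orbitP; exists 1;
    rewrite ?mulr1 //.
  exact: base_s1.
have gammaN y : y \in W -> gamma y L \in N -> y = 0.
  move=> yW; rewrite gammaE kapLK // => /piK.
  by have [_ ->] := complP _ yW.
have BC0 : (Bf @: Ht :&: Cf @: W = 0)%VS.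
  apply/eqP; rewrite -subv0; apply/subvP => u; rewrite memv_cap memv0.
  case/andP=> /memv_imgP[z _ ->] /memv_imgP[y yW e].
  suff y0 : y = 0 by rewrite e y0 linear0.
  apply: gammaN => //; rewrite gammaE Cmul // -e -Bmul //.
  by apply/orbitP; exists (base_form z L) => //; exact: base_form_in.
have dimC : \dim (Cf @: W) = \dim W.
  rewrite -[RHS](limg_ker_dim Cf W).
  suff -> : (W :&: lker Cf = 0)%VS by rewrite dimv0.
  apply/eqP; rewrite -subv0; apply/subvP => y; rewrite memv_cap memv_ker memv0.
  case/andP=> yW /eqP Cy0; rewrite -(kapLK y yW) Cmul //.
  by rewrite Cy0 mulr0.
pose Z := (Ht :&: lker Bf)%VS.
have dimZ : (\dim P <= \dim Z)%N.
  have : (\dim (Bf @: Ht) + \dim (Cf @: W) <= \dim Ht)%N.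
    by rewrite -(dimv_disjoint_sum BC0) dimvS // subv_add BHt.
  by rewrite -(limg_ker_dim Bf Ht) dimC dim_compl addnC leq_add2r.
pose mp : 'End(H) := linfun (fun r => r * p).
have mpE r : mp r = r * p by rewrite linfun_lin //; lin.
pose Q := (P :&: lker mp)%VS.
have QE r : (r \in Q) = (r \in P) && (r * p == 0).
  by rewrite memv_cap memv_ker mpE.
have dimQ : p != 0 -> (\dim Q < \dim P)%N.
  move=> p0; have /leqifP := dimv_leqif_eq (capvSl P (lker mp)).
  case: eqP => // eQ; case/eqP: p0.
  by move: pP; rewrite -eQ QE => /andP[pP' /eqP]; rewrite (pK pP').
pose th : 'End(H) := linfun (fun z => base_form z L).
have thE z : th z = base_form z L.
  apply: linfun_lin => k u v; rewrite !base_formE.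
  by have: lin (fun z => \sw_(a, b <- 1) (f (z * (L * a)) *: S b)); [lin|exact].
have ZP z x : z \in Z -> x \in I -> base_form z x \in P.
  rewrite memv_cap memv_ker => /andP[_ /eqP Bz0] xI; apply/annP.
  by rewrite base_form_in Bmul // Bz0 mulr0.
have thQ : (th @: Z <= Q)%VS.
  apply/subvP => u /memv_imgP[z zZ ->]; rewrite QE thE ZP //=.
  by rewrite -base_form_mulr // Lp linear0.
have thI : (Z :&: lker th = 0)%VS.
  apply/eqP; rewrite -subv0; apply/subvP => z;
    rewrite memv_cap memv_ker memv0 thE.
  case/andP=> zZ /eqP gL0; apply/eqP; apply: base_t_form.
    by move: zZ; rewrite memv_cap => /andP[].
  move=> x xI; rewrite -counit_base_form.
  suff -> : base_form z x = 0 by rewrite linear0.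
  have -> : x = pi x + (x - pi x) by rewrite addrC subrK.
  rewrite linearD /= [X in _ + X](hom_compl_ann (g := base_form z)).
  - have /orbitP[w ws ->] := piN x.
    by rewrite base_form_mulr // gL0 mul0r addr0.
  - by move=> y /complP[yI _]; exact: ZP.
  - by move=> y w; exact: base_form_mulr.
  - apply/complP; split; last by rewrite linearB /= (piK (piN x)) subrr.
    by rewrite rpredB // (subvP orbit_sub).
have p0 : p = 0.
  apply/eqP/negPn/negP => /dimQ; rewrite ltnNge => /negP; apply.
  apply: leq_trans dimZ _; rewrite -(limg_ker_dim th Z) thI dimv0 add0n.
  exact: dimvS.
apply/eqP; rewrite -subv0; apply/subvP => r rP.
by rewrite memv0 -(pK rP) p0 mul0r.
Qed.

End Step.

(** Induction on the codimension of the orbit, which [orbit_enlarge] decreases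
    unless WP = 0. *)
Lemma integrals_cyclic : exists2 L, L \in I & (amull L @: Hs = I)%VS.
Proof.
suff grow n : forall L, L \in I -> (\dim I <= \dim (amull L @: Hs) + n)%N ->
    exists2 L, L \in I & (amull L @: Hs = I)%VS.
  by apply: (grow (\dim I) 0); rewrite ?mem0v ?leq_addl.
elim: n => [|n IHn] L iL dL.
  exists L => //; apply/eqP;
    rewrite -(geq_leqif (dimv_leqif_eq (orbit_sub iL))).
  by rewrite -(addn0 (\dim (_ @: _))).
have [pi [piN piK pil]] := stable_projection (orbit_stable (L := L)).
have [p pP pK] := right_ideal_unit (ann_stable (L := L)) (capvSl _ _).
set P := (Hs :&: lker (amull L))%VS in pP pK.
pose W := (I :&: lker pi)%VS.
have [/forallP WP0|] := boolP [forall i : 'I_(\dim W), [forall j : 'I_(\dim P),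
   (vbasis W)`_i * (vbasis P)`_j == 0]].
  exists L => //; apply/eqP;
    rewrite -(geq_leqif (dimv_leqif_eq (orbit_sub iL))).
  rewrite dim_integrals -(limg_ker_dim (amull L) Hs).
  rewrite (ann_trivial iL piN piK pil pP pK) ?dimv0 // => x r xW rP.
  rewrite (coord_vbasis xW) (coord_vbasis rP) mulr_suml big1 // => i _.
  rewrite mulr_sumr big1 // => j _.
  by rewrite -scalerAl -scalerAr (eqP (forallP (WP0 i) j)) !scaler0.
rewrite negb_forall => /existsP[i]; rewrite negb_forall => /existsP[j ne0].
have iW : (vbasis W)`_i \in W by rewrite vbasis_mem // mem_nth // size_tuple.
have jP : (vbasis P)`_j \in P by rewrite vbasis_mem // mem_nth // size_tuple.
have [L'I ltd] := orbit_enlarge iL piK pil pP pK iW jP ne0.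
by apply: (IHn _ L'I); apply: leq_trans dL _; rewrite addnS -addSn leq_add2r.
Qed.

End FrobeniusIntegrals.

(** * Frobenius structures and nondegenerate left integrals *)

Section Nondegenerate.
Variables (K : fieldType) (H : weakHopfType K).
Local Notation "c *: v" := (@GRing.scale K _ c v) : ring_scope.
Local Notation S := (@antipode K H).
Implicit Types (V : vectType K) (x y z h w a b d L : H) (phi psi : dual H).

(** L is nondegenerate when this map from the dual to H is bijective. *)
Definition contract L phi : H := \sw_(a, b <- L) (phi b *: a).

Lemma lin_contract L : lin (contract L).
Proof. by rewrite /contract; lin. Qed.

(** The decomposition of [hopf_module_decomp] involves only integrals, and
    these are the Lw with w in the source algebra; but
    (Lw).phi = L_1 phi(S(L_2 w)) is a value of [contract]. *)
Lemma Frobenius_nondegenerate :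
  Frobenius_algebra H -> exists L : H, nondegenerate_left_integral L.
Proof.
move=> /Frobenius_casimir[c [f [cas f1]]].
have [L /integralsP iL LI] := integrals_cyclic cas f1.
exists L; split=> //.
pose T : 'Hom(dual H, H) := linfun (contract L).
have TE phi : T phi = contract L phi by rewrite linfun_lin //;
  exact: lin_contract.
suff [g gK Kg] : bijective T by exists g => x; [rewrite -[RHS]gK TE|rewrite -[RHS]Kg TE].
apply: bij_of_surj; first exact: dim_dual.
move=> y; suff /memv_imgP[phi _ ->] : y \in limg T by exists phi.
rewrite -(hopf_module_decomp y); apply: rpred_sum => i _.
have : int_proj ((vbasis {:H})`_i * y) \in (amull L @: base_s H)%VS.
  by rewrite LI; apply/integralsP/int_proj_integral.
case/orbitP=> w /base_sP ws ->.
suff -> : dual_act (L * w) (coordf i) = T (pullback (coordf i) (fun x => S (x * w))).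
  by apply: memv_img; exact: memvf.
rewrite TE /contract -ws.
rewrite /dual_act (sw_mul_eps_s _ _ (F := fun a b => coordf i (S b) *: a));
  [|lin..].
by apply: eq_tlift => a b; rewrite pullbackE //; lin.
Qed.

Lemma dual_eps_tE phi x : eps_t phi x = phi (eps_t x).
Proof.
rewrite -antipoder tlift_lfunE -[eps_t x]antipoder lfun_tlift.
transitivity (tlift (fun p q : dual H => \sw_(a, b <- x) (p a * q (S b)))
   (comul phi)).
  apply: eq_tlift => p q; rewrite dualM.
  by apply: eq_tlift => a b; rewrite [X in _ * X](dual_antipodeE q).
rewrite exchange_tlift; apply: eq_tlift => a b.
exact: tev_dual_comul.
Qed.

Section Construction.
Variable L : H.
Hypotheses (iL : left_integral L) (bL : bijective (contract L)).

(** S(h) L_1 (x) L_2 = L_1 (x) h L_2: the middle term is S(h_1) h_2 L_1 (x) h_3 L_2,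
    where h_2 L_1 (x) h_3 L_2 = Delta(h_2 L) and h_2 L = eps_t(h_2) L. *)
Lemma sw_integral_l V (F : H -> H -> V) h :
  (forall b, lin (F^~ b)) -> (forall a, lin (F a)) ->
  \sw_(a, b <- L) F (S h * a) b = \sw_(a, b <- L) F a (h * b).
Proof.
move=> l1 l2.
transitivity (\sw_(p, q <- h) \sw_(a, b <- L) F (eps_s p * a) (q * b));
  last first.
  rewrite (sw_eps_s_l _ (F := fun p q => \sw_(a, b <- L) F (p * a) (q * b)));
    [|lin..].
  transitivity (\sw_(a, b <- 1 * L) F a (h * b)); last by rewrite mul1r.
  rewrite sw_mul; [|lin..]; apply: eq_tlift => p q.
  by apply: eq_tlift => a b; rewrite mulrA.
transitivity (\sw_(p, q <- h) \sw_(p1, p2 <- p) \sw_(a, b <- L)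
   F (S p1 * (p2 * a)) (q * b)); last first.
  apply: eq_tlift => p q.
  rewrite -(sw_antipodel (f := fun y => \sw_(a, b <- L) F (y * a) (q * b)));
    [|lin].
  by apply: eq_tlift => p1 p2; apply: eq_tlift => a b; rewrite mulrA.
rewrite (sw_coassoc (F := fun p1 p2 q => \sw_(a, b <- L)
   F (S p1 * (p2 * a)) (q * b))); [|lin..].
transitivity (\sw_(p, q <- h) \sw_(a, b <- q * L) F (S p * a) b); last first.
  by apply: eq_tlift => p q; rewrite sw_mul //; lin.
rewrite -(antipode_eps_t h).
rewrite (lin_tlift_fun (F := fun y => \sw_(a, b <- L) F (y * a) b)); [|lin].
apply: eq_tlift => p q; rewrite iL.
rewrite (sw_eps_t_mul _ _ (F := fun a b => F (S p * a) b)); [|lin..].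
by apply: eq_tlift => a b; rewrite mulrA.
Qed.

Lemma contract_inj phi : contract L phi = 0 -> phi = 0.
Proof.
move=> c0; apply: (bij_inj bL); rewrite c0.
by rewrite -(scale0r (0 : dual H)) (lin_scaleE _ _ (@lin_contract L)) scale0r.
Qed.

Variable lam : dual H.
Hypothesis lam1 : contract L lam = 1.

Lemma contract_lam h : contract L (pullback lam (fun x => h * x)) = S h.
Proof.
rewrite /contract.
transitivity (\sw_(a, b <- L) (lam (h * b) *: a)).
  by apply: eq_tlift => a b; rewrite pullbackE //; lin.
rewrite -(sw_integral_l _ (F := fun a b => lam b *: a)); [|lin..].
rewrite -[RHS]mulr1 -lam1 mul_tliftr.
by apply: eq_tlift => a b; rewrite scalerAr.
Qed.

(** By [contract_lam] the kernel of S lies in that of lam, so lam = e o S for a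
    form e. Then every form psi, being contracted to some k = k L_1 e(S(L_2)) =
    L_1 e(S(L_2) k), equals e(S(-) k), and vanishes on the kernel of S. *)
Lemma antipode_inj h : S h = 0 -> h = 0.
Proof.
have kerS x : S x = 0 -> lam x = 0.
  rewrite -contract_lam => /contract_inj e.
  by rewrite -[x]mulr1 -(@pullbackE _ _ lam (fun y => x * y)) ?e ?zero_lfunE //;
    lin.
pose e : dual H := (lam \o S^-1)%VF.
have eE x : e (S x) = lam x.
  apply/eqP; rewrite comp_lfunE -subr_eq0 -linearB; apply/eqP/kerS.
  by rewrite linearB /= limg_lfunVK ?subrr // memv_img ?memvf.
move=> Sh0; apply: form_ext => psi; rewrite linear0.
pose k := contract L psi.
suff -> : psi = pullback e (fun x => S x * k).
  by rewrite pullbackE ?Sh0 ?mul0r ?linear0 //; lin.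
apply: (bij_inj bL); rewrite -/k -[LHS]mulr1 -lam1 {1}/contract mul_tliftr.
transitivity (\sw_(a, b <- L) (e (S b) *: (k * a))).
  by apply: eq_tlift => a b; rewrite eE scalerAr.
rewrite (sw_integral_r _ iL (F := fun a b => e b *: a)); [|lin..].
by apply: eq_tlift => a b; rewrite pullbackE //; lin.
Qed.

Let antipodeV := (S^-1)%VF.

Lemma antipodeVK x : S (antipodeV x) = x.
Proof.
apply: lker0_lfunVK; apply/lker0P => y z yz; apply/eqP.
by rewrite -subr_eq0; apply/eqP/antipode_inj; rewrite linearB /= yz subrr.
Qed.

Lemma antipodeKV x : antipodeV (S x) = x.
Proof.
apply/eqP; rewrite -subr_eq0; apply/eqP/antipode_inj.
by rewrite linearB /= antipodeVK subrr.
Qed.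

Lemma antipodeVM x y : antipodeV (x * y) = antipodeV y * antipodeV x.
Proof. by rewrite -[RHS]antipodeKV antipodeM !antipodeVK. Qed.

(** The element L_2 (x) S^-1(L_1); its order and inverse are chosen so that its
    counit is lam itself and not the composite of lam with S^-1, which is a right
    integral of the dual. *)
Definition int_casimir : H *t H := \sw_(a, b <- L) (b \ox antipodeV a).

Lemma tlift_int_casimir V (F : H -> H -> V) :
  (forall b, lin (F^~ b)) -> (forall a, lin (F a)) ->
  tlift F int_casimir = \sw_(a, b <- L) F b (antipodeV a).
Proof.
by move=> l1 l2; rewrite lfun_tlift;
  apply: eq_tlift => a b; rewrite lin_tlift_tens.
Qed.

Lemma int_casimirP : casimir int_casimir.
Proof.
apply: casimirP => h; rewrite !tlift_int_casimir; [|lin..].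
rewrite -(sw_integral_l _ (F := fun a b => b \ox antipodeV a)); [|lin..].
by apply: eq_tlift => a b; rewrite antipodeVM antipodeKV.
Qed.

Lemma int_casimir_form : \sweedler_(a, b <- int_casimir) (lam a *: b) = 1.
Proof.
rewrite tlift_int_casimir; [|lin..].
have -> : (1 : H) = antipodeV 1 by rewrite -{2}(antipode1 H) antipodeKV.
rewrite -lam1 lfun_tlift.
by apply: eq_tlift => a b; rewrite linearZ.
Qed.

(** With delta(x) = x_1 lam(x_2), the claim is phi(delta(x)) =
    phi(eps_t(delta(x))) for all phi. By nondegeneracy it is enough to check that
    eps_t fixes the second leg of L_1 (x) delta(L_2), and this tensor is
    Delta(L_1 lam(L_2)) = Delta(1). *)
Lemma lam_integral : left_integral lam.
Proof.
pose delta x : H := \sw_(a, b <- x) (lam b *: a).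
have key V (G : H -> H -> V) : (forall b, lin (G^~ b)) -> (forall a, lin (G a)) ->
    \sw_(a, b <- L) G a (delta b) = \sw_(a, b <- 1) G a b.
  move=> l1 l2; rewrite -lam1.
  rewrite (lin_tlift_fun (F := fun x => \sw_(a, b <- x) G a b)); [|lin].
  transitivity (\sw_(a, b <- L) \sw_(d, d' <- b) (lam d' *: G a d)).
    apply: eq_tlift => a b; rewrite (lin_tlift_fun _ _ (l2 a)).
    by apply: eq_tlift => d d'; rewrite (lin_scaleE _ _ (l2 a)).
  rewrite -(sw_coassoc (F := fun a d d' => lam d' *: G a d)); [|lin..].
  apply: eq_tlift => a b.
  rewrite (lin_scaleE (F := fun x => \sw_(a, b <- x) G a b)); [|lin].
  by rewrite tliftZ.
have ld V (g : V -> H) : lin g -> lin (fun v => delta (g v)).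
  by move=> lg; rewrite /delta; lin.
have delta_t x : eps_t (delta x) = delta x.
  apply: form_ext => chi; apply/eqP; rewrite -subr_eq0; apply/eqP.
  pose phi : dual H := linfun (fun x => chi (eps_t (delta x)) - chi (delta x)).
  have phiE y : phi y = chi (eps_t (delta y)) - chi (delta y).
    apply: (@linfun_lin _ _ _ (fun y => chi (eps_t (delta y)) - chi (delta y))).
    by apply: lin_add; [|apply: lin_opp]; apply: lin_lfun;
      [apply: lin_eps_t|]; apply: ld; lin.
  rewrite -phiE (_ : phi = 0) ?zero_lfunE //; apply: contract_inj.
  transitivity (\sw_(a, b <- L) (chi (eps_t (delta b)) *: a)
                + (-1) *: \sw_(a, b <- L) (chi (delta b) *: a)).
    rewrite addrC -tliftP; apply: eq_tlift => a b.
    by rewrite phiE scalerBl scaleN1r addrC.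
  rewrite (key _ (fun a b => chi (eps_t b) *: a)); [|lin..].
  rewrite (key _ (fun a b => chi b *: a)); [|lin..].
  rewrite (sw_eps_t_one (F := fun a b => chi b *: a)); [|lin..].
  by rewrite scaleN1r subrr.
have e phi x : (phi * lam : dual H) x = phi (delta x).
  rewrite dual_scaleM lfun_tlift; apply: eq_tlift => a b.
  by rewrite linearZ /=; exact: mulrC.
move=> phi; apply/lfunP => x; rewrite !e dual_eps_tE delta_t //.
Qed.

(** Every form on the dual is the evaluation at some y, so a kernel element
    satisfies lam(x y) = 0 for all x, and y = 0 as lam is a Frobenius form. *)
Lemma lam_nondegenerate : nondegenerate_left_integral lam.
Proof.
split; first exact: lam_integral.
pose F (Phi : dual (dual H)) : dual H :=
  tlift (fun p q : dual H => Phi q *: p) (comul lam).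
have lF : lin F by rewrite /F; lin.
pose T : 'Hom(dual (dual H), dual H) := linfun F.
have TE Phi : T Phi = F Phi by rewrite linfun_lin.
suff [g gK Kg] : bijective T by exists g => x; [rewrite -[RHS]gK TE|rewrite -[RHS]Kg TE].
apply: bij_of_inj; first exact: dim_dual.
move=> Phi; rewrite TE => F0.
(* The vector whose evaluation is Phi. *)
pose y : H := \sum_(i < \dim {:H}) Phi (coordf i) *: (vbasis {:H})`_i.
have PhiE psi : Phi psi = psi y.
  rewrite {1}(dual_sum psi) !linear_sum; apply: eq_bigr => i _.
  by rewrite !linearZ; exact: mulrC.
have lam0 x : lam (x * y) = 0.
  have := congr1 (fun phi : dual H => phi x) F0.
  rewrite zero_lfunE tlift_lfunE -tev_dual_comul => <-.
  apply: eq_tlift => p q; rewrite scale_lfunE PhiE; exact: mulrC.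
have y0 : y = 0.
  rewrite -(casimir_formr int_casimirP int_casimir_form y) tlift_sum.
  by do 2!(apply: big1 => ? _); rewrite lam0 scale0r scaler0.
by apply/lfunP => psi; rewrite PhiE y0 linear0 zero_lfunE.
Qed.

End Construction.

Lemma nondegenerate_Frobenius_coproduct L : nondegenerate_left_integral L ->
  exists (c : H *t H) (lam : dual H), [/\ casimir c,
    \sweedler_(a, b <- c) (lam a *: b) = 1 & nondegenerate_left_integral lam].
Proof.
move=> [iL bL]; have bL' : bijective (contract L) by [].
have [g _ Kg] := bL'.
exists (int_casimir L), (g 1); split.
- exact: int_casimirP iL bL' _ (Kg 1).
- exact: int_casimir_form iL bL' _ (Kg 1).
- exact: lam_nondegenerate iL bL' _ (Kg 1).
Qed.

(** The element L_1 (x) S(L_2) for a nonzero left integral L; it is nonzero since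
    counit(S(L_2)) L_1 = L. *)
Lemma ex_casimir : exists2 c : H *t H, casimir c & c != 0.
Proof.
have [L iL L0] := ex_left_integral H.
pose c : H *t H := \sw_(a, b <- L) (a \ox S b).
have cE V (F : H -> H -> V) :
    (forall b, lin (F^~ b)) -> (forall a, lin (F a)) ->
    tlift F c = \sw_(a, b <- L) F a (S b).
  by move=> l1 l2; rewrite lfun_tlift;
    apply: eq_tlift => a b; rewrite lin_tlift_tens.
exists c.
  apply: casimirP => h; rewrite !cE; [|lin..].
  by apply: (sw_integral_r _ iL (F := fun a b => a \ox b)); lin.
apply: contra_neq L0 => c0.
rewrite -[L](sw_counitr (f := fun a => a)); last by lin.
transitivity (tlift (fun a b => counit b *: a) c); last by rewrite c0 linear0.
rewrite cE; [|lin..].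
by apply: eq_tlift => a b; rewrite counit_antipode.
Qed.

End Nondegenerate.

(** * The coproduct of the theorem *)

Theorem theorem1p9 (K : fieldType) (charK0 : [pchar K] =i pred0)
    (H : weakHopfType K) :
  exists Delta : 'Hom(H, H *t H),
    [/\ Delta != 0,
        noncounital_Frobenius Delta,
        counital Delta <-> Frobenius_algebra H,
        Frobenius_algebra H <->
          (exists L : H, nondegenerate_left_integral L)
      & forall e : 'Hom(H, K^o), is_counit Delta e ->
          nondegenerate_left_integral (e : dual H)].
Proof.
have counF (D : 'Hom(H, H *t H)) :
    noncounital_Frobenius D -> counital D -> Frobenius_algebra H.
  by move=> [coD biD] cD; exists D; split.
have [[L ndL]|nL] := classic (exists L : H, nondegenerate_left_integral L).
  have [c [lam [cas lam1 ndlam]]] := nondegenerate_Frobenius_coproduct ndL.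
  have counD := casimir_is_counit cas lam1.
  have ncF := casimir_noncounital_Frobenius cas.
  have frobH : Frobenius_algebra H by exact: casimir_Frobenius cas lam1.
  exists (casimir_comul c); split=> //.
  - apply/eqP => D0; have /is_counitP[/(_ 1) + _] := counD.
    by rewrite D0 zero_lfunE linear0 => /esym/eqP; rewrite oner_eq0.
  - by split=> // _; exists lam.
  - by split=> // _; exists L.
  - by move=> e ce; rewrite (counit_uniq ce counD).
have [c cas c0] := ex_casimir H.
have ncF := casimir_noncounital_Frobenius cas.
have nF : ~ Frobenius_algebra H by move=> /Frobenius_nondegenerate.
exists (casimir_comul c); split=> //.
- apply: contra_neq c0 => D0.
  have := casimir_comulE c 1; rewrite D0 zero_lfunE => ->.
  exact/esym/mul1r.
- by split=> [/(counF _ ncF)|].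
- by move=> e ce; case: nF; apply: (counF _ ncF); exists e.
Qed.
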